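(* Let $n\ge1$ and let $H=-\Delta+V$ be the Schrödinger operator on $L^2(\mathbb R^n)$ defined in the context, where $V\in W^{1,\infty}_{\mathrm{loc}}(\mathbb R^n)$ is complex-valued and satisfies $\operatorname{Re}V\ge 0$, $|\nabla V|^2\le a+b|V|^2$ for some $a,b>0$, $|V(x)|\to\infty$ as $|x|\to\infty$, and $\operatorname{Re}V(x)\ge c|x|^2-d$ for some constants $c,d>0$. Then the one-parameter semigroup $(e^{-tH})_{t\ge0}$ generated by $-H$ is immediately compact, i.e. $e^{-tH}$ is a compact operator on $L^2(\mathbb R^n)$ for every $t>0$.
   Context: $L^2(\mathbb R^n)=L^2(\mathbb R^n,\mathbb C)$. The operator $H$ is the closure in $L^2(\mathbb R^n)$ of $-\Delta+V$ defined on $C_0^\infty(\mathbb R^n)$. Under the stated hypotheses on $V$ it is known that this closure exists and has domain $\mathcal D(H)=H^2(\mathbb R^n)\cap\{\psi\in L^2(\mathbb R^n):V\psi\in L^2(\mathbb R^n)\}$, is m-accretive (so $-H$ generates a strongly continuous contraction semigroup), and has compact resolvent. *)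

(* Defs.v *)
From HB Require Import structures.
From mathcomp Require Import all_boot all_order all_algebra.
From mathcomp Require Import complex.
From mathcomp Require Import all_classical all_reals all_analysis.
From mathcomp Require Import measurable_realfun.

Set Implicit Arguments.
Unset Strict Implicit.
Unset Printing Implicit Defensive.

Import Order.TTheory GRing.Theory Num.Theory.
Import numFieldNormedType.Exports.

Local Open Scope classical_set_scope.
Local Open Scope ring_scope.
Local Open Scope complex_scope.

(* 'rV[R]_n carries the sigma-algebra generated by its coordinates, which is
   the Borel one. *)
Definition measure_row_display : measure_display. Proof. exact. Qed.

Section measurable_row.
Variables (R : realType) (n : nat).

Let coor (i : 'I_n) (x : 'rV[R]_n) : R := x ord0 i.

Let row_set0 : g_sigma_preimage coor set0.
Proof. exact: sigma_algebra0. Qed.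

Let row_setC A : g_sigma_preimage coor A -> g_sigma_preimage coor (~` A).
Proof. exact: sigma_algebraC. Qed.

Let row_bigcup (F : (set 'rV[R]_n)^nat) :
  (forall i, g_sigma_preimage coor (F i)) -> g_sigma_preimage coor (\bigcup_i F i).
Proof. exact: sigma_algebra_bigcup. Qed.

HB.instance Definition _ := @isMeasurable.Build measure_row_display
  'rV[R]_n (g_sigma_preimage coor) row_set0 row_setC row_bigcup.

Lemma measurable_coord (i : 'I_n) :
  measurable_fun [set: 'rV[R]_n] (fun x : 'rV[R]_n => x ord0 i).
Proof.
move=> _ Y mY; rewrite setTI; apply: sub_sigma_algebra => /=.
rewrite -bigcup_seq/=; exists i => /=; first by rewrite mem_index_enum.
by exists Y => //; rewrite setTI.
Qed.

Lemma measurable_fun_rowP d (T : measurableType d) (f : T -> 'rV[R]_n) :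
  (forall i, measurable_fun [set: T] (fun t => f t ord0 i)) ->
  measurable_fun [set: T] f.
Proof.
move=> mf; apply: (@measurability _ _ _ _ _ f
  (\big[setU/set0]_(i < n) preimage_set_system setT (coor i) measurable)) => //.
move=> _ [B + <-]; rewrite -bigcup_seq => -[i _ [Y mY <-]].
by have := mf i measurableT Y mY; rewrite !setTI.
Qed.
End measurable_row.

Definition cons_row (R : realType) (n : nat) (p : (R * 'rV[R]_n)%type) : 'rV[R]_n.+1 :=
  row_mx (p.1%:M : 'M[R]_1) p.2.

Lemma measurable_cons_row (R : realType) (n : nat) :
  measurable_fun [set: (R * 'rV[R]_n)%type] (@cons_row R n).
Proof.
apply: measurable_fun_rowP => i.
have [j ->|j ->] := @split_ordP 1 n i.
  rewrite (_ : (fun _ => _) = fst); first exact: measurable_fst.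
  apply/funext => p; transitivity ((p.1%:M : 'M[R]_1) ord0 j).
    exact: row_mxEl.
  by rewrite mxE !ord1 eqxx mulr1n.
rewrite (_ : (fun _ => _) = (fun x : 'rV[R]_n => x ord0 j) \o snd).
  exact: (measurableT_comp (@measurable_coord R n j) measurable_snd).
by apply/funext => p; exact: row_mxEr.
Qed.

Section lebesgue_row.
Variable R : realType.

Definition lebesgue_cons n (m : {measure set 'rV[R]_n -> \bar R}) :
  set 'rV[R]_n.+1 -> \bar R :=
  pushforward (lebesgue_measure \x^ m)%E (@cons_row R n).

Section lebesgue_cons_measure.
Variables (n : nat) (m : {measure set 'rV[R]_n -> \bar R}).
Let mcons := @measurable_cons_row R n.

Let lebesgue_cons0 : lebesgue_cons m set0 = 0%E.
Proof. by apply: measure0. Qed.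

Let lebesgue_cons_ge0 A : (0 <= lebesgue_cons m A)%E.
Proof. by apply: measure_ge0. Qed.

Let lebesgue_cons_sigma_additive : semi_sigma_additive (lebesgue_cons m).
Proof. by apply: measure_semi_sigma_additive. Qed.

HB.instance Definition _ := isMeasure.Build _ _ _ (lebesgue_cons m)
  lebesgue_cons0 lebesgue_cons_ge0 lebesgue_cons_sigma_additive.
End lebesgue_cons_measure.

(* Lebesgue measure on R^n: the n-fold product of [lebesgue_measure]; see
   [lebesgue_row_box]. *)
Fixpoint lebesgue_row (n : nat) : {measure set 'rV[R]_n -> \bar R} :=
  match n with
  | 0%N => dirac (0 : 'rV[R]_0)
  | n'.+1 => lebesgue_cons (lebesgue_row n')
  end.

Lemma measurable_row_box n (a b : 'I_n -> R) :
  measurable [set x : 'rV[R]_n | forall i, a i <= x ord0 i <= b i].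
Proof.
rewrite (_ : mkset _ = \bigcap_(i in [set: 'I_n])
    ((fun x : 'rV[R]_n => x ord0 i) @^-1` `[a i, b i])); last first.
  apply/seteqP; split => x /= xab i; first by move=> _; rewrite /= in_itv; exact: xab.
  by have := xab i I; rewrite /= in_itv.
apply: fin_bigcap_measurable => [|i _]; first exact: finite_finset.
rewrite -[X in measurable X]setTI; apply: (@measurable_coord R n i) => //.
Qed.

Lemma lebesgue_row_box n (a b : 'I_n -> R) : (forall i, a i <= b i) ->
  lebesgue_row n [set x | forall i, a i <= x ord0 i <= b i] =
  (\prod_(i < n) (b i - a i))%:E.
Proof.
elim: n a b => [|n IH] a b ab.
  by rewrite big_ord0 /= diracE mem_set// => -[].
rewrite /= /lebesgue_cons /pushforward.
rewrite (_ : _ @^-1` _ = `[a ord0, b ord0] `*`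
    [set x : 'rV[R]_n | forall i, a (lift ord0 i) <= x ord0 i <= b (lift ord0 i)]).
  rewrite product_measure2E//; last exact: measurable_row_box.
  rewrite [X in (X * _)%E](_ : _ = (b ord0 - a ord0)%:E).
    by rewrite IH// -EFinM big_ord_recl.
  apply: etrans (lebesgue_measure_itv `[a ord0, b ord0]) _; rewrite /= lte_fin.
  have := ab ord0; rewrite le_eqVlt => /orP[/eqP ->|->//].
  by rewrite ltxx subrr.
have E0 (p : (R * 'rV[R]_n)%type) : cons_row p ord0 ord0 = p.1.
  rewrite (_ : ord0 = lshift n (ord0 : 'I_1)); last exact: val_inj.
  transitivity ((p.1%:M : 'M[R]_1) ord0 ord0); first exact: row_mxEl.
  by rewrite mxE eqxx mulr1n.
have EL (p : (R * 'rV[R]_n)%type) j : cons_row p ord0 (lift ord0 j) = p.2 ord0 j.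
  rewrite (_ : lift ord0 j = rshift 1 j); last exact: val_inj.
  exact: row_mxEr.
apply/seteqP; split => -[t x] /= tx.
  split=> [|i]; first by have := tx ord0; rewrite E0 in_itv.
  by have := tx (lift ord0 i); rewrite EL.
move=> i; have [j ->|->] := unliftP ord0 i; first by rewrite EL; exact: tx.2.
by rewrite E0; have := tx.1; rewrite in_itv.
Qed.

End lebesgue_row.

Section L2fun.
Context d (T : measurableType d) (R : realType) (mu : {measure set T -> \bar R}).
Implicit Types f g : T -> R[i].

Definition L2fun : {pred T -> R[i]} := fun f =>
  ((fun x => complex.Re (f x)) \in Lfun mu 2%:E) && ((fun x => complex.Im (f x)) \in Lfun mu 2%:E).

Let one_le2 : (1 <= 2%:E :> \bar R)%E. Proof. by rewrite lee_fin ler1n. Qed.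

Let LfunZ (a : R) u v : u \in Lfun mu 2%:E -> v \in Lfun mu 2%:E ->
  (a *: u + v) \in Lfun mu 2%:E.
Proof. exact: (@Lfun_submod_closed _ T R mu 2%:E one_le2).2. Qed.
Let Lfun0 := (@Lfun_submod_closed _ T R mu 2%:E one_le2).1.

Lemma L2fun_submod_closed : submod_closed L2fun.
Proof.
split; first by apply/andP; split; exact: Lfun0.
move=> a f g /andP[fr fi] /andP[gr gi]; apply/andP; split.
  rewrite (_ : (fun _ => _) = complex.Re a *: (fun x => complex.Re (f x)) +
      ((- complex.Im a) *: (fun x => complex.Im (f x)) + (fun x => complex.Re (g x)))).
    by apply: LfunZ => //; apply: LfunZ.
  apply/funext => x /=; rewrite !fctE /= /GRing.scale/=.
  case: a (f x) (g x) => [a1 a2] [f1 f2] [g1 g2] /=.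
  by rewrite mulNr addrA.
rewrite (_ : (fun _ => _) = complex.Re a *: (fun x => complex.Im (f x)) +
    (complex.Im a *: (fun x => complex.Re (f x)) + (fun x => complex.Im (g x)))).
  by apply: LfunZ => //; apply: LfunZ.
apply/funext => x /=; rewrite !fctE /= /GRing.scale/=.
case: a (f x) (g x) => [a1 a2] [f1 f2] [g1 g2] /=.
by rewrite addrA.
Qed.

HB.instance Definition _ := GRing.isSubmodClosed.Build R[i] (T -> R[i]) L2fun
  L2fun_submod_closed.

Record L2fun_type := L2Fun { L2fun_val :> T -> R[i]; L2fun_valP : L2fun_val \in L2fun }.
HB.instance Definition _ := [isSub for L2fun_val].
HB.instance Definition _ := [Choice of L2fun_type by <:].
HB.instance Definition _ := [SubChoice_isSubLmodule of L2fun_type by <:].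

Definition L2null : {pred L2fun_type} := fun (f : L2fun_type) => `[< {ae mu, forall x, f x = 0} >].

Lemma L2null_submod_closed : submod_closed L2null.
Proof.
split; first by apply/asboolP; apply: aeW.
move=> a f g /asboolP f0 /asboolP g0; apply/asboolP.
apply: filterS2 f0 g0 => x /= fx0 gx0.
by rewrite !fctE /= fx0 gx0 scaler0 addr0.
Qed.

HB.instance Definition _ := GRing.isSubmodClosed.Build R[i] L2fun_type L2null
  L2null_submod_closed.

Local Open Scope quotient_scope.

(* Elements are classes modulo almost everywhere equality; the coercion to
   functions picks a representative. The scalars are R[i], so that the norm
   takes its (real) values in R[i]. *)
Definition L2 : Type := @ring_quotient.Quotient.quot L2fun_type L2null.
HB.instance Definition _ := GRing.Zmodule.on L2.
HB.instance Definition _ := EqQuotient.on L2.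

Definition L2_fun (u : L2) : T -> R[i] := repr u.
Coercion L2_fun : L2 >-> Funclass.

Implicit Types (u v w : L2).

Lemma L2_piD (f g : L2fun_type) : \pi_L2 (f + g) = \pi_L2 f + \pi_L2 g.
Proof. exact: ring_quotient.Quotient.pi_add. Qed.

Lemma L2_pi_eq (f g : L2fun_type) :
  \pi_L2 f = \pi_L2 g <-> {ae mu, forall x, f x = g x}.
Proof.
have -> : (\pi_L2 f = \pi_L2 g) <-> (f - g \in L2null).
  rewrite ring_quotient.Quotient.idealrBE; split => [->//|/eqP//].
have fgE x : (f - g) x = f x - g x by [].
split => [/asboolP|] fg; last apply/asboolP; apply: filterS fg => x.
  by rewrite fgE => /eqP; rewrite subr_eq0 => /eqP.
by rewrite fgE => ->; rewrite subrr.
Qed.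

Lemma L2_reprK (f : L2fun_type) : {ae mu, forall x, (\pi_L2 f : L2) x = f x}.
Proof. by apply/L2_pi_eq; rewrite reprK. Qed.

Definition L2_scale (a : R[i]) (u : L2) : L2 := \pi_L2 (a *: repr u).

Lemma L2_piZ (a : R[i]) (f : L2fun_type) : \pi_L2 (a *: f) = L2_scale a (\pi_L2 f).
Proof.
apply/L2_pi_eq; apply: filterS (L2_reprK f) => x fx.
have aE (g : L2fun_type) : (a *: g) x = a * g x by [].
by rewrite !aE -[in LHS]fx.
Qed.

Fact L2_scaleA a b u : L2_scale a (L2_scale b u) = L2_scale (a * b) u.
Proof. by rewrite -[LHS]L2_piZ scalerA. Qed.
Fact L2_scale1 : left_id 1 L2_scale.
Proof. by move=> u; rewrite /L2_scale scale1r reprK. Qed.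
Fact L2_scaleDr : right_distributive L2_scale +%R.
Proof.
move=> a u v; rewrite -[u]reprK -[v]reprK -L2_piD.
by rewrite -(L2_piZ a (repr u + repr v)) -!L2_piZ scalerDr L2_piD.
Qed.
Fact L2_scaleDl u : {morph L2_scale^~ u : a b / a + b}.
Proof. by move=> a b; rewrite /L2_scale scalerDl L2_piD. Qed.

HB.instance Definition _ := GRing.Zmodule_isLmodule.Build R[i] L2
  L2_scaleA L2_scale1 L2_scaleDr L2_scaleDl.

Lemma normc_ge0 (z : R[i]) : 0 <= Normc.normc z.
Proof. by case: z => a b; exact: sqrtr_ge0. Qed.

Lemma measurable_normc (f : L2fun_type) :
  measurable_fun setT (fun x => Normc.normc (f x)).
Proof.
have /andP[] := L2fun_valP f; rewrite !inE => /andP[]; rewrite inE/= => mr _.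
move=> /andP[]; rewrite inE/= => mi _.
rewrite (_ : (fun _ => _) = Num.sqrt \o
    ((fun x => complex.Re (f x) ^+ 2) \+ (fun x => complex.Im (f x) ^+ 2))).
  apply: measurableT_comp.
    apply: continuous_measurable_fun; exact: sqrt_continuous.
  by apply: measurable_funD; apply: measurable_funX.
by apply/funext => x /=; case: (f x).
Qed.

Lemma le_Lnorm2 (f g : T -> R) : measurable_fun setT f -> measurable_fun setT g ->
  {ae mu, forall x, `|f x| <= `|g x|} ->
  (Lnorm mu 2%:E (EFin \o f) <= Lnorm mu 2%:E (EFin \o g))%E.
Proof.
move=> mf mg fg; rewrite unlock.
have mp (h : T -> R) : measurable_fun setT h ->
    measurable_fun setT (fun x => (`|(EFin \o h) x| `^ 2)%E : \bar R).
  move=> mh; apply/measurable_EFinP.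
  apply: (measurableT_comp (measurable_powR _)).
  exact: measurableT_comp.
apply: gt0_ler_poweR => //.
- by rewrite in_itv/= leey integral_ge0 // => x _; exact: poweR_ge0.
- by rewrite in_itv/= leey integral_ge0 // => x _; exact: poweR_ge0.
apply: ae_ge0_le_integral => //.
- by move=> x _; exact: poweR_ge0.
- exact: mp.
- by move=> x _; exact: poweR_ge0.
- exact: mp.
apply: filterS fg => x fgx _; apply: gt0_ler_poweR => //.
- by rewrite in_itv/= leey lee_fin normr_ge0.
- by rewrite in_itv/= leey lee_fin normr_ge0.
Qed.

Definition L2norm (f : T -> R[i]) : R :=
  fine (Lnorm mu 2%:E (fun x => (Normc.normc (f x))%:E)).

Lemma L2norm_fin (f : L2fun_type) :
  (Lnorm mu 2%:E (fun x => (Normc.normc (f x))%:E) < +oo)%E.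
Proof.
have /andP[] := L2fun_valP f; rewrite !inE => /andP[]; rewrite !inE/= => mr fr.
move=> /andP[]; rewrite !inE/= => mi fi.
have mR : measurable_fun setT (fun x => `|complex.Re (f x)|).
  exact: measurableT_comp.
have mI : measurable_fun setT (fun x => `|complex.Im (f x)|).
  exact: measurableT_comp.
apply: (@le_lt_trans _ _ (Lnorm mu 2%:E (EFin \o
    ((fun x => `|complex.Re (f x)|) \+ (fun x => `|complex.Im (f x)|))))).
  apply: le_Lnorm2; first exact: measurable_normc.
    exact: measurable_funD.
  apply: aeW => x /=; rewrite [leRHS]ger0_norm ?addr_ge0//.
  case: (f x) => a b /=; rewrite ger0_norm ?sqrtr_ge0//.
  rewrite -[leRHS]ger0_norm ?addr_ge0// -sqrtr_sqr ler_sqrt ?sqr_ge0//.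
  rewrite sqrrD !real_normK ?num_real// lerD2r lerDl mulrn_wge0//.
apply: le_lt_trans (eminkowski _ mR mI one_le2) _.
rewrite lte_add_pinfty//.
  by have := fr; rewrite /finite_norm -Lnorm_abse.
by have := fi; rewrite /finite_norm -Lnorm_abse.
Qed.

Lemma L2normE (f : L2fun_type) :
  (L2norm f)%:E = Lnorm mu 2%:E (fun x => (Normc.normc (f x))%:E).
Proof.
by rewrite /L2norm fineK// fin_numElt (lt_le_trans ltNy0) ?Lnorm_ge0//= L2norm_fin.
Qed.

Lemma L2norm_ae (f g : L2fun_type) : {ae mu, forall x, f x = g x} ->
  L2norm f = L2norm g.
Proof.
move=> fg; apply/eqP; rewrite -eqe !L2normE eq_le; apply/andP; split;
  apply: le_Lnorm2; do ?exact: measurable_normc.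
  by apply: filterS fg => x ->.
by apply: filterS fg => x ->.
Qed.

Lemma L2normD (f g : L2fun_type) : L2norm (f + g) <= L2norm f + L2norm g.
Proof.
rewrite -lee_fin EFinD !L2normE.
apply: le_trans (eminkowski _ (measurable_normc f) (measurable_normc g) one_le2).
apply: le_Lnorm2; first exact: measurable_normc.
  by apply: measurable_funD; exact: measurable_normc.
apply: aeW => x /=; rewrite !ger0_norm ?addr_ge0 ?normc_ge0//.
exact: le_normcD.
Qed.

Lemma L2normZ (a : R[i]) (f : L2fun_type) :
  L2norm (a *: f) = Normc.normc a * L2norm f.
Proof.
have hP : (fun x => Normc.normc (f x)) \in Lfun mu 2%:E.
  apply/andP; split; rewrite inE /=; first exact: measurable_normc.
  exact: L2norm_fin.
apply: EFin_inj; rewrite EFinM !L2normE.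
have := LnormZ (Lfun_Sub one_le2 hP) (Normc.normc a).
rewrite ger0_norm ?normc_ge0// => <-.
by apply: eq_Lnorm => x; exact: (congr1 EFin (Normc.normcM a (f x))).
Qed.

Lemma L2_funD u v : {ae mu, forall x, (u + v : L2) x = u x + v x}.
Proof.
have -> : u + v = \pi_L2 (repr u + repr v) by rewrite L2_piD !reprK.
exact: L2_reprK.
Qed.

Lemma L2_funZ a u : {ae mu, forall x, (a *: u : L2) x = a * u x}.
Proof. exact: L2_reprK. Qed.

Definition L2_norm (u : L2) : R[i] := (L2norm u)%:C.

Fact L2_ler_normD u v : L2_norm (u + v) <= L2_norm u + L2_norm v.
Proof.
rewrite /L2_norm -rmorphD /= lecR.
rewrite (@L2norm_ae (repr (u + v)) (repr u + repr v)); last exact: L2_funD.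
exact: L2normD.
Qed.

Fact L2_normrZ a u : L2_norm (a *: u) = `|a| * L2_norm u.
Proof.
rewrite /L2_norm (_ : `|a| = (Normc.normc a)%:C)// -rmorphM /=; congr (_%:C).
rewrite -L2normZ; apply: L2norm_ae; exact: L2_funZ.
Qed.

Fact L2_normr0_eq0 u : L2_norm u = 0 -> u = 0.
Proof.
move=> /(congr1 (@complex.Re R)) /= u0.
have uN : Lnorm mu 2%:E (fun x => (Normc.normc (u x))%:E) = 0%E.
  by rewrite -L2normE u0.
have := Lnorm_eq0_eq0 _ _ uN.
have mu2 : measurable_fun setT (fun x => (Normc.normc (u x))%:E).
  by apply/measurable_EFinP; exact: measurable_normc.
move=> /(_ mu2 (lt_le_trans lte01 one_le2)) ae0.
rewrite -[u]reprK -[0]reprK; apply/L2_pi_eq.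
have z0 : {ae mu, forall x, (0 : L2) x = 0}.
  have -> : (0 : L2) = 0 *: 0 by rewrite scale0r.
  by apply: filterS (L2_funZ 0 0) => x ->; rewrite mul0r.
apply: filterS2 ae0 z0 => x /(_ I) [] /Normc.eq0_normc ux zx.
by rewrite -[RHS]/(L2_fun 0 x) zx.
Qed.

HB.instance Definition _ := Lmodule_isNormed.Build R[i] L2
  L2_ler_normD L2_normrZ L2_normr0_eq0.

Lemma L2_normE u : `|u| = (L2norm u)%:C.
Proof. by []. Qed.

End L2fun.

Section operators.
Variables (R : realType) (X : normedModType R[i]).

Definition compact_operator (S : {linear X -> X}) : Prop :=
  forall B : set X, bounded_set B -> precompact (S @` B).

(* Only the values of [T] at nonnegative times are meaningful. *)
Definition C0_semigroup (T : R -> {linear X -> X}) : Prop :=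
  [/\ forall t, 0 <= t -> continuous (T t),
      forall u, T 0 u = u,
      forall s t u, 0 <= s -> 0 <= t -> T (s + t) u = T s (T t u) &
      forall u, T h u @[h --> 0^'+] --> u].

(* Unbounded operators are given by their graphs. *)
Definition generator (T : R -> {linear X -> X}) : set (X * X) :=
  [set p | (h^-1)%:C *: (T h p.1 - p.1) @[h --> 0^'+] --> p.2].

Definition opp_operator (A : set (X * X)) : set (X * X) :=
  [set p | A (p.1, - p.2)].

End operators.

Section schrodinger.
Variables (R : realType) (n : nat).
Local Notation E := 'rV[R]_n.
Local Notation mu := (lebesgue_row R n).
Local Notation L2Rn := (L2 mu).
Implicit Types (f g phi : E -> R) (V W : E -> R[i]).

(* ['rV[R]_n] is normed by the sup norm in the library. *)
Definition euclid (x : E) : R := Num.sqrt (\sum_(i < n) x ord0 i ^+ 2).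

Definition partial (i : 'I_n) f (x : E) : R := 'D_(delta_mx ord0 i) f x.

Fixpoint Cdiff (k : nat) f : Prop :=
  match k with
  | 0%N => continuous f
  | k'.+1 => continuous f /\
      forall i, (forall x, derivable f x (delta_mx ord0 i)) /\ Cdiff k' (partial i f)
  end.

Definition test_fun phi : Prop :=
  (forall k, Cdiff k phi) /\ compact (closure [set x | phi x != 0]).

Definition Cre V : E -> R := fun x => complex.Re (V x).
Definition Cim V : E -> R := fun x => complex.Im (V x).

Definition ctest_fun (phi : E -> R[i]) : Prop :=
  test_fun (Cre phi) /\ test_fun (Cim phi).

Definition laplacian f (x : E) : R := \sum_(i < n) partial i (partial i f) x.

Definition claplacian (phi : E -> R[i]) (x : E) : R[i] :=
  laplacian (Cre phi) x +i* laplacian (Cim phi) x.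

(* The graph of - Delta + V with domain C_0^oo. *)
Definition schrodinger_min V : set (L2Rn * L2Rn) :=
  [set p : L2Rn * L2Rn | exists phi : E -> R[i], [/\ ctest_fun phi,
     {ae mu, forall x, p.1 x = phi x} &
     {ae mu, forall x, p.2 x = - claplacian phi x + V x * phi x}]].

(* The closure of an operator is the closure of its graph. *)
Definition schrodinger V : set (L2Rn * L2Rn) := closure (schrodinger_min V).

Definition Linfty_loc V : Prop :=
  [/\ measurable_fun setT (Cre V), measurable_fun setT (Cim V) &
      forall K : set E, compact K ->
        exists M : R, {ae mu, forall x, K x -> Normc.normc (V x) <= M}].

Definition weak_partial (i : 'I_n) f g : Prop :=
  forall phi, test_fun phi ->
    \int[mu]_x (f x * partial i phi x) = - \int[mu]_x (g x * phi x).

Definition weak_gradient V (DV : 'I_n -> E -> R[i]) : Prop :=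
  forall i, weak_partial i (Cre V) (Cre (DV i)) /\
            weak_partial i (Cim V) (Cim (DV i)).

(* V belongs to W^{1,oo}_loc, with weak gradient DV. *)
Definition W1infty_loc V (DV : 'I_n -> E -> R[i]) : Prop :=
  [/\ Linfty_loc V, forall i, Linfty_loc (DV i) & weak_gradient V DV].

End schrodinger.

(* Main.v *)
Require Import Defs.
From HB Require Import structures.
From mathcomp Require Import all_boot all_order all_algebra.
From mathcomp Require Import complex ring lra.
From mathcomp Require Import all_classical all_reals all_analysis.
From mathcomp Require Import measurable_realfun.
Import Order.TTheory GRing.Theory Num.Theory.
Import numFieldNormedType.Exports.
Local Open Scope classical_set_scope.
Local Open Scope ring_scope.
Local Open Scope complex_scope.

Set Implicit Arguments.
Unset Strict Implicit.
Unset Printing Implicit Defensive.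

(* For [u0] in the domain of [H], the square of the norm of [u s = T s u0] has
   right derivative [- 2 Re <H (u s), u s>].  As it stays nonnegative, some [s]
   in [[0, t]] satisfies [Re <H (u s), u s> <= C], with [C] depending only on [t]
   and a bound on [u0].  On test functions, [Re <H phi, phi>] is at least
   [|grad phi|^2 + c |x phi|^2 - d |phi|^2], so [u s] lies in the closure of a set
   of test functions with bounded gradient and bounded second moment; this
   closure [K] is compact, by the Poincare inequality on the cells of a grid.
   Hence [T t u0 = T (t - s) (u s)] belongs to the compact set
   [{T r k | 0 <= r <= t, k in K}], and the domain of [H] is dense. *)

(** The time [s] at which the energy is bounded depends on [u0]. This is harmless because one
    compact [K] serves every [u0] of a bounded set and the orbits issued from [K] sweep out a
    compact set; no smoothing at a prescribed time and no norm continuity of [T] enters. The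
    condition $\mathrm{Re}\langle Hv,v\rangle\ge C$ is expressed, with $w=-Hv$, as
    $\|v+hw\|^2\le\|v\|^2-2Ch+h^2\|w\|^2$ for $h>0$. It mentions norms only, so the semigroup
    argument runs in a complete normed space without inner product. It is also closed in $(v,w)$:
    elements of the domain of $H$ are known only as graph limits of test functions, and the energy
    identity is proved on test functions and carried to the closure in this form. [C0_semigroup]
    contains no growth bound; the bound of [T] on $[0,t]$ comes from uniform boundedness, hence the
    role of completeness. *)

Section real_norm.
Variables (R : realType) (X : normedModType R[i]).
Implicit Types u v w : X.

(* The norm of [X] takes its values in [R[i]]; this is the same number in [R]. *)
Definition rnorm u : R := complex.Re `|u|.

Lemma rnormE u : `|u| = (rnorm u)%:C.
Proof.
by rewrite RRe_real ?normr_real.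
Qed.

Lemma rnorm_ge0 u : 0 <= rnorm u.
Proof. by rewrite -lecR -rnormE normr_ge0. Qed.

Lemma rnormD u v : rnorm (u + v) <= rnorm u + rnorm v.
Proof. by rewrite -lecR rmorphD /= -!rnormE ler_normD. Qed.

Lemma rnormN u : rnorm (- u) = rnorm u.
Proof. by rewrite /rnorm normrN. Qed.

Lemma rnormB u v : rnorm (u - v) = rnorm (v - u).
Proof. by rewrite /rnorm distrC. Qed.

Lemma rnorm0 : rnorm 0 = 0.
Proof. by rewrite /rnorm normr0. Qed.

Lemma rnorm_eq0 u : rnorm u = 0 -> u = 0.
Proof. by move=> u0; apply/normr0_eq0; rewrite rnormE u0. Qed.

Lemma rnormZ (a : R) u : rnorm (a%:C *: u) = `|a| * rnorm u.
Proof.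
suff : (rnorm (a%:C *: u))%:C = (`|a| * rnorm u)%:C by case.
rewrite -rnormE rmorphM /= -rnormE normrZ; congr (_ * _).
by rewrite normc_def /= expr0n addr0 sqrtr_sqr.
Qed.

Lemma rnorm_sum (I : Type) (r : seq I) (F : I -> X) :
  rnorm (\sum_(i <- r) F i) <= \sum_(i <- r) rnorm (F i).
Proof.
elim/big_ind2 : _ => //; first by rewrite rnorm0.
by move=> u a v b ua vb; apply: le_trans (rnormD _ _) _; exact: lerD.
Qed.

(** In the order of [R[i]] the condition [0 < e] forces [e] to be real, so real radii suffice. *)
Lemma cvg_rnormP (T : Type) (F : set_system T) (FF : Filter F) (f : T -> X) u :
  f @ F --> u <-> forall e : R, 0 < e -> \forall x \near F, rnorm (f x - u) < e.
Proof.
split=> [/cvgrPdist_lt fu e e0|fu].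
  have e0' : 0 < e%:C by rewrite ltcR.
  by apply: filterS (fu _ e0') => x; rewrite distrC rnormE ltcR.
apply/cvgrPdist_lt => e e0; have eE : (complex.Re e)%:C = e by rewrite RRe_real ?gtr0_real.
have e0' : 0 < complex.Re e by rewrite -ltcR eE.
by apply: filterS (fu _ e0') => x; rewrite distrC rnormE -[in X in _ -> X]eE ltcR.
Qed.

Lemma nbhs_rnormP u (A : set X) :
  nbhs u A <-> exists2 e : R, 0 < e & forall v, rnorm (v - u) < e -> A v.
Proof.
split=> [/nbhs_normP[e /= e0 eA]|[e e0 eA]].
  have eE : (complex.Re e)%:C = e by rewrite RRe_real ?gtr0_real.
  exists (complex.Re e); first by rewrite -ltcR eE.
  by move=> v vu; apply: eA => /=; rewrite distrC rnormE -eE ltcR.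
apply/nbhs_normP; exists e%:C => /=; first by rewrite ltcR.
by move=> v /=; rewrite distrC rnormE ltcR; exact: eA.
Qed.

Lemma closure_rnormP (A : set X) u :
  closure A u <-> forall e : R, 0 < e -> exists2 v, A v & rnorm (v - u) < e.
Proof.
split=> [cAu e e0|h B /nbhs_rnormP[e e0 eB]]; last first.
  by have [v Av vu] := h e e0; exists v; split => //; exact: eB.
have [v [Av vu]] := cAu _ (proj2 (nbhs_rnormP u [set v | rnorm (v - u) < e])
  (ex_intro2 _ _ e e0 (fun v h => h))).
by exists v.
Qed.

Lemma rnorm_continuous : continuous rnorm.
Proof.
move=> u; apply/cvgrPdist_lt => e e0; apply/nbhs_rnormP; exists e => // v vu.
have h1 := rnormD (v - u) u; have h2 := rnormD (u - v) v.
move: h1 h2; rewrite !subrK (rnormB u) => h1 h2.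
by rewrite ltr_norml; apply/andP; split; lra.
Qed.

Lemma linear_rnorm_bounded (f : {linear X -> X}) : continuous f ->
  exists2 C : R, 0 <= C & forall u, rnorm (f u) <= C * rnorm u.
Proof.
move=> cf.
have /cvg_rnormP/(_ 1 ltr01)/nbhs_rnormP[e e0 fe] := cf 0.
exists (2 / e) => [|u]; first by rewrite divr_ge0 ?ltW.
have [u0|u0] := eqVneq (rnorm u) 0.
  by rewrite (rnorm_eq0 u0) linear0 rnorm0 mulr0.
have up : 0 < rnorm u by rewrite lt_neqAle eq_sym u0 rnorm_ge0.
(* [u] is rescaled to norm [e / 2], inside the ball on which [f] has norm less than 1. *)
have := fe ((e / (2 * rnorm u))%:C *: u).
rewrite (linear0 f) !subr0 linearZ !rnormZ ger0_norm; last first.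
  by rewrite divr_ge0 ?mulr_ge0 ?rnorm_ge0 ?ltW.
have -> : e / (2 * rnorm u) * rnorm u = e / 2 by field.
have h : e / 2 < e by lra.
move=> /(_ h)/ltW.
rewrite -ler_pdivlMl ?divr_gt0 ?mulr_gt0//.
by have -> : (e / (2 * rnorm u))^-1 * 1 = 2 / e * rnorm u by field; rewrite gt_eqF.
Qed.

End real_norm.

(** * Completeness and the uniform boundedness principle *)

Section uniform_boundedness.
Variables (R : realType) (X : normedModType R[i]).
Implicit Types (u v x : X) (f : {linear X -> X}).

Definition seq_lim (u : nat -> X) (l : X) :=
  forall e : R, 0 < e -> exists K, forall k, (K <= k)%N -> rnorm (u k - l) < e.

Definition geo_cauchy (u : nat -> X) :=
  forall k, rnorm (u k.+1 - u k) <= 4^-1 ^+ k.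

(** Completeness is tested only on sequences with steps at most $4^{-k}$. Such sequences have
    summable weighted differences in [L2], and the gliding hump produces them directly;
    [geo_complete_cauchy] recovers the limits of all Cauchy sequences. *)
Definition geo_complete :=
  forall u : nat -> X, geo_cauchy u -> exists l, seq_lim u l.

(** The constant is the geometric tail $\sum_{j\ge k}4^{-j}=\frac43\,4^{-k}$; [step] is its finite
    form, before the limit. *)
Lemma geo_rate (u : nat -> X) l : geo_cauchy u -> seq_lim u l ->
  forall k, rnorm (u k - l) <= 4 / 3 * 4^-1 ^+ k.
Proof.
move=> cu ul k.
have step m : rnorm (u (k + m)%N - u k) <= 4 / 3 * (4^-1 ^+ k - 4^-1 ^+ (k + m)).
  elim: m => [|m IH]; first by rewrite addn0 !subrr rnorm0 mulr0.
  rewrite addnS -[u (k + m).+1](subrK (u (k + m)%N)) -addrA.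
  apply: le_trans (rnormD _ _) _.
  have := cu (k + m)%N; rewrite exprS; lra.
apply/ler_addgt0Pr => e e0; have [K Kl] := ul _ e0.
have h1 := ltW (Kl (k + K)%N (leq_addl _ _)); have h2 := step K.
have -> : u k - l = (u k - u (k + K)%N) + (u (k + K)%N - l) by rewrite addrA subrK.
apply: le_trans (rnormD _ _) _; rewrite rnormB.
have : 0 <= 4^-1 ^+ (k + K) :> R by rewrite exprn_ge0.
lra.
Qed.

Lemma geo_complete_cauchy (u : nat -> X) : geo_complete ->
  (forall e : R, 0 < e -> exists K, forall k, (K <= k)%N -> rnorm (u k - u K) < e) ->
  exists l, seq_lim u l.
Proof.
move=> cX cu.
(* Half of $4^{-k}$, because two terms will be compared through [u (K k)]. *)
have e0 k : 0 < 4^-1 ^+ k / 2 :> R by rewrite divr_gt0 ?exprn_gt0.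
have [K Ku] := choice (fun k => cu _ (e0 k)).
(* The running maximum of [K]: both [M k] and [M k.+1] lie beyond [K k], so consecutive terms of the
   subsequence are within $4^{-k}$. *)
pose M := fix M k := if k is k'.+1 then maxn (M k') (K k) else K 0%N.
have KM k : (K k <= M k)%N by case: k => //= k; rewrite leq_maxr.
have MM k : (M k <= M k.+1)%N by rewrite /= leq_maxl.
have dist k m : (K k <= m)%N -> rnorm (u m - u (M k)) <= 4^-1 ^+ k.
  move=> km; have h1 := ltW (Ku k _ km); have h2 := ltW (Ku k _ (KM k)).
  have -> : u m - u (M k) = (u m - u (K k)) + (u (K k) - u (M k)) by rewrite addrA subrK.
  apply: le_trans (rnormD _ _) _; rewrite (rnormB (u (K k))); lra.
have [|l Ml] := cX (u \o M).
  by move=> k /=; apply: dist; rewrite -/(M k.+1) (leq_trans (KM k)).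
exists l => e e0'; have e2 : 0 < e / 2 by rewrite divr_gt0.
have [k1 k1l] := Ml _ e2.
have /cvgrPdist_lt/(_ _ e2)[k2 _ k2l] : (4^-1 ^+ k : R) @[k --> \oo] --> (0 : R).
  by apply: cvg_expr; rewrite ger0_norm // invf_lt1 // ltr1n.
pose k := maxn k1 k2; exists (K k) => m km.
have h1 := k1l k (leq_maxl _ _); have h2 := dist _ _ km.
have := k2l k (leq_maxr _ _); rewrite /= sub0r normrN ger0_norm ?exprn_ge0 // => h3.
have -> : u m - l = (u m - u (M k)) + (u (M k) - l) by rewrite addrA subrK.
apply: le_lt_trans (rnormD _ _) _.
by move: h1 => /= h1; lra.
Qed.

(** [C] is the operator norm, a supremum over the unit ball that need not be attained; the factor
    9/10 makes up for this. *)
Lemma near_maximizer f (A : R) : continuous f -> 0 < A ->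
  (exists u, A * rnorm u < rnorm (f u)) ->
  exists2 C : R, A <= C & (forall u, rnorm (f u) <= C * rnorm u) /\
    exists2 u, rnorm u <= 1 & 9 / 10 * C <= rnorm (f u).
Proof.
move=> /linear_rnorm_bounded[B B0 fB] A0 [u0 u0A].
pose S := [set rnorm (f u) | u in [set u | rnorm u <= 1]].
have hS : has_sup S.
  split; first by exists (rnorm (f 0)); exists 0 => //=; rewrite rnorm0.
  exists B => _ [u /= u1 <-]; apply: le_trans (fB u) _.
  by rewrite -[leRHS]mulr1 ler_wpM2l.
have fS u : rnorm (f u) <= sup S * rnorm u.
  have [/rnorm_eq0 ->|un0] := eqVneq (rnorm u) 0.
    by rewrite linear0 rnorm0 mulr0.
  have up : 0 < rnorm u by rewrite lt_neqAle eq_sym un0 rnorm_ge0.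
  have Su : S (rnorm (f ((rnorm u)^-1%:C *: u))).
    exists ((rnorm u)^-1%:C *: u) => //=.
    by rewrite rnormZ ger0_norm ?invr_ge0 ?rnorm_ge0 // mulVf.
  have := ub_le_sup (proj2 hS) Su.
  by rewrite linearZ /= rnormZ ger0_norm ?invr_ge0 ?rnorm_ge0 // ler_pdivrMl // mulrC.
have AS : A <= sup S.
  have u0p : 0 < rnorm u0.
    rewrite lt_neqAle rnorm_ge0 andbT eq_sym; apply/eqP => /rnorm_eq0 z.
    by move: u0A; rewrite z linear0 rnorm0 mulr0 ltxx.
  by have := lt_le_trans u0A (fS u0); rewrite ltr_pM2r // => /ltW.
exists (sup S) => //; split => //.
have e0 : 0 < 1 / 10 * sup S by rewrite mulr_gt0 // (lt_le_trans A0).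
have [_ [u /= u1 <-] hu] := sup_adherent e0 hS.
by exists u => //; lra.
Qed.

(* Gliding hump: a point at which the operators blow up is the limit of a
   sequence whose n-th step, of size [4^-n], makes the n-th operator large. *)
Lemma uniform_boundedness (f : nat -> {linear X -> X}) : geo_complete ->
  (forall k, continuous (f k)) ->
  (forall u, exists B, forall k, rnorm (f k u) <= B) ->
  exists k, forall u, rnorm (f k u) <= 16 ^+ k * rnorm u.
Proof.
move=> cX cf bf; apply: contrapT => /forallNP nf.
have /choice[C Ch] : forall k, exists C, 16 ^+ k <= C /\
    ((forall u, rnorm (f k u) <= C * rnorm u) /\
    exists2 u, rnorm u <= 1 & 9 / 10 * C <= rnorm (f k u)).
  move=> k; have p16 : 0 < 16 ^+ k :> R by rewrite exprn_gt0.
  have [|C C1 C2] := near_maximizer (cf k) p16.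
  - by have /existsNP[u /negP] := nf k; rewrite -ltNge => fu; exists u.
  - by exists C.
have /choice[g gh] : forall k, exists g : X -> X, forall x, rnorm (g x - x) <= 4^-1 ^+ k /\
    9 / 10 * C k * 4^-1 ^+ k <= rnorm (f k (g x)).
  move=> k; suff /choice[g gP] : forall x, exists y, rnorm (y - x) <= 4^-1 ^+ k /\
      9 / 10 * C k * 4^-1 ^+ k <= rnorm (f k y) by exists g.
  move=> x.
  have [_ [_ [u u1 uC]]] := Ch k; pose r : R := 4^-1 ^+ k.
  have r0 : 0 < r by rewrite exprn_gt0.
  have d s : `|s| = 1 -> rnorm (x + (s * r)%:C *: u - x) <= r.
    move=> s1; rewrite addrAC subrr add0r rnormZ normrM s1 mul1r ger0_norm ?(ltW r0) //.
    by rewrite -[leRHS]mulr1 ler_wpM2l ?(ltW r0).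
  (* The images of $x+ru$ and $x-ru$ differ by $2r f_k(u)$, so one of them has norm at least
     $r\|f_k(u)\|$. This is the point chosen for [g k x]. *)
  have h : 2 * r * rnorm (f k u) <= rnorm (f k (x + (1 * r)%:C *: u)) +
      rnorm (f k (x + (-1 * r)%:C *: u)).
    rewrite -[rnorm (f k (x + (-1 * r)%:C *: u))]rnormN.
    apply: le_trans (rnormD _ _); rewrite -linearB /= opprD addrACA subrr add0r.
    rewrite -scalerBl -rmorphB /= (_ : 1 * r - -1 * r = 2 * r); last by ring.
    by rewrite linearZ /= rnormZ ger0_norm // mulr_ge0 ?(ltW r0).
  have r0' := ltW r0; have := ler_wpM2l r0' uC => h2.
  have [h3|h3] := leP (9 / 10 * C k * r) (rnorm (f k (x + (1 * r)%:C *: u))).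
    by exists (x + (1 * r)%:C *: u); rewrite d ?normr1.
  exists (x + (-1 * r)%:C *: u); rewrite d ?normrN ?normr1 //; split => //; rewrite -/r; nra.
pose x := fix x k := if k is k'.+1 then g k' (x k') else 0.
have cx : geo_cauchy x by move=> k; have [] := gh k (x k).
have [l xl] := cX _ cx; have [B fB] := bf l.
(* The later steps move the point by at most $\frac13 4^{-k}$, so
   $\|f_k(l)\|\ge(\frac9{10}-\frac13)C_k4^{-k}$, and $C_k\ge16^k$ leaves at least $4^k/2$. *)
have bound k : 4 ^+ k / 2 <= B.
  apply: le_trans (fB k); have [C16 [fC _]] := Ch k.
  have [_] := gh k (x k); rewrite -/(x k.+1) => h1.
  have h2 := geo_rate cx xl k.+1; have h3 := fC (x k.+1 - l).
  have h4 : rnorm (f k (x k.+1)) <= rnorm (f k (x k.+1 - l)) + rnorm (f k l).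
    by rewrite -[in leLHS](subrK l (x k.+1)) linearD rnormD.
  move: h2; rewrite exprS => h2.
  have r0 : 0 < 4^-1 ^+ k :> R by rewrite exprn_gt0.
  have C0 : 0 < C k by apply: lt_le_trans C16; rewrite exprn_gt0.
  have h5 : C k * rnorm (x k.+1 - l) <= C k * (1 / 3 * 4^-1 ^+ k).
    by rewrite ler_wpM2l ?(ltW C0) //; lra.
  have h6 : 4 ^+ k <= C k * 4^-1 ^+ k.
    apply: le_trans (ler_wpM2r (ltW r0) C16); rewrite -exprMn.
    by rewrite (_ : 16 * 4^-1 = 4) //; field.
  nra.
have := bound (Num.truncn (2 * B)).+1; apply/negP; rewrite -ltNge.
have h : 2 * B < (Num.truncn (2 * B)).+1%:R by rewrite truncnS_gt.
have h2 : (Num.truncn (2 * B)).+1%:R < 4 ^+ (Num.truncn (2 * B)).+1 :> R.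
  by rewrite -natrX ltr_nat ltn_expl.
lra.
Qed.
End uniform_boundedness.

(** * Semigroups *)

Section right_derivative.
Variable R : realType.

Lemma near_at_right0P (P : set R) :
  (\forall h \near 0^'+, P h) <-> exists2 d : R, 0 < d & forall h, 0 < h < d -> P h.
Proof.
rewrite /at_right near_withinE; split=> [/nbhs_ballP[d /= d0 dP]|[d d0 dP]].
  by exists d => // h /andP[h0 hd]; apply: dP => //=; rewrite /ball /= sub0r normrN gtr0_norm.
apply/nbhs_ballP; exists d => //= h; rewrite /ball /= sub0r normrN => hd h0.
by apply: dP; rewrite h0 -(gtr0_norm h0).
Qed.

(** Continuous induction on the set [S] of times at which the estimate holds. The first hypothesis,
    a semicontinuity from the left, puts [sup S] in [S]; the second pushes past every time before
    [t]. Only forward increments of [f] are controlled, since a generator yields right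
    derivatives. *)
Lemma right_derivative_le (f : R -> R) (t C : R) : 0 <= t ->
  (forall s, 0 < s <= t -> forall e, 0 < e ->
    exists2 d : R, 0 < d & forall r, 0 <= r < s -> s - d < r -> f s - f r < e) ->
  (forall s, 0 <= s < t ->
    exists2 d : R, 0 < d & forall h, 0 < h < d -> f (s + h) <= f s - C * h) ->
  f t <= f 0 - C * t.
Proof.
move=> t0 fl fr.
pose S := [set s : R | 0 <= s <= t /\ f s <= f 0 - C * s].
have S0 : S 0 by split; rewrite ?lexx //= mulr0 subr0.
have hS : has_sup S by split; [exists 0|exists t => s [/andP[]]].
pose z := sup S.
have z0 : 0 <= z by exact: (ub_le_sup (proj2 hS)).
have zt : z <= t by apply: ge_sup => [|s [/andP[]] //]; exists 0.
have Sz : S z.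
  split; first by rewrite z0.
  have [->|zn0] := eqVneq z 0; first by case: S0.
  have zp : 0 < z by rewrite lt_neqAle eq_sym zn0.
  apply/ler_addgt0Pr => e e0; have e2 : 0 < e / 2 by rewrite divr_gt0.
  have [|d d0 dz] := fl z _ _ e2; first by rewrite zp.
  (* The second term keeps the variation of [C * s] between [r] and [z] below [e / 2]. *)
  pose d' := Num.min d (e / 2 / (`|C| + 1)).
  have C1 : 0 < `|C| + 1 by rewrite ltr_wpDl.
  have d'0 : 0 < d' by rewrite lt_min d0 divr_gt0.
  have [r [/andP[r0 rt] fr0] zr] := sup_adherent d'0 hS.
  have rz : r <= z by apply: (ub_le_sup (proj2 hS)); split => //; rewrite r0.
  have [rz'|rz'] := eqVneq r z; first by rewrite -rz'; lra.
  have rz2 : r < z by rewrite lt_neqAle rz'.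
  have := dz r; rewrite r0 rz2 => /(_ isT).
  rewrite -/z in zr; have d'd : d' <= d by rewrite ge_min lexx.
  have d'e : d' * (`|C| + 1) <= e / 2 by rewrite -ler_pdivlMr // ge_min lexx orbT.
  have Cz : C * (z - r) <= (`|C| + 1) * (z - r).
    by rewrite ler_wpM2r ?subr_ge0 // (le_trans (ler_norm _)) // lerDl.
  have : (`|C| + 1) * (z - r) <= (`|C| + 1) * d' by rewrite ler_wpM2l ?(ltW C1) //; lra.
  move=> h2 /(_ ltac:(lra)); lra.
have [zlt|] := ltP z t; last by move=> tz; have <- : z = t by [lra]; case: Sz.
have [|d d0 dz] := fr z; first by rewrite z0.
pose h := Num.min (d / 2) (t - z).
have h0 : 0 < h by rewrite lt_min divr_gt0 //= subr_gt0.
have h1 : h <= d / 2 by rewrite ge_min lexx.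
have h2 : h <= t - z by rewrite ge_min lexx orbT.
have : z + h <= z.
  apply: (ub_le_sup (proj2 hS)); split; first by apply/andP; split; lra.
  have := dz h; rewrite h0 /= => /(_ ltac:(lra)).
  by case: Sz; lra.
lra.
Qed.
End right_derivative.

Section semigroup.
Variables (R : realType) (X : normedModType R[i]) (T : R -> {linear X -> X}).
Hypotheses (cX : geo_complete X) (T_sg : C0_semigroup T).
Implicit Types (u v w : X) (s t h : R).

Let T_cont t : 0 <= t -> continuous (T t). Proof. by case: T_sg => h _ _ _; exact: h. Qed.
Let T0 u : T 0 u = u. Proof. by case: T_sg. Qed.
Let TD u s t : 0 <= s -> 0 <= t -> T (s + t) u = T s (T t u).
Proof. by case: T_sg => _ _ h _; exact: h. Qed.

Lemma semigroup_right u (e : R) : 0 < e ->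
  exists2 d : R, 0 < d & forall h, 0 <= h < d -> rnorm (T h u - u) < e.
Proof.
case: T_sg => _ _ _ /(_ u)/cvg_rnormP Tu e0.
have /near_at_right0P[d d0 dh] := Tu _ e0; exists d => // h /andP[].
rewrite le_eqVlt => /predU1P[<- _|h0 hd]; first by rewrite T0 subrr rnorm0.
by apply: dh; rewrite h0.
Qed.

(** If there were no bound near 0, times [s k] at most $1/(k+1)$ would have operator norms above
    $16^k$, while each orbit stays bounded along them by right continuity at 0;
    [uniform_boundedness] forbids this. The semigroup law then reaches [t] in steps of length
    [d]. *)
Lemma semigroup_bounded t : 0 <= t ->
  exists2 M : R, 0 <= M & forall s, 0 <= s <= t -> forall u, rnorm (T s u) <= M * rnorm u.
Proof.
have [d d0 [M0 M00 hM0]] : exists2 d : R, 0 < d & exists2 M : R, 0 <= M &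
    forall s, 0 <= s <= d -> forall u, rnorm (T s u) <= M * rnorm u.
  apply: contrapT => /forall2NP nb.
  have /choice[s sP] : forall k : nat, exists s, 0 <= s <= k.+1%:R^-1 /\
      exists u, 16 ^+ k * rnorm u < rnorm (T s u).
    move=> k; apply: contrapT => /forallNP nk.
    have [|] := nb k.+1%:R^-1; first by rewrite invr_gt0.
    apply; exists (16 ^+ k); first by rewrite exprn_ge0.
    move=> s hs u; rewrite leNgt; apply/negP => hu.
    by apply: (nk s); split => //; exists u.
  have [k kP|u|k] := @uniform_boundedness _ _ (fun k => T (s k)) cX.
  - by have [/andP[s0 _] _] := sP k; exact: T_cont.
  - have [d d0 du] := semigroup_right u ltr01.
    pose K := Num.truncn d^-1.
    exists (\sum_(k < K.+1) rnorm (T (s k) u) + (1 + rnorm u)) => k.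
    have [kK|Kk] := ltnP k K.+1.
      rewrite (bigD1 (Ordinal kK)) //= -addrA lerDl addr_ge0 //.
        by apply: sumr_ge0 => i _; exact: rnorm_ge0.
      by rewrite addr_ge0 // rnorm_ge0.
    apply: ler_wpDl; first by apply: sumr_ge0 => i _; exact: rnorm_ge0.
    rewrite -[T (s k) u](subrK u); apply: le_trans (rnormD _ _) _.
    rewrite lerD2r ltW // du //; have [/andP[-> sk] _] := sP k; apply: le_lt_trans sk _.
    rewrite -[ltRHS]invrK ltf_pV2 ?posrE ?invr_gt0 //.
    apply: (@lt_trans _ _ K.+1%:R); first by rewrite truncnS_gt.
    by rewrite ltr_nat ltnS.
  by have [_ [u]] := sP k => + kb; rewrite ltNge kb.
move=> t0; have hn : forall n : nat, exists2 M : R, 0 <= M & forall s, 0 <= s <= n%:R * d ->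
    forall u, rnorm (T s u) <= M * rnorm u.
  elim=> [|n [M M1 hM]].
    exists 1 => // s; rewrite mul0r -eq_le => /eqP <- u; by rewrite T0 mul1r.
  exists (M0 * M + M + M0) => [|s /andP[s0 sn] u]; first by rewrite !addr_ge0 // mulr_ge0.
  have u0 := rnorm_ge0 u.
  have [sd|ds] := leP s d.
    apply: le_trans (hM0 s _ u) _; first by rewrite s0.
    by apply: ler_wpM2r => //; rewrite lerDr addr_ge0 // mulr_ge0.
  rewrite -(subrKC d s) TD ?(ltW d0) ?subr_ge0 ?(ltW ds) //.
  apply: le_trans (hM0 d _ _) _; first by rewrite lexx ltW.
  apply: (@le_trans _ _ (M0 * (M * rnorm u))).
    rewrite ler_wpM2l // hM // subr_ge0 (ltW ds) /= lerBlDr.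
    by move: sn; rewrite -natr1 mulrDl mul1r.
  by rewrite mulrA ler_wpM2r // -addrA lerDl addr_ge0.
have [M M1 hM] := hn (Num.truncn (t / d)).+1; exists M => // s /andP[s0 st]; apply: hM.
rewrite s0 (le_trans st) // -ler_pdivrMr // ltW // truncnS_gt //.
Qed.

(** For $r\le s$, $T_su-T_ru=T_r(T_{s-r}u-u)$: right continuity at 0 and the bound on $T_r$ give
    uniform continuity on both sides. *)
Lemma semigroup_ucont t u (e : R) : 0 <= t -> 0 < e -> exists2 d : R, 0 < d &
  forall r s, 0 <= r <= t -> 0 <= s <= t -> `|r - s| < d -> rnorm (T r u - T s u) < e.
Proof.
move=> t0 e0; have [M M0 hM] := semigroup_bounded t0.
have M1 : 0 < M + 1 by rewrite ltr_wpDl.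
have [|d d0 du] := @semigroup_right u (e / (M + 1)); first by rewrite divr_gt0.
exists d => //; suff H r s : 0 <= r -> r <= s -> s <= t -> s - r < d ->
    rnorm (T s u - T r u) < e.
  move=> r s /andP[r0 rt] /andP[s0 st]; have [sr|rs] := leP s r.
    by rewrite ger0_norm ?subr_ge0 //; exact: H.
  by rewrite ler0_norm ?subr_le0 ?(ltW rs) // opprB rnormB; apply: H => //; exact: ltW.
move=> r0 rs st sd.
rewrite -(subrKC r s) TD ?subr_ge0 // -linearB.
apply: le_lt_trans (hM r _ _) _; first by rewrite r0 (le_trans rs).
have := du (s - r); rewrite subr_ge0 rs sd => /(_ isT); rewrite ltr_pdivlMr // => h.
apply: le_lt_trans h; rewrite mulrC ler_wpM2l ?rnorm_ge0 //; lra.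
Qed.

Lemma generatorP u w : generator T (u, w) <->
  forall e : R, 0 < e -> exists2 d : R, 0 < d & forall h, 0 < h < d ->
    rnorm (T h u - u - h%:C *: w) < e * h.
Proof.
have E h : 0 < h -> rnorm ((h^-1)%:C *: (T h u - u) - w) =
    h^-1 * rnorm (T h u - u - h%:C *: w).
  move=> h0; rewrite -[h^-1 in RHS]gtr0_norm ?invr_gt0 // -rnormZ [in RHS]scalerBr scalerA.
  by rewrite -rmorphM /= mulVf ?gt_eqF // scale1r.
split=> [/cvg_rnormP gu e e0|gu].
  have /near_at_right0P[d d0 dh] := gu _ e0; exists d => // h hd.
  have /andP[h0 _] := hd; have := dh h hd.
  by rewrite /= E // ltr_pdivrMl // mulrC.
apply/cvg_rnormP => e e0; apply/near_at_right0P; have [d d0 dh] := gu _ e0.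
exists d => // h hd; have /andP[h0 _] := hd.
by rewrite /= E // ltr_pdivrMl // mulrC dh.
Qed.

Lemma generator_semigroup u w s : 0 <= s -> generator T (u, w) -> generator T (T s u, T s w).
Proof.
move=> s0 /generatorP gu; apply/generatorP => e e0.
have [C C0 hC] := linear_rnorm_bounded (T_cont s0).
have C1 : 0 < C + 1 by rewrite ltr_wpDl.
have [|d d0 dh] := gu (e / (C + 1)); first by rewrite divr_gt0.
exists d => // h hd; have /andP[h0 _] := hd.
have -> : T h (T s u) - T s u - h%:C *: T s w = T s (T h u - u - h%:C *: w).
  have -> : T h (T s u) = T s (T h u) by rewrite -!TD ?(ltW h0) // addrC.
  by rewrite 2![in RHS]linearB /= [T s (h%:C *: w)]linearZ.
apply: le_lt_trans (hC _) _; have := dh h hd; set z := rnorm _ => hz.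
have z0 : 0 <= z by exact: rnorm_ge0.
have : (C + 1) * z < e * h.
  by rewrite -ltr_pdivlMl // mulrC mulrAC.
lra.
Qed.
End semigroup.

(** * Means of orbits and density of the domain of the generator *)

Section averages.
Variable V : zmodType.
Implicit Type F : nat -> V.

(** Discrete form of $\int_h^{t+h}F-\int_0^tF=\int_0^h(F(t+s)-F(s))\,ds$. *)
Lemma sum_shift_sub F N j :
  \sum_(k < N) F (k + j)%N - \sum_(k < N) F k = \sum_(k < j) (F (N + k)%N - F k).
Proof.
apply/eqP; rewrite sumrB subr_eq addrAC -subr_eq opprK; apply/eqP.
transitivity (\sum_(k < N + j) F k).
  by rewrite addnC big_split_ord /= addrC; congr (_ + _); apply: eq_bigr => i _; rewrite addnC.
by rewrite big_split_ord /= addrC.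
Qed.

(** Each index is repeated [p] times; this transfers a Riemann sum to a refined grid. *)
Lemma sum_divn F K p : (0 < p)%N ->
  \sum_(k < K * p) F (k %/ p)%N = (\sum_(k < K) F k) *+ p.
Proof.
move=> p0; elim: K => [|K IH]; first by rewrite mul0n !big_ord0 mul0rn.
rewrite mulSnr big_split_ord /= IH big_ord_recr /= mulrnDl; congr (_ + _).
rewrite (eq_bigr (fun=> F K)) ?sumr_const ?card_ord // => i _.
by rewrite divnMDl // divn_small // addn0.
Qed.
End averages.

Lemma scale_natC (R : realType) (X : lmodType R[i]) n (v : X) : n%:R%:C *: v = v *+ n.
Proof. by rewrite rmorph_nat scaler_nat. Qed.

Section generator_dense.
Variables (R : realType) (X : normedModType R[i]) (T : R -> {linear X -> X}).
Hypotheses (cX : geo_complete X) (T_sg : C0_semigroup T).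
Implicit Types (u v w : X) (s t h : R).

Let TD u s t : 0 <= s -> 0 <= t -> T (s + t) u = T s (T t u).
Proof. by case: T_sg => _ _ h _; exact: h. Qed.

(* Riemann sum of the mean value of the orbit of [u] over [0, t] *)
Definition orbit_mean t u (N : nat) : X :=
  (N%:R^-1)%:C *: \sum_(k < N) T (k%:R * t / N%:R) u.

Lemma rnorm_mean_le (N : nat) (F : 'I_N -> X) (e : R) : (0 < N)%N ->
  (forall k, rnorm (F k) <= e) -> rnorm ((N%:R^-1)%:C *: \sum_(k < N) F k) <= e.
Proof.
move=> N0 Fe; have NR : 0 < N%:R :> R by rewrite ltr0n.
rewrite rnormZ ger0_norm ?invr_ge0 ?ler0n // ler_pdivrMl //.
apply: le_trans (rnorm_sum _ _) _; apply: (@le_trans _ _ (\sum_(k < N) e)).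
  by apply: ler_sum => k _; exact: Fe.
by rewrite sumr_const card_ord mulr_natl.
Qed.

Lemma orbit_mean_cauchy t u (e : R) : 0 <= t -> 0 < e ->
  exists K : nat, forall N m, (K <= N)%N -> (0 < m)%N ->
    rnorm (orbit_mean t u (N * m) - orbit_mean t u N) <= e.
Proof.
move=> t0 e0; have [d d0 dT] := semigroup_ucont cX T_sg u t0 e0.
exists (Num.truncn (t / d)).+1 => N m KN m0.
have N0 : (0 < N)%N by apply: leq_trans KN.
have NR : 0 < N%:R :> R by rewrite ltr0n.
have mR : 0 < m%:R :> R by rewrite ltr0n.
have tN : t / N%:R < d.
  rewrite ltr_pdivrMr // mulrC -ltr_pdivrMr //.
  by apply: lt_le_trans (truncnS_gt _) _; rewrite ler_nat.
(* The coarse sum is rewritten on the fine grid. Matched nodes then differ by at most [t / N], and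
   uniform continuity of the orbit applies. *)
have -> : orbit_mean t u N = ((N * m)%:R^-1)%:C *:
    \sum_(k < N * m) T ((k %/ m)%:R * t / N%:R) u.
  rewrite (sum_divn (fun k => T (k%:R * t / N%:R) u)) // -scale_natC scalerA /orbit_mean.
  rewrite -rmorphM natrM /=; congr (_%:C *: _).
  by field; rewrite !gt_eqF.
rewrite /orbit_mean -scalerBr -sumrB; apply: rnorm_mean_le; first by rewrite muln_gt0 N0.
move=> k; apply/ltW/dT.
- rewrite divr_ge0 ?mulr_ge0 //= ler_pdivrMr ?ltr0n ?muln_gt0 ?N0 // mulrC.
  by rewrite ler_wpM2l // ler_nat ltnW.
- rewrite divr_ge0 ?mulr_ge0 //= ler_pdivrMr // mulrC ler_wpM2l // ler_nat.
  by rewrite ltnW // ltn_divLR.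
have -> : k%:R * t / (N * m)%:R - (k %/ m)%:R * t / N%:R =
    (k %% m)%:R / m%:R * (t / N%:R) :> R.
  rewrite {1}(divn_eq k m) natrD !natrM; field; by rewrite !gt_eqF.
apply: le_lt_trans tN; rewrite ger0_norm ?mulr_ge0 ?divr_ge0 ?invr_ge0 //.
rewrite -[leRHS]mul1r ler_wpM2r ?divr_ge0 // ler_pdivrMr // mul1r ler_nat.
by rewrite ltnW // ltn_mod.
Qed.

(** With [j] the integer part of [h N / t], shifting by [h] is nearly shifting by [j] nodes. The
    error terms are, in order: rounding [h] to a node, replacing [T s w] by [w = T t u - u] in the
    remaining [j] terms, and replacing [j / N] by [h / t]. *)
Lemma orbit_mean_shift t u h N : 0 < t -> 0 <= h <= t -> (0 < N)%N ->
  forall e eta : R,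
  (forall r s, 0 <= r <= t + t -> 0 <= s <= t + t -> `|r - s| <= t / N%:R ->
    rnorm (T r u - T s u) <= e) ->
  (forall s, 0 <= s <= h -> rnorm (T s (T t u - u) - (T t u - u)) <= eta) ->
  rnorm (T h (orbit_mean t u N) - orbit_mean t u N - (h / t)%:C *: (T t u - u)) <=
    e + h / t * eta + N%:R^-1 * rnorm (T t u - u).
Proof.
move=> t0 /andP[h0 ht] N0 e eta he heta.
have NR : 0 < N%:R :> R by rewrite ltr0n.
pose j := Num.truncn (h / t * N%:R); set w := T t u - u.
have hN0 : 0 <= h / t * N%:R by rewrite mulr_ge0 // divr_ge0 // ltW.
have /andP[j1 j2] := truncn_itv hN0; rewrite -/j in j1 j2.
pose A := (N%:R^-1)%:C *: \sum_(k < N) T ((k + j)%:R * t / N%:R) u.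
have jh : j%:R * t / N%:R <= h.
  rewrite ler_pdivrMr // -ler_pdivlMr //.
  by rewrite (_ : h * N%:R / t = h / t * N%:R) //; rewrite mulrAC.
have jhN : j%:R * t / N%:R + t / N%:R > h.
  rewrite (_ : _ + _ = j.+1%:R * t / N%:R).
    rewrite ltr_pdivlMr // -ltr_pdivrMr //.
    by rewrite (_ : h * N%:R / t = h / t * N%:R) // mulrAC.
  by rewrite -natr1; field; rewrite gt_eqF.
have jN : (j <= N)%N.
  rewrite -(@ler_nat R) (le_trans j1) // ler_piMl // ler_pdivrMr // mul1r //.
have kt (k : nat) : (k <= N)%N -> 0 <= k%:R * t / N%:R <= t.
  move=> kN; rewrite divr_ge0 ?mulr_ge0 ?(ltW t0) //= ler_pdivrMr // mulrC.
  by rewrite ler_wpM2l ?(ltW t0) // ler_nat.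
have h1 : rnorm (T h (orbit_mean t u N) - A) <= e.
  rewrite /orbit_mean linearZ /= -scalerBr linear_sum -sumrB.
  apply: rnorm_mean_le => // k; have /andP[k0 k1] := kt k (ltnW (ltn_ord k)).
  have /andP[j0 j3] := kt j jN.
  rewrite -TD //; apply: he.
  - by rewrite addr_ge0 //= lerD.
  - by rewrite natrD !mulrDl addr_ge0 //= lerD.
  rewrite natrD !mulrDl; set a := k%:R * t / N%:R in k0 k1 *.
  by set b := j%:R * t / N%:R in jh jhN j0 j3 *; rewrite ler_norml; apply/andP; split; lra.
have h2 : A - orbit_mean t u N = (N%:R^-1)%:C *: \sum_(k < j) T (k%:R * t / N%:R) w.
  rewrite /orbit_mean -scalerBr (sum_shift_sub (fun k => T (k%:R * t / N%:R) u)).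
  congr (_ *: _); apply: eq_bigr => k _; rewrite linearB -TD ?(ltW t0) //=; last first.
    by have /andP[] := kt k (leq_trans (ltnW (ltn_ord k)) jN).
  by congr (T _ _ - _); rewrite natrD; field; rewrite gt_eqF.
have h3 : rnorm (A - orbit_mean t u N - (j%:R / N%:R)%:C *: w) <= h / t * eta.
  have eta0 : 0 <= eta by apply: le_trans (heta 0 _); rewrite ?rnorm_ge0 // lexx.
  have -> : (j%:R / N%:R)%:C *: w = (N%:R^-1)%:C *: \sum_(k < j) w.
    by rewrite sumr_const card_ord -scale_natC scalerA -rmorphM mulrC.
  rewrite h2 -scalerBr -sumrB rnormZ ger0_norm ?invr_ge0 ?ler0n // ler_pdivrMl //.
  apply: le_trans (rnorm_sum _ _) _; apply: (@le_trans _ _ (\sum_(k < j) eta)).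
    apply: ler_sum => k _; apply: heta.
    have /andP[-> _] /= := kt k (leq_trans (ltnW (ltn_ord k)) jN).
    apply: le_trans jh; rewrite !ler_pM2r ?invr_gt0 // ler_nat ltnW //.
  by rewrite sumr_const card_ord -[eta *+ j]mulr_natl mulrA ler_wpM2r // mulrC.
have h4 : rnorm ((j%:R / N%:R)%:C *: w - (h / t)%:C *: w) <= N%:R^-1 * rnorm w.
  rewrite -scalerBl -rmorphB rnormZ ler_wpM2r ?rnorm_ge0 // distrC.
  rewrite ger0_norm; last by rewrite subr_ge0 ler_pdivrMr.
  by rewrite lerBlDr -{1}[N%:R^-1]mul1r -mulrDl ler_pdivlMr // addrC natr1 ltW.
have -> : T h (orbit_mean t u N) - orbit_mean t u N - (h / t)%:C *: w =
    (T h (orbit_mean t u N) - A) + (A - orbit_mean t u N - (j%:R / N%:R)%:C *: w) +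
    ((j%:R / N%:R)%:C *: w - (h / t)%:C *: w).
  by rewrite !addrA !subrK.
apply: le_trans (rnormD _ _) _; apply: lerD => //.
by apply: le_trans (rnormD _ _) _; exact: lerD.
Qed.

(** The limit [v] stands for $\frac1t\int_0^tT_su\,ds$. Powers of 2 are used because their grids are
    nested, as [orbit_mean_cauchy] requires. *)
Lemma generator_mean t u : 0 < t -> exists2 v, seq_lim (fun m => orbit_mean t u (2 ^ m)) v &
  generator T (v, (t^-1)%:C *: (T t u - u)).
Proof.
move=> t0; set w := T t u - u; pose g m := orbit_mean t u (2 ^ m).
have [|v gv] := geo_complete_cauchy (u := g) cX.
  move=> e e0; have e2 : 0 < e / 2 by rewrite divr_gt0.
  have [K hK] := orbit_mean_cauchy u (ltW t0) e2; exists K => k Kk.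
  rewrite /g -(subnKC Kk) expnD; apply: le_lt_trans (hK _ _ _ _) _.
  - by rewrite ltnW // ltn_expl.
  - by rewrite expn_gt0.
  - lra.
exists v => //; apply/generatorP => // e e0.
(* Chosen so that the error [h / t * eta] of [orbit_mean_shift] becomes [e / 2 * h]. *)
have et : 0 < e * t / 2 by rewrite divr_gt0 ?mulr_gt0.
have [d d0 dw] := semigroup_right T_sg w et.
exists (Num.min d t) => [|h /andP[h0]]; first by rewrite lt_min d0.
rewrite lt_min => /andP[hd ht].
have H : rnorm (T h v - v - h%:C *: ((t^-1)%:C *: w)) <= e / 2 * h.
  rewrite scalerA -rmorphM /=.
  have [M M0 hM] := semigroup_bounded cX T_sg (ltW h0).
  (* Here [h] is fixed and the grid is refined: every discretisation error, including that of
     replacing [v] by [g m], goes into the slack [a]. The index [m] is the sum of the thresholds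
     that these errors impose. *)
  apply/ler_addgt0Pr => a a0.
  have a3 : 0 < a / 3 by rewrite divr_gt0.
  have [|d' d'0 d'u] := semigroup_ucont cX T_sg u (t := t + t) _ a3; first lra.
  have b0 : 0 < a / 3 / (M + 1) by rewrite divr_gt0 // ltr_wpDl.
  have [K hK] := gv _ b0.
  pose m := (K + (Num.truncn (t / d')).+1 + (Num.truncn (rnorm w / (a / 3))).+1)%N.
  have N0 : (0 < 2 ^ m)%N by rewrite expn_gt0.
  have NR : 0 < (2 ^ m)%:R :> R by rewrite ltr0n.
  have big (x : R) : ((Num.truncn x).+1 <= m)%N -> x < (2 ^ m)%:R.
    move=> xm; apply: lt_le_trans (truncnS_gt _) _.
    by rewrite ler_nat (leq_trans xm) // ltnW // ltn_expl.
  have tN : t / (2 ^ m)%:R < d'.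
    rewrite ltr_pdivrMr // mulrC -ltr_pdivrMr // big //.
    by rewrite /m -addnA addnCA leq_addr.
  have wN : (2 ^ m)%:R^-1 * rnorm w <= a / 3.
    rewrite ler_pdivrMl // -ler_pdivrMr // ltW // big // /m leq_addl //.
  have := @orbit_mean_shift t u h (2 ^ m) t0 _ N0 (a / 3) (e * t / 2).
  rewrite (ltW h0) (ltW ht) => /(_ isT) h1.
  have {}h1 : rnorm (T h (g m) - g m - (h / t)%:C *: w) <= e / 2 * h + 2 * (a / 3).
    apply: le_trans (h1 _ _) _.
    - by move=> r s hr hs rs; apply/ltW/d'u => //; apply: le_lt_trans rs _.
    - by move=> s /andP[s0 sh]; rewrite -/w; apply/ltW/dw; rewrite s0 (le_lt_trans sh).
    rewrite -/w (_ : h / t * (e * t / 2) = e / 2 * h); last by field; rewrite gt_eqF.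
    by move: wN; set z := _ * rnorm w; clear; lra.
  have h2 : rnorm (g m - v) < a / 3 / (M + 1) by apply: hK; rewrite /m -addnA leq_addr.
  have h3 : rnorm (T h (v - g m)) <= M * rnorm (g m - v).
    by rewrite [rnorm (g m - v)]rnormB hM // lexx ltW.
  have -> : T h v - v - (h / t)%:C *: w = T h (v - g m) + (g m - v) +
      (T h (g m) - g m - (h / t)%:C *: w).
    rewrite (linearB (T h) v) [g m - v]addrC [_ + (- v + _)]addrACA -[RHS]addrA; congr (_ + _).
    by rewrite addrA [- _ + g m]addrC -(opprB (T h (g m))) addNr add0r.
  apply: le_trans (rnormD _ _) _; rewrite (_ : e / 2 * h + a = a / 3 + (e / 2 * h + 2 * (a / 3))).
    apply: lerD => //; apply: le_trans (rnormD _ _) _.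
    apply: le_trans (lerD h3 (lexx _)) _.
    by move: h2; rewrite ltr_pdivlMr ?ltr_wpDl // mulrDr mulr1 mulrC => /ltW.
  by field.
apply: le_lt_trans H _; rewrite ltr_pM2r //; lra.
Qed.

(** The mean of the orbit over a short interval lies in the domain and is close to [u]. *)
Lemma generator_dense u (e : R) : 0 < e ->
  exists2 v, (exists w, generator T (v, w)) & rnorm (v - u) < e.
Proof.
move=> e0; have e3 : 0 < e / 3 by rewrite divr_gt0.
have [d d0 du] := semigroup_right T_sg u e3.
have t0 : 0 < d / 2 by rewrite divr_gt0.
have [v gv gen] := generator_mean u t0; exists v; first by eexists; exact: gen.
have [K hK] := gv _ e3; have := hK _ (leqnn K).
have h : rnorm (orbit_mean (d / 2) u (2 ^ K) - u) <= e / 3.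
  have N0 : (0 < 2 ^ K)%N by rewrite expn_gt0.
  have NR : 0 < (2 ^ K)%:R :> R by rewrite ltr0n.
  have uE : u = ((2 ^ K)%:R^-1)%:C *: \sum_(k < 2 ^ K) u.
    rewrite sumr_const card_ord -scale_natC scalerA.
    by rewrite -rmorphM mulVf ?gt_eqF // scale1r.
  rewrite [X in rnorm (_ - X)]uE /orbit_mean -scalerBr -sumrB.
  apply: rnorm_mean_le => // k; apply/ltW.
  apply: du; rewrite divr_ge0 ?mulr_ge0 ?(ltW d0) //= ltr_pdivrMr //.
  rewrite mulrC; apply: (@le_lt_trans _ _ (d / 2 * (2 ^ K)%:R)).
    by rewrite ler_wpM2l ?(ltW t0) // ler_nat ltnW.
  by rewrite ltr_pM2r //; lra.
rewrite [rnorm (_ - v)]rnormB => h2.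
have -> : v - u = (v - orbit_mean (d / 2) u (2 ^ K)) + (orbit_mean (d / 2) u (2 ^ K) - u).
  by rewrite addrA subrK.
apply: le_lt_trans (rnormD _ _) _; lra.
Qed.
End generator_dense.

(** * Compactness of the semigroup from a compact set met by the orbits *)

Section compactness.
Variables (R : realType) (X : normedModType R[i]).
Implicit Types (u v w : X) (S : set X).

(* Such colourings make the ultrafilters on [closure S] Cauchy. *)
Lemma precompact_colouring S : geo_complete X ->
  (forall d : R, 0 < d -> exists (I : finType) (c : X -> I),
    forall u v, S u -> S v -> c u = c v -> rnorm (u - v) <= d) ->
  compact (closure S).
Proof.
move=> cX hS; rewrite compact_ultra => F FU FS.
have FF : ProperFilter F by exact: ultra_proper.
have small (d : R) : 0 < d -> exists2 A : set X, F A & forall u v, A u -> A v -> rnorm (u - v) <= d.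
  move=> d0; have d3 : 0 < d / 3 by rewrite divr_gt0.
  have [I [c hc]] := hS _ d3.
  (* Finitely many of these neighbourhoods of colour classes cover [closure S], so the ultrafilter
     contains one; its diameter is at most three times [d / 3]. *)
  pose A i := [set u | exists2 v, S v /\ c v = i & rnorm (v - u) < d / 3].
  have [i Fi] : exists i, F (A i).
    apply: contrapT => /forallNP nF.
    have : \forall u \near F, forall i, ~ A i u.
      apply: filter_forall => i; have [//|//] := in_ultra_setVsetC (A i) FU.
      by move=> /nF.
    move=> Fn; have [u [/closure_rnormP/(_ _ d3)[v Sv vu] nAu]] := filter_ex (filterI FS Fn).
    by apply: (nAu (c v)); exists v.
  exists (A i) => // u v [u' [Su' <-] uu'] [v' [Sv' cv'] vv'].
  have h := hc _ _ Su' Sv' (esym cv').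
  have -> : u - v = (u - u') + ((u' - v') + (v' - v)) by rewrite !addrA !subrK.
  apply: le_trans (rnormD _ _) _; have := rnormD (u' - v') (v' - v).
  rewrite (rnormB u u'); lra.
have r0 k : 0 < 4^-1 ^+ k :> R by rewrite exprn_gt0.
have /choice[A hA] : forall k, exists A : set X, F A /\
    forall u v, A u -> A v -> rnorm (u - v) <= 4^-1 ^+ k.
  by move=> k; have [A FA hA] := small _ (r0 k); exists A.
(* Nesting the small sets makes any choice of points [x k] in [B k] a sequence to which
   [geo_complete] applies. *)
pose B := fix B k := if k is k'.+1 then B k' `&` A k else closure S `&` A 0%N.
have FB k : F (B k).
  elim: k => [|k IH] /=; first by apply: filterI => //; case: (hA 0%N).
  by apply: filterI => //; case: (hA k.+1).
have BA k : B k `<=` A k by case: k => [|k] x [].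
have BS k : B k `<=` closure S by elim: k => [|k IH] x [//] /IH.
have /choice[x Bx] : forall k, exists x, B k x by move=> k; exact: filter_ex (FB k).
have cx : geo_cauchy x.
  move=> k; apply: (proj2 (hA k)); last exact: BA (Bx k).
  by apply: BA; have [] := Bx k.+1.
have [l xl] := cX _ cx; exists l; split.
  apply/closure_rnormP => e e0; have e2 : 0 < e / 2 by rewrite divr_gt0.
  have [K hK] := xl _ e2; have /closure_rnormP/(_ _ e2)[v Sv vx] := BS _ _ (Bx K).
  exists v => //; rewrite -[v](subrK (x K)) -addrA; apply: le_lt_trans (rnormD _ _) _.
  have := hK K (leqnn _); lra.
apply/cvg_rnormP => e e0; have e2 : 0 < e / 2 by rewrite divr_gt0.
have [K hK] := xl _ e2.
have /cvgrPdist_lt/(_ _ e2)[k _ kl] : (4^-1 ^+ k : R) @[k --> \oo] --> (0 : R).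
  by apply: cvg_expr; rewrite ger0_norm // invf_lt1 // ltr1n.
pose m := maxn K k; apply: filterS (FB m) => u Bu.
have h1 := hK m (leq_maxl _ _); have := kl m (leq_maxr _ _).
rewrite /= sub0r normrN ger0_norm ?exprn_ge0 // => h2.
have h3 := proj2 (hA m) _ _ (BA _ _ Bu) (BA _ _ (Bx m)).
have -> : u - l = (u - x m) + (x m - l) by rewrite addrA subrK.
apply: le_lt_trans (rnormD _ _) _; lra.
Qed.

Variable T : R -> {linear X -> X}.
Hypotheses (cX : geo_complete X) (T_sg : C0_semigroup T).

Let T0 u : T 0 u = u. Proof. by case: T_sg. Qed.
Let TD u s t : 0 <= s -> 0 <= t -> T (s + t) u = T s (T t u).
Proof. by case: T_sg => _ _ h _; exact: h. Qed.

(** Joint continuity follows from $T_rv-T_su=T_r(v-u)+(T_ru-T_su)$. It is proved relative to the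
    rectangle of times and points, since [T] is arbitrary at negative times. *)
Lemma orbits_compact t (K : set X) : 0 <= t -> compact K ->
  compact [set T p.1 p.2 | p in `[0, t] `*` K].
Proof.
move=> t0 cK; apply: continuous_compact; last first.
  by apply: compact_setX => //; exact: segment_compact.
apply/subspace_continuousP => -[s u] [/= + Ku]; rewrite in_itv /= => st.
apply/cvg_rnormP => e e0; rewrite near_withinE.
have e2 : 0 < e / 2 by rewrite divr_gt0.
have [M M0 hM] := semigroup_bounded cX T_sg t0.
have [d d0 dT] := semigroup_ucont cX T_sg u t0 e2.
have M1 : 0 < M + 1 by rewrite ltr_wpDl.
exists ([set r | `|s - r| < d], [set v | rnorm (v - u) < e / 2 / (M + 1)]) => /=.
  split; first by apply/nbhs_ballP; exists d => //= r; rewrite /ball.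
  by apply/nbhs_rnormP; exists (e / 2 / (M + 1)) => //; rewrite divr_gt0.
move=> [r v] [/= sr vu] [/= + Kv]; rewrite in_itv /= => rt.
have -> : T r v - T s u = T r (v - u) + (T r u - T s u) by rewrite linearB addrA subrK.
apply: le_lt_trans (rnormD _ _) _.
have h1 := hM r rt (v - u); have h2 : rnorm (T r u - T s u) < e / 2.
  by apply: dT => //; rewrite distrC.
move: vu; rewrite ltr_pdivlMr // => h3; have := rnorm_ge0 (v - u); nra.
Qed.

(* Along an orbit that stays outside [K], the square of the norm would decrease
   at speed larger than [C] and become negative before time [t]. *)
Lemma orbit_meets t (C m : R) (K : set X) u : 0 < t ->
  (exists w, generator T (u, w)) -> rnorm u ^+ 2 < C * t ->
  (forall s, 0 <= s <= t -> rnorm (T s u) < m) ->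
  (forall v w, generator T (v, w) -> rnorm v < m -> ~ K v -> forall h, 0 < h ->
    rnorm (v + h%:C *: w) ^+ 2 <= rnorm v ^+ 2 - 2 * C * h + h ^+ 2 * rnorm w ^+ 2) ->
  exists2 s, 0 <= s <= t & K (T s u).
Proof.
move=> t0 [w uw] uC um hK; apply: contrapT => /forall2NP nK.
pose f s := rnorm (T s u) ^+ 2.
suff : f t <= f 0 - C * t.
  by rewrite /f T0; have : 0 <= rnorm (T t u) ^+ 2 := sqr_ge0 _; lra.
have C0 : 0 < C by rewrite -(pmulr_lgt0 _ t0); apply: le_lt_trans uC; exact: sqr_ge0.
apply: right_derivative_le; first exact: ltW.
  move=> s /andP[s0 st] e e0.
  have m0 : 0 < m by apply: le_lt_trans (um 0 _); rewrite ?rnorm_ge0 // lexx ltW.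
  have em : 0 < e / (2 * m) by rewrite divr_gt0 // mulr_gt0.
  have [d d0 dT] := semigroup_ucont cX T_sg u (ltW t0) em.
  exists d => // r /andP[r0 rs] sdr.
  have hs : 0 <= s <= t by rewrite ltW.
  have hr : 0 <= r <= t by rewrite r0 (le_trans (ltW rs)).
  have : rnorm (T s u - T r u) < e / (2 * m).
    by apply: dT => //; rewrite gtr0_norm ?subr_gt0 //; lra.
  have := rnormD (T s u - T r u) (T r u); rewrite subrK /f.
  have := um _ hs; have := um _ hr; have := rnorm_ge0 (T s u); have := rnorm_ge0 (T r u).
  set a := rnorm (T s u); set b := rnorm (T r u); set z := rnorm _.
  move=> b0 a0 bm am abz; rewrite ltr_pdivlMr ?mulr_gt0 // => zm.
  have : (a - b) * (a + b) <= z * (2 * m).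
    have z0 : 0 <= z by exact: rnorm_ge0.
    apply: (@le_trans _ _ (z * (a + b))); first by rewrite ler_wpM2r ?addr_ge0 //; lra.
    by rewrite ler_wpM2l //; lra.
  have -> : (a - b) * (a + b) = a ^+ 2 - b ^+ 2 by ring.
  by lra.
move=> s /andP[s0 st].
have hs : 0 <= s <= t by rewrite s0 ltW.
have gs := generator_semigroup T_sg s0 uw.
have nKs : ~ K (T s u) by have [] := nK s.
have dec := hK _ _ gs (um s hs) nKs.
set v := T s u in gs dec; set z := T s w in gs dec.
pose a := rnorm v; pose c := rnorm z.
have a0 : 0 <= a := rnorm_ge0 _. have c0 : 0 <= c := rnorm_ge0 _.
(* The hypothesis gives decrease at rate [2 * C] and only rate [C] is claimed. Of the spare [C * h],
   one half pays for the cross term [2 * eta * h * p], where [p <= a + c]; the other half pays for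
   the terms of order [h ^+ 2] through [q]. *)
pose eta := C / 2 / (2 * (a + c) + 1).
have eta0 : 0 < eta by rewrite !divr_gt0 // ltr_wpDl // mulr_ge0 // addr_ge0.
have [d d0 dT] := proj1 (generatorP T v z) gs eta eta0.
pose q := C / 2 / (c ^+ 2 + eta ^+ 2 + 1).
have q0 : 0 < q by rewrite !divr_gt0 // ltr_wpDl // addr_ge0 // sqr_ge0.
exists (Num.min (Num.min d 1) q) => [|h /andP[h0]]; first by rewrite !lt_min d0 ltr01.
rewrite !lt_min => /andP[/andP[hd h1] hq].
have hdT := dT h (introT andP (conj h0 hd)).
rewrite /f addrC TD ?(ltW h0) // -/v.
have h2 : rnorm (T h v) <= rnorm (v + h%:C *: z) + eta * h.
  have -> : T h v = v + h%:C *: z + (T h v - v - h%:C *: z) by rewrite -[T h v - v - _]addrA -opprD [RHS]addrC subrK.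
  by apply: le_trans (rnormD _ _) _; rewrite lerD2l ltW.
have h3 : rnorm (v + h%:C *: z) <= a + c.
  apply: le_trans (rnormD _ _) _; rewrite rnormZ gtr0_norm // lerD2l.
  by rewrite ler_piMl // ltW.
have h4 := dec h h0; rewrite -/a -/c in h4 *.
move: h2 h3 h4; set p := rnorm (v + _); set p' := rnorm (T h v) => h2 h3 h4.
have p0 : 0 <= p := rnorm_ge0 _. have p'0 : 0 <= p' := rnorm_ge0 _.
have h5 : p' ^+ 2 <= p ^+ 2 + 2 * (eta * h) * p + (eta * h) ^+ 2.
  rewrite (_ : _ + _ + _ = (p + eta * h) ^+ 2); last by ring.
  by rewrite lerXn2r // nnegrE // addr_ge0 // mulr_ge0 // ltW.
have h6 : eta * (2 * (a + c) + 1) = C / 2.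
  by rewrite divfK // gt_eqF // ltr_wpDl // mulr_ge0 // addr_ge0.
have h7 : h * (c ^+ 2 + eta ^+ 2 + 1) < C / 2.
  by rewrite -ltr_pdivlMr // ltr_wpDl // addr_ge0 // sqr_ge0.
have h8 : h * eta * (2 * p) <= h * (C / 2).
  rewrite -mulrA ler_wpM2l ?(ltW h0) // -h6 ler_wpM2l ?(ltW eta0) //; lra.
have h9 : h * (h * (c ^+ 2 + eta ^+ 2 + 1)) <= h * (C / 2) by rewrite ler_wpM2l ?ltW.
have h10 : 0 <= h * h by rewrite mulr_ge0 ?(ltW h0).
move: h4 h5 h8 h9; rewrite exprMn; clear -h10; nra.
Qed.

Theorem semigroup_compact t : 0 < t ->
  (forall C m : R, exists2 K : set X, compact K &
    forall v w, generator T (v, w) -> rnorm v < m -> ~ K v -> forall h, 0 < h ->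
    rnorm (v + h%:C *: w) ^+ 2 <= rnorm v ^+ 2 - 2 * C * h + h ^+ 2 * rnorm w ^+ 2) ->
  compact_operator (T t).
Proof.
move=> t0 hT B bB.
have [b b0 hb] : exists2 b : R, 0 <= b & forall u, B u -> rnorm u <= b.
  have [b [breal hb]] := bB; pose r := complex.Re b.
  have br : b = r%:C by rewrite RRe_real.
  have := hb (`|r| + 1)%:C; rewrite br ltcR => /(_ _)/wrap[|h].
    by rewrite (le_lt_trans (ler_norm _)) // ltrDl.
  exists (`|r| + 1); first by rewrite addr_ge0.
  by move=> u Bu; have := h u Bu; rewrite /= rnormE lecR.
have [M M0 hM] := semigroup_bounded cX T_sg (ltW t0).
(* [b + 1] bounds the points of the domain within distance 1 of [B]; [C] is large enough that
   [(b + 1) ^+ 2 < C * t], and [m] strictly bounds the orbits of these points up to time [t]. *)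
pose C := ((b + 1) ^+ 2 + 1) / t; pose m := M * (b + 1) + 1.
have [K cK hK] := hT C m.
pose Z := [set T p.1 p.2 | p in `[0, t] `*` K].
have cZ : compact Z by apply: orbits_compact => //; exact: ltW.
have hausX : hausdorff_space X by exact: norm_hausdorff.
(* As [Z] is closed, it is enough to approximate [T t u] by points [T t v] of [Z] with [v] in the
   domain. *)
apply: (precompact_subset _ (compact_precompact hausX cZ)).
move=> _ [u Bu <-]; apply: (compact_closed hausX cZ).
have dom v : (exists w, generator T (v, w)) -> rnorm v <= b + 1 -> Z (T t v).
  move=> vw vb; have [||s /andP[s0 st] Ks] := orbit_meets t0 vw (C := C) (m := m) _ _ hK.
  - rewrite divfK ?gt_eqF // ltr_pwDr // lerXn2r ?nnegrE ?rnorm_ge0 // addr_ge0 //.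
  - move=> s hs; apply: le_lt_trans (hM s hs v) _; rewrite ltr_pwDr // ler_wpM2l //.
  exists (t - s, T s v) => /=; last by rewrite -TD ?subr_ge0 // subrK.
  by split => //=; rewrite in_itv /= subr_ge0 st lerBlDr lerDl.
apply/closure_rnormP => e e0.
(* The bound 1 keeps [rnorm v] below [b + 1]; the other one makes [T t v] within [e] of [T t u]. *)
have e1 : 0 < Num.min 1 (e / (M + 1)) by rewrite lt_min ltr01 divr_gt0 // ltr_wpDl.
have [v vw] := generator_dense cX T_sg u e1.
rewrite lt_min => /andP[v1 vM]; exists (T t v).
  apply: dom => //; rewrite -[v](subrK u) addrC; apply: le_trans (rnormD _ _) _.
  by rewrite lerD ?hb // ltW.
rewrite -linearB; apply: le_lt_trans (hM t _ _) _; first by rewrite lexx ltW.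
move: vM; rewrite ltr_pdivlMr ?ltr_wpDl //; have := rnorm_ge0 (v - u); lra.
Qed.
End compactness.

(** * The space L2 *)

Section L2_facts.
Context d (T : measurableType d) (R : realType) (mu : {measure set T -> \bar R}).
Implicit Types (f g : T -> R[i]) (u v w : L2 mu).
Local Notation Re := complex.Re.
Local Notation Im := complex.Im.
Local Notation re f := (fun x => complex.Re (f x)).
Local Notation im f := (fun x => complex.Im (f x)).

(** The real part of $f(x)\overline{g(x)}$; its integral is the real inner product underlying the
    norm of [L2]. *)
Definition ip f g (x : T) : R := Re (f x) * Re (g x) + Im (f x) * Im (g x).

Lemma ip_ge0 f x : 0 <= ip f f x.
Proof. by rewrite addr_ge0 // -expr2 sqr_ge0. Qed.

Definition cmeasurable f := measurable_fun setT (re f) /\ measurable_fun setT (im f).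

Lemma L2_Lfun u : (fun x => Re (u x)) \in Lfun mu 2%:E /\ (fun x => Im (u x)) \in Lfun mu 2%:E.
Proof. by have /andP[] := L2fun_valP (repr u). Qed.

Lemma Lfun_measurable (h : T -> R) : h \in Lfun mu 2%:E -> measurable_fun setT h.
Proof. by rewrite inE => /andP[]; rewrite inE. Qed.

Lemma L2_measurable u : cmeasurable u.
Proof. by have [h1 h2] := L2_Lfun u; split; exact: Lfun_measurable. Qed.

Lemma measurable_ip f g : cmeasurable f -> cmeasurable g -> measurable_fun setT (ip f g).
Proof.
by move=> [f1 f2] [g1 g2]; apply: measurable_funD; apply: measurable_funM.
Qed.

Lemma integrable_ip u v : mu.-integrable setT (EFin \o ip u v).
Proof.
have [u1 u2] := L2_Lfun u; have [v1 v2] := L2_Lfun v.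
have i1 := proj1 (Lfun1_integrable _ _) (Lfun2_mul_Lfun1 u1 v1).
have i2 := proj1 (Lfun1_integrable _ _) (Lfun2_mul_Lfun1 u2 v2).
exact: (integrableD measurableT i1 i2).
Qed.

Lemma L2_memP f : cmeasurable f -> (\int[mu]_x (ip f f x)%:E < +oo)%E -> f \in L2fun mu.
Proof.
move=> [f1 f2] fi.
have H (h : T -> R) : measurable_fun setT h -> (forall x, h x ^+ 2 <= ip f f x) ->
    h \in Lfun mu 2%:E.
  move=> mh hf; apply/andP; split; rewrite inE //= /finite_norm unlock.
  rewrite poweR_lty // (le_lt_trans _ fi) //; apply: ge0_le_integral => //.
  - by move=> x _; exact: poweR_ge0.
  - apply/measurable_EFinP; apply: (measurableT_comp (measurable_powR _)).
    exact: measurableT_comp.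
  - exact/measurable_EFinP/measurable_ip.
  - by move=> x _; rewrite /= lee_fin powR_mulrn // real_normK ?num_real.
apply/andP; split; apply: H => // x; rewrite /ip -!expr2; first by rewrite lerDl sqr_ge0.
by rewrite lerDr sqr_ge0.
Qed.

Lemma rnorm_sqrE u : (rnorm u ^+ 2)%:E = (\int[mu]_x (ip u u x)%:E)%E.
Proof.
have -> : rnorm u = L2norm mu (repr u) by [].
rewrite -powR_mulrn; last exact: fine_ge0 (Lnorm_ge0 _ _ _).
rewrite -poweR_EFin L2normE powR_Lnorm ?pnatr_eq0 //.
apply: eq_integral => x _; rewrite poweR_EFin /= powR_mulrn // real_normK ?num_real //.
by rewrite /ip /L2_fun; case: (repr u x) => a b /=; rewrite sqr_sqrtr // addr_ge0 // sqr_ge0.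
Qed.

Lemma rnorm_sqr_ae u f : cmeasurable f -> {ae mu, forall x, u x = f x} ->
  (rnorm u ^+ 2)%:E = (\int[mu]_x (ip f f x)%:E)%E.
Proof.
move=> mf uf; rewrite rnorm_sqrE; apply: ge0_ae_eq_integral => //.
- exact/measurable_EFinP/measurable_ip/L2_measurable/L2_measurable.
- exact/measurable_EFinP/measurable_ip.
- by move=> x _; rewrite lee_fin ip_ge0.
- by move=> x _; rewrite lee_fin ip_ge0.
by apply: filterS uf => x ux _; rewrite /ip ux.
Qed.

(** This converts the norm inequality on [u + h w] into a bound on the real part of the inner
    product. *)
Lemma rnorm_sqr_addZ u w (h : R) : rnorm (u + h%:C *: w) ^+ 2 =
  rnorm u ^+ 2 + 2 * h * \int[mu]_x ip u w x + h ^+ 2 * rnorm w ^+ 2.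
Proof.
have iI v v' : (\int[mu]_x ip v v' x)%:E = (\int[mu]_x (ip v v' x)%:E)%E.
  by rewrite fineK // (integrable_fin_num measurableT) //; exact: integrable_ip.
apply: EFin_inj; rewrite (rnorm_sqr_ae (f := fun x => u x + h%:C * w x)); last first.
- by apply: filterS2 (L2_funD u (h%:C *: w)) (L2_funZ h%:C w) => x -> ->.
- have [u1 u2] := L2_measurable u; have [w1 w2] := L2_measurable w.
  split.
    rewrite (_ : (fun _ => _) = (re (u)) \+ (fun x => h * Re (w x))); last first.
      by apply/funext => x /=; case: (u x) (w x) => [a b] [a' b'] /=; rewrite mul0r subr0.
    by apply: measurable_funD => //; exact: measurable_funM.
  rewrite (_ : (fun _ => _) = (im (u)) \+ (fun x => h * Im (w x))); last first.
    by apply/funext => x /=; case: (u x) (w x) => [a b] [a' b'] /=; rewrite mul0r addr0.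
  by apply: measurable_funD => //; exact: measurable_funM.
transitivity (\int[mu]_x ((ip u u x)%:E + ((2 * h)%:E * (ip u w x)%:E + (h ^+ 2)%:E * (ip w w x)%:E))%E)%E.
  apply: eq_integral => x _; rewrite -!EFinM -!EFinD /ip; congr _%:E.
  by case: (u x) (w x) => [a b] [a' b'] /=; ring.
have i1 := integrable_ip u u; have i2 := integrable_ip u w; have i3 := integrable_ip w w.
rewrite integralD //=; last first.
  by apply: (integrableD measurableT); apply: (integrableZl measurableT).
rewrite integralD //=; [|exact: (integrableZl measurableT)..].
by rewrite !integralZl // -rnorm_sqrE -rnorm_sqrE -iI -!EFinM -!EFinD addrA.
Qed.

(** Nested intervals: the radius $2C\,2^{-k}$ is exactly the tail of the steps, so [lo] increases,
    [hi] decreases, and [sup lo] lies in all the intervals. *)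
Lemma real_geometric_limit (r : nat -> R) (C : R) :
  (forall k, `|r k.+1 - r k| <= C * 2^-1 ^+ k) ->
  exists l, forall k, `|r k - l| <= 2 * C * 2^-1 ^+ k.
Proof.
move=> hr; have C0 : 0 <= C by have := hr 0%N; rewrite expr0 mulr1; exact: le_trans.
have p0 k : 0 <= C * 2^-1 ^+ k by rewrite mulr_ge0 // exprn_ge0.
pose lo k := r k - 2 * (C * 2^-1 ^+ k); pose hi k := r k + 2 * (C * 2^-1 ^+ k).
have lo1 k : lo k <= lo k.+1.
  have := hr k; rewrite ler_norml /lo exprS => /andP[h _].
  have -> : C * (2^-1 * 2^-1 ^+ k) = C * 2^-1 ^+ k / 2 by field.
  by lra.
have hi1 k : hi k.+1 <= hi k.
  have := hr k; rewrite ler_norml /hi exprS => /andP[_ h].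
  have -> : C * (2^-1 * 2^-1 ^+ k) = C * 2^-1 ^+ k / 2 by field.
  by lra.
have lom k m : (k <= m)%N -> lo k <= lo m.
  by move/subnKC => <-; elim: (m - k)%N => [|j IH]; rewrite ?addn0 // addnS (le_trans IH).
have him k m : (k <= m)%N -> hi m <= hi k.
  by move/subnKC => <-; elim: (m - k)%N => [|j IH]; rewrite ?addn0 // addnS (le_trans _ IH).
have lohi k m : lo k <= hi m.
  apply: (@le_trans _ _ (lo (maxn k m))); first by rewrite lom // leq_maxl.
  apply: (@le_trans _ _ (hi (maxn k m))); last by rewrite him // leq_maxr.
  by rewrite /lo /hi; have := p0 (maxn k m); lra.
have ub m : ubound (range lo) (hi m) by move=> _ [k _ <-].
have hs : has_sup (range lo) by split; [exists (lo 0%N); exists 0%N|exists (hi 0%N)].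
exists (sup (range lo)) => k; rewrite ler_norml; apply/andP.
have h1 : lo k <= sup (range lo) by apply: (ub_le_sup (proj2 hs)); exists k.
have h2 : sup (range lo) <= hi k by apply: ge_sup => //; exact: (proj1 hs).
move: h1 h2; rewrite /lo /hi; split; lra.
Qed.

(* With [H = sum_k 4^k |u_{k+1} - u_k|^2], which is integrable, the sequence
   converges wherever [H] is finite, and [|u_k - u|^2 <= 8 H / 4^k] there. *)
Lemma L2_geo_complete : geo_complete (L2 mu).
Proof.
suff : forall u : nat -> L2 mu, geo_cauchy u -> exists l, seq_lim u l by [].
move=> u cu.
pose D k x := ip (fun x => u k.+1 x - u k x) (fun x => u k.+1 x - u k x) x.
have mB k : cmeasurable (fun x => u k.+1 x - u k x).
  have [a1 a2] := L2_measurable (u k.+1); have [b1 b2] := L2_measurable (u k).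
  split.
    rewrite (_ : (fun _ => _) = (re (u k.+1)) \- (re (u k))); first exact: measurable_funB.
    by apply/funext => x /=; case: (u _ x) (u k x) => [? ?] [? ?].
  rewrite (_ : (fun _ => _) = (im (u k.+1)) \- (im (u k))); first exact: measurable_funB.
  by apply/funext => x /=; case: (u _ x) (u k x) => [? ?] [? ?].
have mD k : measurable_fun setT (D k) by exact: measurable_ip.
have intD k : (\int[mu]_x (D k x)%:E <= (4^-1 ^+ k * 4^-1 ^+ k)%:E)%E.
  rewrite -(rnorm_sqr_ae (u := u k.+1 - u k)) //; last first.
    have -> : u k.+1 - u k = u k.+1 + (-1) *: u k by rewrite scaleN1r.
    apply: filterS2 (L2_funD (u k.+1) (-1 *: u k)) (L2_funZ (-1) (u k)) => x -> ->.
    by rewrite mulN1r.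
  by rewrite lee_fin expr2 ler_pM ?rnorm_ge0.
pose h k x : \bar R := (4 ^+ k * D k x)%:E.
have h0 k x : (0 <= h k x)%E by rewrite lee_fin mulr_ge0 ?exprn_ge0 // ip_ge0.
have mh k : measurable_fun setT (h k) by apply/measurable_EFinP/measurable_funM.
pose H x := (\sum_(k <oo) h k x)%E.
have H0 x : (0 <= H x)%E by exact: nneseries_ge0.
have mH : measurable_fun setT H by apply: ge0_emeasurable_sum.
have hH k x : (h k x <= H x)%E.
  rewrite /H (@nneseriesD1 _ _ k) //; apply: leeDl; exact: nneseries_ge0.
have intH : (\int[mu]_x H x <= 2%:E)%E.
  rewrite integral_nneseries //; apply: lime_le.
    by apply: is_cvg_nneseries => k _ _; exact: integral_ge0.
  apply: nearW => N; rewrite big_mkord; apply: (@le_trans _ _ (\sum_(k < N) (4^-1 ^+ k)%:E)%E).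
    apply: lee_sum => k _; rewrite /h; under eq_integral do rewrite EFinM.
    rewrite ge0_integralZl //; last 2 first.
    - exact/measurable_EFinP.
    - by move=> x _; rewrite lee_fin ip_ge0.
    apply: (@le_trans _ _ ((4 ^+ k)%:E * (4^-1 ^+ k * 4^-1 ^+ k)%:E)%E).
      by rewrite lee_wpmul2l // lee_fin exprn_ge0.
    by rewrite -EFinM lee_fin mulrA -exprMn divff ?expr1n ?mul1r.
  rewrite sumEFin lee_fin.
  have : \sum_(k < N) (4^-1 ^+ k : R) <= 4 / 3 * (1 - 4^-1 ^+ N).
    elim: N => [|N IH]; first by rewrite big_ord0 subrr mulr0.
    by rewrite big_ord_recr /= exprS; lra.
  have : 0 <= 4^-1 ^+ N :> R by rewrite exprn_ge0.
  lra.
pose A := [set x | H x \is a fin_num].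
have mA : measurable A by have := emeasurable_fin_num measurableT mH; rewrite setTI.
have Hae : {ae mu, forall x, A x}.
  have iH : mu.-integrable setT H.
    apply/integrableP; split => //; under eq_integral do rewrite gee0_abs //.
    by rewrite (le_lt_trans intH) // ltry.
  by apply: filterS (integrable_ae measurableT iH) => x /(_ I).
have part (q : nat -> T -> R) : (forall k, measurable_fun setT (q k)) ->
    (forall k x, (q k.+1 x - q k x) ^+ 2 <= D k x) ->
    exists2 g : T -> R, measurable_fun setT g & (forall x, ~ A x -> g x = 0) /\
      (forall k x, A x -> (q k x - g x) ^+ 2 <= 4 * 4^-1 ^+ k * fine (H x)).
  move=> mq qD.
  have lim x : A x -> exists l, forall k, `|q k x - l| <= 2 * Num.sqrt (fine (H x)) * 2^-1 ^+ k.
    move=> Ax; apply: real_geometric_limit => k.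
    have s0 : 0 <= Num.sqrt (fine (H x)) * 2^-1 ^+ k by rewrite mulr_ge0 ?sqrtr_ge0 ?exprn_ge0.
    rewrite -[leRHS](ger0_norm s0) -ler_sqr ?nnegrE // !real_normK ?num_real //.
    apply: le_trans (qD k x) _; rewrite exprMn sqr_sqrtr ?fine_ge0 // -exprM muln2 -mul2n exprM.
    have := hH k x; rewrite -[H x]fineK // /h lee_fin.
    have -> : (2^-1 ^+ 2 : R) = 4^-1 by field.
    by rewrite exprVn ler_pdivlMr ?exprn_gt0 // mulrC.
  (* The value 0 off [A] makes [g] the everywhere limit of [q k] times the indicator of [A], hence
     measurable. *)
  pose g x := if pselect (A x) is left Ax then projT1 (cid (lim x Ax)) else 0.
  have gl x : A x -> forall k, `|q k x - g x| <= 2 * Num.sqrt (fine (H x)) * 2^-1 ^+ k.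
    by rewrite /g => Ax; case: pselect => // Ax'; case: cid.
  have gk k x : A x -> (q k x - g x) ^+ 2 <= 4 * 4^-1 ^+ k * fine (H x).
    move=> Ax; have := gl x Ax k; rewrite -ler_sqr ?nnegrE ?mulr_ge0 ?sqrtr_ge0 //.
    rewrite real_normK ?num_real // => /le_trans; apply.
    rewrite !exprMn sqr_sqrtr ?fine_ge0 // -exprM muln2 -mul2n exprM.
    have -> : (2^-1 ^+ 2 : R) = 4^-1 by field.
    by rewrite mulrAC -natrX.
  exists g; last by split => // x nAx; rewrite /g; case: pselect.
  apply: (@measurable_fun_cvg _ _ _ setT (fun k x => q k x * \1_A x)).
    by move=> k; apply: measurable_funM => //; exact: measurable_indic.
  move=> x _; have [Ax|nAx] := pselect (A x); last first.
    rewrite (_ : (fun _ => _) = fun=> g x); first exact: cvg_cst.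
    apply/funext => k; rewrite indicE memNset // mulr0 /g; by case: pselect.
  rewrite (_ : (fun _ => _) = q ^~ x); last first.
    by apply/funext => k; rewrite indicE mem_set // mulr1.
  apply/cvgrPdist_lt => e e0; pose C := 2 * Num.sqrt (fine (H x)).
  have C0 : 0 < C + 1 by rewrite ltr_wpDl // mulr_ge0 // sqrtr_ge0.
  have eC : 0 < e / (C + 1) by rewrite divr_gt0.
  have /cvgrPdist_lt/(_ _ eC)[K _ hK] : (2^-1 ^+ k : R) @[k --> \oo] --> (0 : R).
    by apply: cvg_expr; rewrite ger0_norm // invf_lt1 // ltr1n.
  exists K => // k Kk; have := hK k Kk; rewrite /= sub0r normrN ger0_norm ?exprn_ge0 //.
  rewrite ltr_pdivlMr // distrC => h1; apply: le_lt_trans (gl x Ax k) _; rewrite -/C.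
  have : 0 <= 2^-1 ^+ k :> R by rewrite exprn_ge0.
  lra.
have [gr mgr [gr0 grk]] : exists2 g : T -> R, measurable_fun setT g &
    (forall x, ~ A x -> g x = 0) /\
    (forall k x, A x -> (Re (u k x) - g x) ^+ 2 <= 4 * 4^-1 ^+ k * fine (H x)).
  apply: (part (fun k x => Re (u k x))) => [k|k x]; first by case: (L2_measurable (u k)).
  rewrite /D /ip; case: (u k.+1 x) (u k x) => [a b] [a' b'] /=.
  by rewrite -!expr2 lerDl sqr_ge0.
have [gi mgi [gi0 gik]] : exists2 g : T -> R, measurable_fun setT g &
    (forall x, ~ A x -> g x = 0) /\
    (forall k x, A x -> (Im (u k x) - g x) ^+ 2 <= 4 * 4^-1 ^+ k * fine (H x)).
  apply: (part (fun k x => Im (u k x))) => [k|k x]; first by case: (L2_measurable (u k)).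
  rewrite /D /ip; case: (u k.+1 x) (u k x) => [a b] [a' b'] /=.
  by rewrite -!expr2 lerDr sqr_ge0.
pose g x := gr x +i* gi x.
have mg : cmeasurable g by split.
(* From $|u_0-g|^2\le8H$ on [A] comes $|g|^2\le2|u_0|^2+16H$, an integrable bound. *)
have gL : g \in L2fun mu.
  apply: L2_memP => //.
  apply: (@le_lt_trans _ _ (\int[mu]_x (2%:E * (ip (u 0%N) (u 0%N) x)%:E + 16%:E * H x))%E).
    apply: ge0_le_integral => //.
    - by move=> x _; rewrite lee_fin ip_ge0.
    - exact/measurable_EFinP/measurable_ip.
    - apply: emeasurable_funD; apply: measurable_funeM => //.
      exact/measurable_EFinP/measurable_ip/L2_measurable/L2_measurable.
    move=> x _; have [Ax|nAx] := pselect (A x); last first.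
      rewrite {1}/ip /g /= gr0 // gi0 // mulr0 addr0 adde_ge0 ?mule_ge0 //.
      by rewrite lee_fin ip_ge0.
    rewrite -[H x]fineK // -!EFinM -EFinD lee_fin.
    have := grk 0%N x Ax; have := gik 0%N x Ax; rewrite expr0 mulr1 /ip /g /=.
    move=> h1 h2.
    have := sqr_ge0 (2 * Re (u 0%N x) - gr x); have := sqr_ge0 (2 * Im (u 0%N x) - gi x).
    by move: h1 h2; set a := Re _; set b := Im _; set c := fine _; clear; nra.
  rewrite ge0_integralD //; last 4 first.
  - by move=> x _; rewrite mule_ge0 // lee_fin ip_ge0.
  - apply: measurable_funeM; exact/measurable_EFinP/measurable_ip/L2_measurable/L2_measurable.
  - by move=> x _; rewrite mule_ge0.
  - exact: measurable_funeM.
  rewrite !ge0_integralZl //.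
  - rewrite -rnorm_sqrE -EFinM lte_add_pinfty ?ltry //.
    by apply: (@le_lt_trans _ _ (16%:E * 2%:E)%E); rewrite ?lee_wpmul2l // -EFinM ltry.
  - exact/measurable_EFinP/measurable_ip/L2_measurable/L2_measurable.
  - by move=> x _; rewrite lee_fin ip_ge0.
pose l : L2 mu := \pi_(L2 mu)%qT (L2Fun gL).
have lg : {ae mu, forall x, l x = g x} by exact: L2_reprK.
have ul k : rnorm (u k - l) ^+ 2 <= 16 * 4^-1 ^+ k.
  have mkg : cmeasurable (fun x => u k x - g x).
    have [a1 a2] := L2_measurable (u k).
    split.
      rewrite (_ : (fun _ => _) = (re (u k)) \- gr); first exact: measurable_funB.
      by apply/funext => x /=; case: (u k x) => [? ?].
    rewrite (_ : (fun _ => _) = (im (u k)) \- gi); first exact: measurable_funB.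
    by apply/funext => x /=; case: (u k x) => [? ?].
  rewrite -lee_fin (rnorm_sqr_ae (f := fun x => u k x - g x)) //; last first.
    have -> : u k - l = u k + (-1) *: l by rewrite scaleN1r.
    apply: filterS3 (L2_funD (u k) (-1 *: l)) (L2_funZ (-1) l) lg => x -> -> ->.
    by rewrite mulN1r.
  apply: (@le_trans _ _ (\int[mu]_x ((8 * 4^-1 ^+ k)%:E * H x))%E).
    apply: ae_ge0_le_integral => //.
    - by move=> x _; rewrite lee_fin ip_ge0.
    - exact/measurable_EFinP/measurable_ip.
    - by move=> x _; rewrite mule_ge0 // lee_fin mulr_ge0 ?exprn_ge0.
    - exact: measurable_funeM.
    apply: filterS Hae => x Ax _; rewrite -[H x]fineK // -EFinM lee_fin.
    have := grk k x Ax; have := gik k x Ax; rewrite /ip /g.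
    by case: (u k x) => [a b] /=; rewrite -!expr2; lra.
  rewrite ge0_integralZl //.
  apply: (@le_trans _ _ ((8 * 4^-1 ^+ k)%:E * 2%:E)%E).
    by rewrite lee_wpmul2l // lee_fin mulr_ge0 ?exprn_ge0.
  by rewrite -EFinM lee_fin; set a := 4^-1 ^+ k; lra.
exists l => e e0; have e16 : 0 < e ^+ 2 / 16 by rewrite divr_gt0 ?exprn_gt0.
have /cvgrPdist_lt/(_ _ e16)[K _ hK] : (4^-1 ^+ k : R) @[k --> \oo] --> (0 : R).
  by apply: cvg_expr; rewrite ger0_norm // invf_lt1 // ltr1n.
exists K => k Kk; have := hK k Kk; rewrite /= sub0r normrN ger0_norm ?exprn_ge0 // => h1.
rewrite -ltr_sqr ?nnegrE ?rnorm_ge0 ?(ltW e0) //; have := ul k; lra.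
Qed.
End L2_facts.

(** * Integration over boxes *)

Section bounded_measurable.
Context d (T : measurableType d) (R : realType) (mu : {measure set T -> \bar R}).
Implicit Types (f g : T -> R) (D : set T).

(** Measurability and boundedness are required on the whole space, so one hypothesis gives
    integrability on every measurable set of finite measure and passes to slices. *)
Definition bmeas f := measurable_fun setT f /\ exists B : R, forall x, `|f x| <= B.

Lemma bmeas_cst (r : R) : bmeas (fun=> r).
Proof. by split; [exact: measurable_cst|exists `|r|]. Qed.

Lemma bmeasD f g : bmeas f -> bmeas g -> bmeas (fun x => f x + g x).
Proof.
move=> [mf [B fB]] [mg [C gC]]; split; first exact: measurable_funD.
by exists (B + C) => x; rewrite (le_trans (ler_normD _ _)) // lerD.
Qed.

Lemma bmeasM f g : bmeas f -> bmeas g -> bmeas (fun x => f x * g x).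
Proof.
move=> [mf [B fB]] [mg [C gC]]; split; first exact: measurable_funM.
by exists (B * C) => x; rewrite normrM ler_pM.
Qed.

Lemma bmeasZ (r : R) f : bmeas f -> bmeas (fun x => r * f x).
Proof. by apply: bmeasM; exact: bmeas_cst. Qed.

Lemma bmeasB f g : bmeas f -> bmeas g -> bmeas (fun x => f x - g x).
Proof.
move=> bf bg; rewrite (_ : (fun _ => _) = fun x => f x + -1 * g x).
  by apply: bmeasD => //; exact: bmeasZ.
by apply/funext => x; rewrite mulN1r.
Qed.

Lemma bmeasX f k : bmeas f -> bmeas (fun x => f x ^+ k).
Proof.
move=> [mf [B fB]]; split; first exact: measurable_funX.
by exists (B ^+ k) => x; rewrite normrX lerXn2r ?nnegrE // (le_trans _ (fB x)).
Qed.

Lemma bmeas_sum (I : Type) (r : seq I) (F : I -> T -> R) : (forall i, bmeas (F i)) ->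
  bmeas (fun x => \sum_(i <- r) F i x).
Proof.
move=> bF; elim: r => [|i r IH].
  by rewrite (_ : (fun _ => _) = fun=> 0); [exact: bmeas_cst|apply/funext => x; rewrite big_nil].
rewrite (_ : (fun _ => _) = fun x => F i x + \sum_(j <- r) F j x); first exact: bmeasD.
by apply/funext => x; rewrite big_cons.
Qed.

Variable D : set T.
Hypotheses (mD : measurable D) (Dfin : (mu D < +oo)%E).

Lemma bmeas_integrable f : bmeas f -> mu.-integrable D (EFin \o f).
Proof.
move=> [mf [B fB]]; apply: measurable_bounded_integrable => //.
  exact: measurable_funTS.
by exists B; split; rewrite ?num_real // => C BC x _ /=; apply: le_trans (fB x) (ltW BC).
Qed.

Lemma bintD f g : bmeas f -> bmeas g ->
  \int[mu]_(x in D) (f x + g x) = \int[mu]_(x in D) f x + \int[mu]_(x in D) g x.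
Proof. by move=> bf bg; rewrite RintegralD //; exact: bmeas_integrable. Qed.

Lemma bintB f g : bmeas f -> bmeas g ->
  \int[mu]_(x in D) (f x - g x) = \int[mu]_(x in D) f x - \int[mu]_(x in D) g x.
Proof. by move=> bf bg; rewrite RintegralB //; exact: bmeas_integrable. Qed.

Lemma bintZ (r : R) f : bmeas f -> \int[mu]_(x in D) (r * f x) = r * \int[mu]_(x in D) f x.
Proof. by move=> bf; rewrite RintegralZl //; exact: bmeas_integrable. Qed.

Lemma bint_le f g : bmeas f -> bmeas g -> (forall x, D x -> f x <= g x) ->
  \int[mu]_(x in D) f x <= \int[mu]_(x in D) g x.
Proof. by move=> bf bg fg; rewrite le_Rintegral //; exact: bmeas_integrable. Qed.

Lemma bint_sum (I : Type) (r : seq I) (F : I -> T -> R) : (forall i, bmeas (F i)) ->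
  \int[mu]_(x in D) (\sum_(i <- r) F i x) = \sum_(i <- r) \int[mu]_(x in D) F i x.
Proof.
move=> bF; elim: r => [|i r IH].
  rewrite big_nil -[RHS](mul0r (fine (mu D))) -Rintegral_cst //.
  by apply: eq_Rintegral => x _; rewrite big_nil.
rewrite big_cons -IH -bintD //; last exact: bmeas_sum.
by apply: eq_Rintegral => x _; rewrite big_cons.
Qed.

Variables (v : R) (v0 : 0 < v) (muD : mu D = v%:E).

(** The variance identity, [v] being the measure of [D]. Nonnegativity of the variance is
    Cauchy-Schwarz against the constant 1. *)
Lemma bint_sqr_sub f : bmeas f ->
  \int[mu]_(x in D) (f x - v^-1 * \int[mu]_(y in D) f y) ^+ 2 =
  \int[mu]_(x in D) f x ^+ 2 - v^-1 * (\int[mu]_(x in D) f x) ^+ 2.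
Proof.
move=> bf; set m := \int[mu]_(y in D) f y.
rewrite (@eq_Rintegral _ _ _ mu D (fun x => f x ^+ 2 + ((- 2 * v^-1 * m) * f x + (v^-1 * m) ^+ 2))).
  rewrite bintD; [|exact: bmeasX|apply: bmeasD; [exact: bmeasZ|exact: bmeas_cst]].
  rewrite bintD; [|exact: bmeasZ|exact: bmeas_cst].
  rewrite bintZ // Rintegral_cst // muD /= -/m; field; by rewrite gt_eqF.
by move=> x _; ring.
Qed.

Lemma bint_cauchy_schwarz f : bmeas f ->
  (\int[mu]_(x in D) f x) ^+ 2 <= v * \int[mu]_(x in D) f x ^+ 2.
Proof.
move=> bf; rewrite -ler_pdivrMl // -subr_ge0 -bint_sqr_sub //.
by apply: Rintegral_ge0 => x _; exact: sqr_ge0.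
Qed.

(** The deviation of [f s] from the mean is the average of [f s - f t] over [t], so Cauchy-Schwarz
    bounds its square by [K]. *)
Lemma bint_osc f (K : R) : bmeas f ->
  (forall s t, D s -> D t -> (f s - f t) ^+ 2 <= K) ->
  \int[mu]_(x in D) f x ^+ 2 <= v^-1 * (\int[mu]_(x in D) f x) ^+ 2 + v * K.
Proof.
move=> bf fK; rewrite -lerBlDl -bint_sqr_sub //; set m := v^-1 * _.
have bm s : bmeas (fun x => f s - f x) by apply: bmeasB => //; exact: bmeas_cst.
have sm s : D s -> (f s - m) ^+ 2 <= K.
  move=> Ds; have -> : f s - m = v^-1 * \int[mu]_(t in D) (f s - f t).
    rewrite bintB //; last exact: bmeas_cst.
    by rewrite Rintegral_cst // muD /= mulrBr mulrCA mulVf ?gt_eqF // mulr1.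
  rewrite exprMn; apply: le_trans (ler_wpM2l (sqr_ge0 _) (bint_cauchy_schwarz (bm s))) _.
  apply: (@le_trans _ _ (v^-1 ^+ 2 * (v * (K * v)))); last first.
    by rewrite le_eqVlt; apply/orP; left; apply/eqP; field; rewrite gt_eqF.
  rewrite ler_wpM2l ?sqr_ge0 // ler_wpM2l ?(ltW v0) //.
  have -> : K * v = \int[mu]_(x in D) K by rewrite Rintegral_cst // muD.
  by apply: bint_le => [||t Dt]; [exact: bmeasX|exact: bmeas_cst|exact: fK].
have -> : v * K = \int[mu]_(x in D) K by rewrite Rintegral_cst // muD mulrC.
apply: bint_le => [||t Dt]; [|exact: bmeas_cst|exact: sm].
by apply: bmeasX; apply: bmeasB => //; exact: bmeas_cst.
Qed.
End bounded_measurable.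

(** * Borel sets and half-open boxes of the space of rows *)

Section borel_row.
Variables (R : realType) (n : nat).
Implicit Types x y : 'rV[R]_n.

Lemma rV_ballP x y (e : R) : 0 < e -> ball x e y <-> forall i, `|x ord0 i - y ord0 i| < e.
Proof.
move=> e0; split=> [[_ xy] i|xy]; first by have := xy ord0 i.
by split => // i j; rewrite !ord1; exact: xy.
Qed.

Lemma measurable_rV_ball x (e : R) : 0 < e -> measurable (ball x e : set 'rV[R]_n).
Proof.
move=> e0; rewrite (_ : ball x e = \bigcap_(i in [set: 'I_n])
    ((fun y : 'rV[R]_n => y ord0 i) @^-1` ball (x ord0 i) e)).
  apply: fin_bigcap_measurable => [|i _]; first exact: finite_finset.
  rewrite -[X in measurable X]setTI; apply: (@measurable_coord R n i) => //.
  exact: measurable_ball.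
apply/seteqP; split => y /=; first by move=> /rV_ballP-/(_ e0) xy i _; exact: xy.
by move=> xy; apply/rV_ballP => // i; exact: xy.
Qed.

(** The sigma-algebra is generated by the coordinates, for which sup-norm balls are measurable; [U]
    is the union of the balls it contains with rational centre and radius $1/(k+1)$, a countable
    family. *)
Lemma open_measurable_rV (U : set 'rV[R]_n) : open U -> measurable U.
Proof.
move=> oU.
pose q (p : 'rV[rat]_n * nat) : 'rV[R]_n := \row_i ratr (p.1 ord0 i).
pose r (p : 'rV[rat]_n * nat) : R := p.2.+1%:R^-1.
pose F (p : 'rV[rat]_n * nat) := [set x | ball (q p) (r p) x /\ ball (q p) (r p) `<=` U].
have r0 p : 0 < r p by rewrite invr_gt0.
rewrite (_ : U = \bigcup_p F p).
  apply: countable_bigcupT_measurable => [|p]; [exact: countableP|rewrite /F].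
  have [h|h] := pselect (ball (q p) (r p) `<=` U).
    rewrite (_ : mkset _ = ball (q p) (r p)); first exact: measurable_rV_ball.
    by apply/seteqP; split => x /= [].
  rewrite (_ : mkset _ = set0) //.
  by apply/seteqP; split => x //= [].
apply/seteqP; split => [x Ux|x [p _ [qx]] /(_ x qx)//].
have /nbhs_ballP[e /= e0 eU] : nbhs x U by exact: open_nbhs_nbhs.
pose k := Num.truncn (2 / e).
have kR : 0 < k.+1%:R^-1 :> R by rewrite invr_gt0.
have ke : k.+1%:R^-1 + k.+1%:R^-1 < e.
  have : 2 / e < k.+1%:R by rewrite truncnS_gt.
  by rewrite ltr_pdivrMr // -ltr_pdivrMl // mulrDr !mulr1.
have /choice[z zP] : forall i, exists z : rat, `|ratr z - x ord0 i| < k.+1%:R^-1.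
  move: kR; set s := k.+1%:R^-1 => s0 i.
  have [|z] := @rat_in_itvoo R (x ord0 i - s) (x ord0 i + s); first lra.
  by rewrite in_itv /= => /andP[z1 z2]; exists z; rewrite ltr_norml; apply/andP; split; lra.
exists (\row_i z i, k) => //; split.
  by apply/rV_ballP => // i; rewrite !mxE.
move=> y /rV_ballP-/(_ kR) qy; apply: eU; apply/rV_ballP => // i.
have := qy i; have := zP i; rewrite !mxE /= distrC => h1 h2.
by apply: le_lt_trans ke; rewrite -(subrKA (ratr (z i))) (le_trans (ler_normD _ _)) // lerD // ltW.
Qed.

Lemma continuous_measurable_rV (f : 'rV[R]_n -> R) : continuous f -> measurable_fun setT f.
Proof.
move=> /continuousP cf; apply: (measurability _ (RGenOInfty.measurableE R)).
by move=> _ [_ [a ->] <-]; rewrite setTI; apply: open_measurable_rV; apply: cf; exact: interval_open.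
Qed.

(** Half-open, so that the cells of a grid are disjoint and still cover. *)
Definition box (a : 'I_n -> R) (e : R) : set 'rV[R]_n :=
  [set x | forall i, a i <= x ord0 i < a i + e].

Lemma measurable_box a e : measurable (box a e).
Proof.
rewrite (_ : box a e = \bigcap_(i in [set: 'I_n])
    ((fun y : 'rV[R]_n => y ord0 i) @^-1` `[a i, a i + e[)).
  apply: fin_bigcap_measurable => [|i _]; first exact: finite_finset.
  rewrite -[X in measurable X]setTI; exact: (@measurable_coord R n i).
apply/seteqP; split => y /=; first by move=> ya i _ /=; rewrite in_itv /=; exact: ya.
by move=> ya i; have := ya i I; rewrite /= in_itv.
Qed.
End borel_row.

Section cons_row.
Variables (R : realType) (n : nat).

Lemma cons_row0 (t : R) (x : 'rV[R]_n) : cons_row (t, x) ord0 ord0 = t.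
Proof.
rewrite (_ : ord0 = lshift n (ord0 : 'I_1)); last exact: val_inj.
transitivity ((t%:M : 'M[R]_1) ord0 ord0); first exact: row_mxEl.
by rewrite mxE eqxx mulr1n.
Qed.

Lemma cons_rowS (t : R) (x : 'rV[R]_n) j : cons_row (t, x) ord0 (lift ord0 j) = x ord0 j.
Proof.
rewrite (_ : lift ord0 j = rshift 1 j); last exact: val_inj.
exact: row_mxEr.
Qed.

Lemma preimage_cons_box (a : 'I_n.+1 -> R) (e : R) : @cons_row R n @^-1` box a e =
  `[a ord0, a ord0 + e[ `*` box (fun i => a (lift ord0 i)) e.
Proof.
apply/seteqP; split => -[t x] /= tx.
  split=> [|i]; first by have := tx ord0; rewrite cons_row0 in_itv.
  by have := tx (lift ord0 i); rewrite cons_rowS.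
move=> i; have [j ->|->] := unliftP ord0 i; first by rewrite cons_rowS; exact: tx.2.
by rewrite cons_row0; have := tx.1; rewrite in_itv.
Qed.

Lemma cons_row_continuous (t : R) (x : 'rV[R]_n) : {for (t, x), continuous (@cons_row R n)}.
Proof.
apply/cvg_ballP => e e0.
exists (ball t e, ball x e) => /=; first by split; exact: nbhsx_ballx.
move=> [s y] [/= st yx]; apply/rV_ballP => // i.
have [j ->|->] := unliftP ord0 i; first by rewrite !cons_rowS; exact: (proj1 (rV_ballP x y e0) yx).
by rewrite !cons_row0.
Qed.

Lemma slice_continuous0 (x : 'rV[R]_n) : continuous (fun t : R => cons_row (t, x)).
Proof.
move=> t; apply: (@continuous_comp _ _ _ (fun t => (t, x)) (@cons_row R n)).
  by apply: (@cvg_pair _ _ _ (nbhs t) (nbhs t) (nbhs x)); [exact: cvg_id|exact: cvg_cst].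
exact: cons_row_continuous.
Qed.

Lemma slice_continuousS (t : R) : continuous (fun x : 'rV[R]_n => cons_row (t, x)).
Proof.
move=> x; apply: (@continuous_comp _ _ _ (fun x => (t, x)) (@cons_row R n)).
  by apply: (@cvg_pair _ _ _ (nbhs x) (nbhs t) (nbhs x)); [exact: cvg_cst|exact: cvg_id].
exact: cons_row_continuous.
Qed.
End cons_row.

Section box_integrals.
Variable R : realType.
Local Notation mu := (lebesgue_row R).

Lemma lebesgue_itvco (a e : R) : 0 < e -> lebesgue_measure `[a, a + e[ = e%:E :> \bar R.
Proof.
move=> e0; rewrite lebesgue_measure_itv /= lte_fin ltrDl e0 -EFinB addrAC subrr add0r //.
Qed.

Lemma lebesgue_row_boxco n (a : 'I_n -> R) e : 0 < e -> mu n (box a e) = (e ^+ n)%:E.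
Proof.
move=> e0; elim: n a => [|n IH] a.
  by rewrite /= diracE mem_set // => -[].
rewrite /= /lebesgue_cons /pushforward preimage_cons_box.
rewrite product_measure2E //; last exact: measurable_box.
rewrite [X in (X * _)%E](_ : _ = e%:E); last exact: lebesgue_itvco.
by rewrite IH exprS -EFinM.
Qed.

Lemma lebesgue_row_boxlty n (a : 'I_n -> R) e : 0 < e -> (mu n (box a e) < +oo)%E.
Proof. by move=> e0; rewrite lebesgue_row_boxco // ltry. Qed.

(** Fubini is stated for measures carrying a sigma-finite structure. An exhaustion by cubes gives
    the property, and a structured copy equal to [mu n] is then used in its place. *)
Lemma lebesgue_row_sigma_finite n : exists m : {sigma_finite_measure set 'rV[R]_n -> \bar R},
  (m : {measure set 'rV[R]_n -> \bar R}) = mu n.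
Proof.
have sf : sigma_finite setT (mu n).
  exists (fun k => box (fun=> - k.+1%:R) (k.+1%:R *+ 2)); last first.
    by move=> k; split; [exact: measurable_box|apply: lebesgue_row_boxlty; rewrite pmulrn_lgt0].
  apply/seteqP; split => // x _.
  pose k := \max_(i < n) Num.truncn `|x ord0 i|.
  exists k => // i; rewrite mulr2n addrA addNr add0r.
  have : `|x ord0 i| < k.+1%:R.
    apply: lt_le_trans (truncnS_gt _) _; rewrite ler_nat ltnS /k.
    exact: (leq_bigmax (F := fun i => Num.truncn `|x ord0 i|)).
  by rewrite ltr_norml => /andP[/ltW -> ->].
move: (mu n) sf => m sf.
pose H2 := isSFinite.Build _ _ _ _ (sfinite_measure_sigma_finite sf).
pose H3 := isSigmaFinite.Build _ _ _ _ sf.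
pose m' := HB.pack_for {sigma_finite_measure set 'rV[R]_n -> \bar R} (Measure.sort m) H2 H3.
by exists m'; exact: eq_measure.
Qed.
End box_integrals.

(** * Fubini for bounded functions on rectangles and boxes *)

Section rectangle_fubini.
Context d1 d2 (T1 : measurableType d1) (T2 : measurableType d2) (R : realType).
Variables (m1 : {sigma_finite_measure set T1 -> \bar R})
          (m2 : {sigma_finite_measure set T2 -> \bar R}).
Variables (A : set T1) (D : set T2) (f : T1 * T2 -> R).
Hypotheses (mA : measurable A) (mD : measurable D).
Hypotheses (Afin : (m1 A < +oo)%E) (Dfin : (m2 D < +oo)%E) (bf : bmeas f).

Lemma bmeas_slice1 t : bmeas (fun x => f (t, x)).
Proof. by case: bf => mf [B fB]; split; [exact: measurableT_comp|exists B]. Qed.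

Lemma bmeas_slice2 x : bmeas (fun t => f (t, x)).
Proof. by case: bf => mf [B fB]; split; [exact: measurableT_comp|exists B]. Qed.

Lemma bmeas_int_slice1 : bmeas (fun t => \int[m2]_(x in D) f (t, x)).
Proof.
case: bf => mf [B fB]; split; last first.
  exists (B * fine (m2 D)) => t; apply: (le_trans (le_normr_Rintegral _ _)) => //.
    exact/(bmeas_integrable mD Dfin)/bmeas_slice1.
  rewrite -Rintegral_cst //; apply: (bint_le mD Dfin) => //; last exact: bmeas_cst.
  have [ms _] := bmeas_slice1 t; split; first exact: measurableT_comp.
  by exists B => x; rewrite normr_id.
(* Tonelli measurability asks for a nonnegative integrand on the whole product: add the bound [B],
   cut off outside [D], and subtract the constant [B * mu D] afterwards. *)
pose g p := ((f p + B) * \1_(setT `*` D) p)%:E.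
have g0 p : (0 <= g p)%E.
  rewrite lee_fin mulr_ge0 // ; have := fB p; rewrite ler_norml => /andP[h _]; lra.
have mg : measurable_fun setT g.
  apply/measurable_EFinP/measurable_funM; first exact: measurable_funD.
  by apply: measurable_indic; exact: measurableX.
have := measurable_fun_fubini_tonelli_F (m2 := m2) g mg g0.
rewrite (_ : fubini_F m2 g = EFin \o (fun t => \int[m2]_(x in D) f (t, x) + B * fine (m2 D))).
  move/measurable_EFinP => h.
  rewrite (_ : (fun _ => _) = fun t => (\int[m2]_(x in D) f (t, x) + B * fine (m2 D)) - B * fine (m2 D)).
    exact: measurable_funB.
  by apply/funext => t; rewrite addrK.
apply/funext => t; rewrite /fubini_F /= -Rintegral_cst // -(bintD mD Dfin); last 2 first.
- exact: bmeas_slice1.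
- exact: bmeas_cst.
rewrite fineK; last first.
  apply: (integrable_fin_num mD); apply: (bmeas_integrable mD Dfin).
  by apply: bmeasD; [exact: bmeas_slice1|exact: bmeas_cst].
rewrite [RHS]integral_mkcond; apply: eq_integral => x _.
rewrite /g patchE indicE; have [xD|xD] := boolP (x \in D).
  by rewrite mem_set ?mulr1 //=; split => //; exact: set_mem.
rewrite memNset ?mulr0 // => -[_ /= xD']; by move: xD; rewrite mem_set.
Qed.

(** Extension by 0 outside the rectangle makes [f] integrable on the whole product. The product
    [\x^] is the one that defines [lebesgue_cons]. *)
Lemma rectangle_fubini : \int[(m1 \x^ m2)%E]_(p in A `*` D) f p =
  \int[m1]_(t in A) \int[m2]_(x in D) f (t, x).
Proof.
have mAD : measurable (A `*` D) by exact: measurableX.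
have iAD : (m1 \x m2)%E.-integrable setT ((EFin \o f) \_ (A `*` D)).
  apply: (proj1 (integrable_mkcond _ mAD)).
  apply: (@bmeas_integrable _ _ _ (m1 \x m2)%E _ mAD _ f bf).
  have : (m1 A * m2 D < +oo)%E by rewrite lte_mul_pinfty // ge0_fin_numE.
  by rewrite -(product_measure1E m1 m2 mA mD).
have iD t : m2.-integrable D (fun x => (f (t, x))%:E).
  exact/(bmeas_integrable mD Dfin)/bmeas_slice1.
rewrite /Rintegral; congr fine; rewrite integral_mkcond -(integral12_prod_meas2 iAD).
rewrite [RHS]integral_mkcond; apply: eq_integral => t _; rewrite /fubini_F patchE.
have [tA|tA] := boolP (t \in A).
  rewrite fineK; last exact: (integrable_fin_num mD).
  rewrite [RHS]integral_mkcond; apply: eq_integral => x _; rewrite !patchE.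
  have [xD|xD] := boolP (x \in D).
    by rewrite mem_set //; split; exact: set_mem.
  rewrite memNset // => -[_ /= xD']; by move: xD; rewrite mem_set.
rewrite (eq_integral (cst 0%E)) ?integral0 // => x _; rewrite patchE memNset //.
by move=> [/= tA' _]; move: tA; rewrite mem_set.
Qed.
End rectangle_fubini.

Section rectangle_fubini_swap.
Context d1 d2 (T1 : measurableType d1) (T2 : measurableType d2) (R : realType).
Variables (m1 : {sigma_finite_measure set T1 -> \bar R})
          (m2 : {sigma_finite_measure set T2 -> \bar R}).
Variables (A : set T1) (D : set T2) (f : T1 * T2 -> R).
Hypotheses (mA : measurable A) (mD : measurable D).
Hypotheses (Afin : (m1 A < +oo)%E) (Dfin : (m2 D < +oo)%E) (bf : bmeas f).

Let bfs : bmeas (fun p : T2 * T1 => f (p.2, p.1)).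
Proof.
case: bf => mf [B fB]; split; last by exists B => p.
by apply: measurableT_comp => //; exact: measurable_swap.
Qed.

Lemma bmeas_int_slice2 : bmeas (fun x => \int[m1]_(t in A) f (t, x)).
Proof. exact: (bmeas_int_slice1 mA Afin bfs). Qed.

Lemma rectangle_fubini_swap : \int[m1]_(t in A) \int[m2]_(x in D) f (t, x) =
  \int[m2]_(x in D) \int[m1]_(t in A) f (t, x).
Proof.
have mAD : measurable (A `*` D) by exact: measurableX.
have iAD : (m1 \x m2)%E.-integrable setT ((EFin \o f) \_ (A `*` D)).
  apply: (proj1 (integrable_mkcond _ mAD)).
  apply: (@bmeas_integrable _ _ _ (m1 \x m2)%E _ mAD _ f bf).
  have : (m1 A * m2 D < +oo)%E by rewrite lte_mul_pinfty // ge0_fin_numE.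
  by rewrite -(product_measure1E m1 m2 mA mD).
have iA x : m1.-integrable A (fun t => (f (t, x))%:E).
  exact/(bmeas_integrable mA Afin)/(bmeas_slice2 bf).
rewrite -(rectangle_fubini mA mD Afin Dfin bf).
rewrite /Rintegral; congr fine; rewrite integral_mkcond -(integral21_prod_meas2 iAD).
rewrite [RHS]integral_mkcond; apply: eq_integral => x _; rewrite /fubini_G patchE.
have [xD|xD] := boolP (x \in D).
  rewrite fineK; last exact: (integrable_fin_num mA).
  rewrite [RHS]integral_mkcond; apply: eq_integral => t _; rewrite !patchE.
  have [tA|tA] := boolP (t \in A).
    by rewrite mem_set //; split; exact: set_mem.
  rewrite memNset // => -[/= tA' _]; by move: tA; rewrite mem_set.
rewrite (eq_integral (cst 0%E)) ?integral0 // => t _; rewrite patchE memNset //.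
by move=> [_ /= xD']; move: xD; rewrite mem_set.
Qed.
End rectangle_fubini_swap.

Section box_fubini.
Variables (R : realType) (n : nat).
Local Notation mu := (lebesgue_row R).
Local Notation leb := (@lebesgue_measure R).
Variables (a : 'I_n.+1 -> R) (e : R) (e0 : 0 < e) (f : 'rV[R]_n.+1 -> R) (bf : bmeas f).
Local Notation a' := (fun i => a (lift ord0 i)).
Local Notation I := `[a ord0, a ord0 + e[%classic.
Local Notation Q := (box a' e).

Let bfc : bmeas (f \o @cons_row R n).
Proof.
case: bf => mf [B fB]; split; last by exists B => p; exact: fB.
exact: measurableT_comp mf (@measurable_cons_row R n).
Qed.

Let Ifin : (leb I < +oo)%E. Proof. by rewrite lebesgue_itvco // ltry. Qed.

Lemma bmeas_box_slice t : bmeas (fun x => f (cons_row (t, x))).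
Proof. exact: bmeas_slice1 bfc t. Qed.

Lemma bmeas_int_box : bmeas (fun t => \int[mu n]_(x in Q) f (cons_row (t, x))).
Proof.
have [m mE] := lebesgue_row_sigma_finite R n; rewrite -mE.
apply: (bmeas_int_slice1 (m2 := m) _ _ bfc); first exact: measurable_box.
have := lebesgue_row_boxlty a' e0; by rewrite -mE.
Qed.

Lemma bmeas_int_itv : bmeas (fun x => \int[leb]_(t in I) f (cons_row (t, x))).
Proof. exact: (bmeas_int_slice2 (m1 := leb) _ Ifin bfc). Qed.

Lemma box_fubini : \int[mu n.+1]_(x in box a e) f x =
  \int[leb]_(t in I) \int[mu n]_(x in Q) f (cons_row (t, x)).
Proof.
rewrite [mu n.+1]/=.
have [m mE] := lebesgue_row_sigma_finite R n; rewrite -mE.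
have Qfin : (m Q < +oo)%E by have := lebesgue_row_boxlty a' e0; rewrite -mE.
rewrite -(rectangle_fubini _ (measurable_box _ _) Ifin Qfin bfc) //.
rewrite -preimage_cons_box /Rintegral; congr fine.
apply: integral_pushforward.
- exact: measurable_cons_row.
- by apply/measurable_EFinP; case: bf.
- rewrite preimage_cons_box; apply: bmeas_integrable => //.
    by apply: measurableX => //; exact: measurable_box.
  have : (leb I * m Q < +oo)%E by rewrite lte_mul_pinfty // ge0_fin_numE.
  by rewrite -(product_measure2E leb m _ (measurable_box _ _)).
- exact: measurable_box.
Qed.

Lemma box_fubini_swap : \int[mu n.+1]_(x in box a e) f x =
  \int[mu n]_(x in Q) \int[leb]_(t in I) f (cons_row (t, x)).
Proof.
rewrite box_fubini; have [m mE] := lebesgue_row_sigma_finite R n; rewrite -mE.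
have Qfin : (m Q < +oo)%E by have := lebesgue_row_boxlty a' e0; rewrite -mE.
exact: (rectangle_fubini_swap (m1 := leb) _ (measurable_box _ _) Ifin Qfin bfc).
Qed.
End box_fubini.

(** * The Poincare inequality *)

Section slices.
Variables (R : realType).
Implicit Types (n : nat).

Definition bcont (T : topologicalType) (f : T -> R) :=
  continuous f /\ exists B : R, forall x, `|f x| <= B.

Lemma bcont_bmeas n (f : 'rV[R]_n -> R) : bcont f -> bmeas f.
Proof. by move=> [cf bf]; split => //; exact: continuous_measurable_rV. Qed.

Lemma bcont_bmeas1 (f : R -> R) : bcont f -> bmeas f.
Proof. by move=> [cf bf]; split => //; exact: continuous_measurable_fun. Qed.

(** The conditions hold on the whole space, so slices remain in the class and inductions on the
    dimension need no boundary conditions on the domain. *)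
Definition C1b n (f : 'rV[R]_n -> R) := bcont f /\
  forall i, (forall x, derivable f x (delta_mx ord0 i)) /\ bcont (partial i f).

Lemma bcont_slice0 n (f : 'rV[R]_n.+1 -> R) x : bcont f -> bcont (fun t : R => f (cons_row (t, x))).
Proof.
move=> [cf [B fB]]; split; last by exists B.
move=> t; apply: (@continuous_comp _ _ _ (fun t => cons_row (t, x)) f).
  exact: slice_continuous0.
exact: cf.
Qed.

Lemma bcont_sliceS n (f : 'rV[R]_n.+1 -> R) t : bcont f ->
  bcont (fun x : 'rV[R]_n => f (cons_row (t, x))).
Proof.
move=> [cf [B fB]]; split; last by exists B.
move=> x; apply: (@continuous_comp _ _ _ (fun x => cons_row (t, x)) f).
  exact: slice_continuousS.
exact: cf.
Qed.

Lemma cons_row_shift0 n (h t : R) (x : 'rV[R]_n) :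
  cons_row (h *: 1 + t, x) = h *: delta_mx ord0 ord0 + cons_row (t, x).
Proof.
apply/rowP => i; rewrite [RHS]mxE [X in _ = X + _]mxE [X in _ = _ * X + _]mxE /=; have [j ->|->] := unliftP ord0 i.
  by rewrite !cons_rowS mulr0 add0r.
by rewrite !cons_row0.
Qed.

Lemma cons_row_shiftS n (h t : R) (x : 'rV[R]_n) j :
  cons_row (t, h *: delta_mx ord0 j + x) = h *: delta_mx ord0 (lift ord0 j) + cons_row (t, x).
Proof.
apply/rowP => i; rewrite [RHS]mxE [X in _ = X + _]mxE [X in _ = _ * X + _]mxE /=; have [k ->|->] := unliftP ord0 i.
  by rewrite !cons_rowS !mxE /= (inj_eq lift_inj).
by rewrite !cons_row0 mulr0 add0r.
Qed.

Lemma partial_slice0 n (f : 'rV[R]_n.+1 -> R) t x :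
  derivable f (cons_row (t, x)) (delta_mx ord0 ord0) ->
  is_derive t 1 (fun s : R => f (cons_row (s, x))) (partial ord0 f (cons_row (t, x))).
Proof.
have E : (fun h : R => h^-1 *: (((fun s => f (cons_row (s, x))) \o shift t) (h *: (1 : R)) - f (cons_row (t, x)))) =
    (fun h => h^-1 *: ((f \o shift (cons_row (t, x))) (h *: delta_mx ord0 ord0) - f (cons_row (t, x)))).
  by apply/funext => h /=; rewrite cons_row_shift0.
move=> df; apply: DeriveDef; first by rewrite /derivable E.
by rewrite /partial /derive E.
Qed.

Lemma partial_sliceS n (f : 'rV[R]_n.+1 -> R) t x j :
  partial j (fun y => f (cons_row (t, y))) x = partial (lift ord0 j) f (cons_row (t, x)) /\
  (derivable f (cons_row (t, x)) (delta_mx ord0 (lift ord0 j)) ->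
   derivable (fun y => f (cons_row (t, y))) x (delta_mx ord0 j)).
Proof.
have E : (fun h : R => h^-1 *: (((fun y => f (cons_row (t, y))) \o shift x) (h *: delta_mx ord0 j) - f (cons_row (t, x)))) =
    (fun h => h^-1 *: ((f \o shift (cons_row (t, x))) (h *: delta_mx ord0 (lift ord0 j)) - f (cons_row (t, x)))).
  by apply/funext => h /=; rewrite cons_row_shiftS.
by split; [rewrite /partial /derive E|rewrite /derivable E].
Qed.

Lemma C1b_slice n (f : 'rV[R]_n.+1 -> R) t : C1b f -> C1b (fun x => f (cons_row (t, x))).
Proof.
move=> [cf df]; split=> [|j]; first exact: bcont_sliceS.
have [dj cj] := df (lift ord0 j); split.
  by move=> x; have [_] := partial_sliceS f t x j; apply; exact: dj.
rewrite (_ : partial j _ = fun x => partial (lift ord0 j) f (cons_row (t, x))).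
  exact: bcont_sliceS.
by apply/funext => x; have [] := partial_sliceS f t x j.
Qed.
End slices.

Section calculus.
Variable R : realType.
Local Notation mu := (lebesgue_row R).
Local Notation leb := (@lebesgue_measure R).

Lemma FTC_itvco (F f : R -> R) (a b : R) : a < b -> bcont f ->
  (forall t : R, is_derive t (1 : R) F (f t)) -> \int[leb]_(t in `[a, b[) f t = F b - F a.
Proof.
move=> ab bf dF; have [cf _] := bf.
have cF : continuous F.
  by move=> t; apply: differentiable_continuous; apply/derivable1_diffP; case: (dF t).
have fin : (leb `[a, b[ < +oo)%E by rewrite lebesgue_measure_itv /= lte_fin ab -EFinB ltry.
rewrite Rintegral_itv_bndo_bndc; last first.
  have mI : measurable `[a, b[%classic by [].
  exact: (bmeas_integrable (mu := leb) mI fin (bcont_bmeas1 bf)).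
rewrite /Rintegral (@continuous_FTC2 _ f F) //.
- exact: continuous_subspaceT.
- split.
  + by move=> t _; exact: (@ex_derive _ _ _ _ _ _ _ (dF t)).
  + exact: (cvg_at_right_filter (cF a)).
  + exact: (cvg_at_left_filter (cF b)).
- by move=> t _; rewrite derive1E (@derive_val _ _ _ _ _ _ _ (dF t)).
Qed.

(** In the first direction, Fubini puts that variable innermost and the fundamental theorem of
    calculus leaves values on two opposite faces. Any other direction is a direction of the slices,
    handled by induction. *)
Lemma integral_partial_eq0 n (a : 'I_n -> R) (e : R) (i : 'I_n) (f : 'rV[R]_n -> R) :
  0 < e -> C1b f ->
  (forall x : 'rV[R]_n, x ord0 i = a i \/ x ord0 i = a i + e -> f x = 0) ->
  \int[mu n]_(x in box a e) partial i f x = 0.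
Proof.
move=> e0; elim: n a i f => [a []//|n IH a i f [cf df] f0].
have [dfi cfi] := df i; have mfi := bcont_bmeas cfi.
have [j ij|i0] := unliftP ord0 i.
  rewrite box_fubini // (@eq_Rintegral _ _ _ _ _ (fun=> 0)) ?Rintegral_cst ?mul0r // => t _.
  have E x : partial j (fun y => f (cons_row (t, y))) x = partial i f (cons_row (t, x)).
    by rewrite ij; have [] := partial_sliceS f t x j.
  rewrite -[RHS](IH (fun i => a (lift ord0 i)) j (fun y => f (cons_row (t, y)))).
  - by apply: eq_Rintegral => x _; rewrite E.
  - exact: C1b_slice.
  - by move=> x xj; apply: f0; rewrite ij cons_rowS.
rewrite box_fubini_swap // (@eq_Rintegral _ _ _ _ _ (fun=> 0)); last first.
  move=> x _; have dF (t : R) : is_derive t (1 : R) (fun t => f (cons_row (t, x)))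
      (partial i f (cons_row (t, x))).
    by rewrite i0; apply: partial_slice0; rewrite -i0.
  have ab : a ord0 < a ord0 + e by rewrite ltrDl.
  apply: etrans (FTC_itvco ab (bcont_slice0 x cfi) dF) _.
  by rewrite !f0 ?subrr // i0 cons_row0; [left|right].
by rewrite Rintegral_cst ?mul0r //; exact: measurable_box.
Qed.

(** [F s - F t] is the integral of [f] from [t] to [s]; Cauchy-Schwarz on that interval gives the
    bound, which is then enlarged to the full length [e]. *)
Lemma itv_osc (F f : R -> R) (a e : R) : 0 < e -> bcont f ->
  (forall t : R, is_derive t (1 : R) F (f t)) -> forall s t, `[a, a + e[%classic s -> `[a, a + e[%classic t ->
  (F s - F t) ^+ 2 <= e * \int[leb]_(r in `[a, a + e[) f r ^+ 2.
Proof.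
move=> e0 bf dF; have mf := bcont_bmeas1 bf.
have mf2 := bmeasX 2 mf.
have Ifin : (leb `[a, (a + e)%R[ < +oo)%E by rewrite lebesgue_itvco // ltry.
have I0 : 0 <= \int[leb]_(r in `[a, a + e[) f r ^+ 2.
  by apply: Rintegral_ge0 => r _; exact: sqr_ge0.
suff H s t : `[a, a + e[%classic s -> `[a, a + e[%classic t -> t < s ->
    (F s - F t) ^+ 2 <= e * \int[leb]_(r in `[a, a + e[) f r ^+ 2.
  move=> s t Is It; have [ts|st|->] := ltgtP t s; first exact: H.
    by rewrite -sqrrN opprB; exact: H.
  by rewrite subrr expr0n mulr_ge0 // ltW.
rewrite /= !in_itv /= => /andP[as_ sae] /andP[at_ tae] ts.
have st0 : 0 < s - t by rewrite subr_gt0.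
have E : leb `[t, s[ = (s - t)%:E by rewrite lebesgue_measure_itv /= lte_fin ts.
have fin : (leb `[t, s[ < +oo)%E by rewrite E ltry.
rewrite -(FTC_itvco ts bf dF).
apply: le_trans (bint_cauchy_schwarz _ fin st0 E mf) _ => //.
apply: ler_pM; [exact: ltW|by apply: Rintegral_ge0 => r _; exact: sqr_ge0|lra|].
rewrite /Rintegral fine_le //.
- by apply: (integrable_fin_num _) => //; exact: bmeas_integrable.
- by apply: (integrable_fin_num _) => //; exact: bmeas_integrable.
apply: ge0_subset_integral => //.
- by apply/measurable_EFinP/measurable_funTS; case: mf2.
- by move=> r _; rewrite lee_fin sqr_ge0.
- move=> r /=; rewrite !in_itv /= => /andP[tr rs]; apply/andP; split.
    exact: le_trans tr.
  exact: lt_trans sae.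
Qed.

(* By induction on the dimension: the average [G t] of [f] over the slice at
   height [t] oscillates by at most [sqrt (e ^ (n+1) A)], where [A] is the
   integral of the square of the derivative of [f] in the first direction. *)
Lemma poincare_box n (a : 'I_n -> R) (e : R) (f : 'rV[R]_n -> R) : 0 < e -> C1b f ->
  \int[mu n]_(x in box a e) f x ^+ 2 <=
    (e ^+ n)^-1 * (\int[mu n]_(x in box a e) f x) ^+ 2 +
    e ^+ 2 * \sum_(i < n) \int[mu n]_(x in box a e) partial i f x ^+ 2.
Proof.
move=> e0; elim: n a f => [a f _|n IH a f C1f].
  rewrite big_ord0 mulr0 addr0 expr0 invr1 mul1r.
  have E (h : 'rV[R]_0 -> R) : \int[mu 0]_(x in box a e) h x = h 0.
    rewrite (@eq_Rintegral _ _ _ _ _ (fun=> h 0)); last first.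
      by move=> x _; congr h; apply/rowP => -[].
    rewrite Rintegral_cst; last exact: measurable_box.
    by rewrite lebesgue_row_boxco // expr0 mulr1.
  by rewrite !E.
have [cf df] := C1f; have mf := bcont_bmeas cf; have mf2 := bmeasX 2 mf.
have md i : bmeas (partial i f) by apply: bcont_bmeas; case: (df i).
have md2 i := bmeasX 2 (md i).
pose a' (i : 'I_n) := a (lift ord0 i).
pose I := `[a ord0, a ord0 + e[%classic; pose Q := box a' e.
have mQ : measurable Q by exact: measurable_box.
have Qfin : (mu n Q < +oo)%E by exact: lebesgue_row_boxlty.
have muQ : mu n Q = (e ^+ n)%:E by exact: lebesgue_row_boxco.
have Ifin : (leb I < +oo)%E by rewrite lebesgue_itvco // ltry.
have muI : leb I = e%:E by exact: lebesgue_itvco.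
have mI : measurable I by exact: measurable_itv.
have en0 : 0 < e ^+ n by rewrite exprn_gt0.
pose G t := \int[mu n]_(x in Q) f (cons_row (t, x)).
have mG : bmeas G by exact: bmeas_int_box.
pose A := \int[mu n.+1]_(x in box a e) partial ord0 f x ^+ 2.
(* Cauchy-Schwarz over the section [Q] costs [e ^+ n]; [itv_osc] along each line in the first
   direction costs the remaining [e]. *)
have oscG s t : I s -> I t -> (G s - G t) ^+ 2 <= e ^+ n * (e * A).
  move=> Is It; have ms := bmeas_box_slice mf s; have mt := bmeas_box_slice mf t.
  rewrite /G -(bintB mQ Qfin ms mt).
  apply: le_trans (bint_cauchy_schwarz mQ Qfin en0 muQ (bmeasB ms mt)) _.
  rewrite ler_wpM2l ?(ltW en0) // /A box_fubini_swap //.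
  have mi := bmeas_int_itv a e0 (md2 ord0).
  rewrite -(bintZ mQ Qfin) //; apply: (bint_le mQ Qfin).
  - exact/bmeasX/bmeasB.
  - exact: bmeasZ.
  move=> x _; apply: (@itv_osc (fun t => f (cons_row (t, x)))) => //.
    by apply: bcont_slice0; case: (df ord0).
  by move=> r; apply: partial_slice0; case: (df ord0).
have H t : \int[mu n]_(x in Q) f (cons_row (t, x)) ^+ 2 <=
    (e ^+ n)^-1 * G t ^+ 2 +
    e ^+ 2 * \sum_(j < n) \int[mu n]_(x in Q) partial (lift ord0 j) f (cons_row (t, x)) ^+ 2.
  apply: le_trans (IH a' _ (C1b_slice t C1f)) _; rewrite lerD2l.
  apply: ler_wpM2l; first exact: sqr_ge0.
  apply: ler_sum => j _.
  rewrite le_eqVlt; apply/orP; left; apply/eqP; apply: eq_Rintegral => x _.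
  by have [-> _] := partial_sliceS f t x j.
rewrite box_fubini //.
have mB : bmeas (fun t => \sum_(j < n) \int[mu n]_(x in Q)
    partial (lift ord0 j) f (cons_row (t, x)) ^+ 2).
  by apply: bmeas_sum => j; exact: (bmeas_int_box a e0 (md2 (lift ord0 j))).
apply: (@le_trans _ _ (\int[leb]_(t in I) ((e ^+ n)^-1 * G t ^+ 2 + e ^+ 2 *
    \sum_(j < n) \int[mu n]_(x in Q) partial (lift ord0 j) f (cons_row (t, x)) ^+ 2))).
  apply: (bint_le (mu := leb) mI Ifin) => [||t _]; [exact: (bmeas_int_box a e0 mf2)| |exact: H].
  by apply: bmeasD; apply: bmeasZ => //; exact: bmeasX.
rewrite (bintD (mu := leb) mI Ifin); [|exact/bmeasZ/bmeasX|exact: bmeasZ].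
rewrite (bintZ (mu := leb) mI Ifin) ?(bintZ (mu := leb) mI Ifin) //; last exact: bmeasX.
rewrite (bint_sum (mu := leb) mI Ifin); last first.
  by move=> j; exact: (bmeas_int_box a e0 (md2 (lift ord0 j))).
(* Multiplied by $e^{-n}$, this turns the slice term into $e^{-(n+1)}(\int G)^2+e^2A$; the last
   summand is the missing first direction of the gradient. *)
have h1 := bint_osc (mu := leb) mI Ifin e0 muI mG oscG.
rewrite big_ord_recl mulrDr -/A addrA; apply: lerD; last first.
  apply: ler_wpM2l; first exact: sqr_ge0.
  apply: ler_sum => j _.
  by rewrite -(box_fubini a e0 (md2 _)).
have -> : \int[mu n.+1]_(x in box a e) f x = \int[leb]_(t in I) G t by rewrite box_fubini.
apply: le_trans (ler_wpM2l _ h1) _; first by rewrite invr_ge0 ltW.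
rewrite le_eqVlt; apply/orP; left; apply/eqP; rewrite (exprS e n).
by field; rewrite !gt_eqF.
Qed.
End calculus.

(** * Compactly supported functions, integration by parts and the grid estimate *)

Section compactly_supported.
Variables (R : realType) (n : nat).
Local Notation mu := (lebesgue_row R n).
Implicit Types (f g phi : 'rV[R]_n -> R).

(** Compact support is encoded as vanishing once some coordinate reaches [L] in absolute value. This
    covers the complement of the cube and its faces, where boundary terms are evaluated. *)
Definition ccont f := bcont f /\
  exists2 L : R, 0 < L & forall (x : 'rV[R]_n) i, L <= `|x ord0 i| -> f x = 0.

Definition cube (M : R) : set 'rV[R]_n := box (fun=> - M) (M *+ 2).

Lemma not_cube (M : R) (x : 'rV[R]_n) : ~ cube M x -> exists i, M <= `|x ord0 i|.
Proof.
move=> xM; apply: contrapT => /forallNP nx; apply: xM => i.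
rewrite mulr2n addrA addNr add0r.
by have /negP := nx i; rewrite -ltNge ltr_norml => /andP[/ltW -> ->].
Qed.

Lemma cube_lty (M : R) : 0 < M -> (mu (cube M) < +oo)%E.
Proof. by move=> M0; apply: lebesgue_row_boxlty; rewrite pmulrn_lgt0. Qed.

Lemma measurable_cube (M : R) : measurable (cube M).
Proof. exact: measurable_box. Qed.

Lemma integral_cube f (M : R) : (forall x, ~ cube M x -> f x = 0) ->
  \int[mu]_x f x = \int[mu]_(x in cube M) f x.
Proof.
move=> f0; rewrite [RHS]Rintegral_mkcond; apply: eq_Rintegral => x _.
rewrite patchE; case: ifPn => // xM; apply: f0 => xM'.
by move: xM; rewrite mem_set.
Qed.

Lemma ccont_cube f : ccont f -> exists2 L : R, 0 < L &
  forall M, L <= M -> forall x, ~ cube M x -> f x = 0.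
Proof.
move=> [_ [L L0 fL]]; exists L => // M LM x /not_cube[i Mx].
by apply: (fL x i); exact: le_trans Mx.
Qed.

Lemma ccont_bmeas f : ccont f -> bmeas f. Proof. by case=> /bcont_bmeas. Qed.

Lemma ccont_integrable f : ccont f -> mu.-integrable setT (EFin \o f).
Proof.
move=> cf; have [L L0 fL] := ccont_cube cf.
have := bmeas_integrable (measurable_cube L) (cube_lty L0) (ccont_bmeas cf).
move/(integrable_mkcond _ (measurable_cube L)); apply: eq_integrable => // x _.
rewrite patchE; case: ifPn => // xL /=; rewrite (fL L) // => xL'.
by move: xL; rewrite mem_set.
Qed.

Lemma bcontD (T : topologicalType) (f g : T -> R) : bcont f -> bcont g -> bcont (fun x => f x + g x).
Proof.
move=> [cf [B fB]] [cg [C gC]]; split; first by move=> x; apply: cvgD; [exact: cf|exact: cg].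
by exists (B + C) => x; rewrite (le_trans (ler_normD _ _)) // lerD.
Qed.

Lemma bcontM (T : topologicalType) (f g : T -> R) : bcont f -> bcont g -> bcont (fun x => f x * g x).
Proof.
move=> [cf [B fB]] [cg [C gC]]; split; first by move=> x; apply: cvgM; [exact: cf|exact: cg].
by exists (B * C) => x; rewrite normrM ler_pM.
Qed.

Lemma bcont_cst (T : topologicalType) (c : R) : bcont (fun _ : T => c).
Proof. by split; [move=> x; exact: cvg_cst|exists `|c|]. Qed.

Lemma ccontD f g : ccont f -> ccont g -> ccont (fun x => f x + g x).
Proof.
move=> [bf [L L0 fL]] [bg [M M0 gM]]; split; first exact: bcontD.
exists (Num.max L M) => [|x i]; first by rewrite lt_max L0.
by rewrite ge_max => /andP[Lx Mx]; rewrite (fL x i) // (gM x i) // addr0.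
Qed.

Lemma ccontM f g : ccont f -> bcont g -> ccont (fun x => f x * g x).
Proof.
move=> [bf [L L0 fL]] bg; split; first exact: bcontM.
by exists L => // x i xL; rewrite (fL x i) // mul0r.
Qed.

Lemma ccontZ (c : R) f : ccont f -> ccont (fun x => c * f x).
Proof.
move=> cf; rewrite (_ : (fun _ => _) = fun x => f x * c).
  by apply: ccontM => //; exact: bcont_cst.
by apply/funext => x; rewrite mulrC.
Qed.

Lemma ccontB f g : ccont f -> ccont g -> ccont (fun x => f x - g x).
Proof.
move=> cf cg; rewrite (_ : (fun _ => _) = fun x => f x + -1 * g x).
  by apply: ccontD => //; exact: ccontZ.
by apply/funext => x; rewrite mulN1r.
Qed.

Lemma ccontX f k : ccont f -> ccont (fun x => f x ^+ k.+1).
Proof.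
move=> cf; elim: k => [|k IH].
  by rewrite (_ : (fun _ => _) = f) //; apply/funext => x; rewrite expr1.
rewrite (_ : (fun _ => _) = fun x => f x * f x ^+ k.+1).
  by apply: ccontM => //; case: IH.
by apply/funext => x; rewrite exprS.
Qed.

Lemma ccont0 : ccont (fun=> 0).
Proof. by split; [exact: bcont_cst|exists 1]. Qed.

Lemma ccont_sum (I : Type) (r : seq I) (F : I -> 'rV[R]_n -> R) : (forall i, ccont (F i)) ->
  ccont (fun x => \sum_(i <- r) F i x).
Proof.
move=> cF; elim: r => [|i r IH].
  by rewrite (_ : (fun _ => _) = fun=> 0); [exact: ccont0|apply/funext => x; rewrite big_nil].
rewrite (_ : (fun _ => _) = fun x => F i x + \sum_(j <- r) F j x); first exact: ccontD.
by apply/funext => x; rewrite big_cons.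
Qed.

Lemma coord_row_continuous i : continuous (fun x : 'rV[R]_n => x ord0 i).
Proof.
move=> x U /nbhs_ballP[e e0 eU]; apply/nbhs_ballP; exists e => // y xy; apply: eU.
exact: (proj1 (rV_ballP x y e0) xy).
Qed.

Lemma ccont_coord f i : ccont f -> ccont (fun x : 'rV[R]_n => x ord0 i * f x).
Proof.
move=> [[cf [B fB]] [L L0 fL]]; split; last first.
  by exists L => // x j xL; rewrite (fL x j) // mulr0.
split; first by move=> x; exact: (cvgM (@coord_row_continuous i x) (cf x)).
exists (L * B) => x; have [xL|xL] := leP L `|x ord0 i|.
  by rewrite (fL x i) // mulr0 normr0 mulr_ge0 ?(ltW L0) // (le_trans _ (fB x)).
by rewrite normrM ler_pM // ltW.
Qed.

Lemma euclid_sqr (x : 'rV[R]_n) : euclid x ^+ 2 = \sum_(i < n) x ord0 i ^+ 2.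
Proof. by rewrite sqr_sqrtr // sumr_ge0 // => i _; exact: sqr_ge0. Qed.

Lemma ccont_euclid f : ccont f -> ccont (fun x => euclid x ^+ 2 * f x).
Proof.
move=> cf; rewrite (_ : (fun _ => _) = fun x : 'rV[R]_n => \sum_(i < n) x ord0 i * (x ord0 i * f x)).
  by apply: ccont_sum => i; do 2 apply: ccont_coord.
by apply/funext => x; rewrite euclid_sqr mulr_suml; apply: eq_bigr => i _; rewrite expr2 mulrA.
Qed.

Lemma cintD f g : ccont f -> ccont g ->
  \int[mu]_x (f x + g x) = \int[mu]_x f x + \int[mu]_x g x.
Proof. by move=> cf cg; rewrite RintegralD //; exact: ccont_integrable. Qed.

Lemma cintZ (c : R) f : ccont f -> \int[mu]_x (c * f x) = c * \int[mu]_x f x.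
Proof. by move=> cf; rewrite RintegralZl //; exact: ccont_integrable. Qed.

Lemma cint_le f g : ccont f -> ccont g -> (forall x, f x <= g x) ->
  \int[mu]_x f x <= \int[mu]_x g x.
Proof. by move=> cf cg fg; rewrite le_Rintegral //; exact: ccont_integrable. Qed.

Lemma cint_sum (I : Type) (r : seq I) (F : I -> 'rV[R]_n -> R) : (forall i, ccont (F i)) ->
  \int[mu]_x (\sum_(i <- r) F i x) = \sum_(i <- r) \int[mu]_x F i x.
Proof.
move=> cF; elim: r => [|i r IH].
  rewrite big_nil (@eq_Rintegral _ _ _ _ _ (fun=> 0)) => [|x _]; last by rewrite big_nil.
  by rewrite Rintegral_cst // mul0r.
rewrite big_cons -IH -cintD //; last exact: ccont_sum.
by apply: eq_Rintegral => x _; rewrite big_cons.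
Qed.

Definition C1c f := ccont f /\
  forall i, (forall x, derivable f x (delta_mx ord0 i)) /\ ccont (partial i f).

Lemma C1c_C1b f : C1c f -> C1b f.
Proof. by move=> [[bf _] df]; split => // i; have [? []] := df i. Qed.

Lemma partialM f g i x : derivable f x (delta_mx ord0 i) -> derivable g x (delta_mx ord0 i) ->
  partial i (fun y => f y * g y) x = f x * partial i g x + g x * partial i f x.
Proof. by move=> df dg; rewrite /partial; exact: deriveM. Qed.

Lemma C1cM f g : C1c f -> C1c g -> C1c (fun x => f x * g x).
Proof.
move=> [cf df] [cg dg]; have [bf _] := cf; have [bg _] := cg; split; first exact: ccontM.
move=> i; have [dfi cfi] := df i; have [dgi cgi] := dg i.
split; first by move=> x; exact: derivableM.
rewrite (_ : partial i _ = fun x => f x * partial i g x + g x * partial i f x).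
  have [bfi _] := cfi; have [bgi _] := cgi.
  by apply: ccontD; apply: ccontM.
by apply/funext => x; exact: partialM.
Qed.

Lemma cint_partial f i : C1c f -> \int[mu]_x partial i f x = 0.
Proof.
move=> Cf; have [cf /(_ i)[_ cfi]] := Cf.
have [L L0 fL] := ccont_cube cfi; have [_ [M M0 fM]] := cf.
(* The cube must contain the support of the derivative, to carry the whole integral, and have faces
   on which [f] vanishes. *)
have K0 : 0 < Num.max L M by rewrite lt_max L0.
rewrite (integral_cube (fL (Num.max L M) _)); last by rewrite le_max lexx.
apply: integral_partial_eq0; [by rewrite pmulrn_lgt0|exact: C1c_C1b|].
have h : M <= `|Num.max L M| by rewrite gtr0_norm // le_max lexx orbT.
by move=> x [xi|xi]; apply: (fM x i); rewrite xi ?normrN // mulr2n addrA addNr add0r.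
Qed.

Lemma integration_by_parts_row f i : C1c f -> C1c (partial i f) ->
  \int[mu]_x (f x * partial i (partial i f) x) = - \int[mu]_x partial i f x ^+ 2.
Proof.
move=> Cf Cfi; have [cf /(_ i)[dfi cfi]] := Cf; have [_ /(_ i)[dfii cfii]] := Cfi.
have := cint_partial i (C1cM Cf Cfi).
rewrite (@eq_Rintegral _ _ _ _ _ (fun x => f x * partial i (partial i f) x + partial i f x ^+ 2)).
  rewrite cintD; [by move/eqP; rewrite addr_eq0 => /eqP|apply: ccontM => //|exact: ccontX].
  by case: cfii.
by move=> x _; rewrite partialM // expr2.
Qed.

Lemma test_fun_partial phi i : test_fun phi -> test_fun (partial i phi).
Proof.
move=> [Cphi cphi]; split.
  by move=> k; have [_ /(_ i)[]] := Cphi k.+1.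
apply: (subclosed_compact _ cphi); first exact: closed_closure.
apply: (@subset_trans _ (closure (closure [set x | phi x != 0]))); last first.
  by move/closure_id: (@closed_closure _ [set x | phi x != 0]) => <-.
(* If [phi] vanishes near [x], its difference quotients at [x] are eventually 0; so differentiation
   does not enlarge the support. *)
apply: closure_subset => x /= px; apply: contrapT => nx.
have [U Ux U0] : exists2 U, nbhs x U & forall y, U y -> phi y = 0.
  have /existsNP[U /not_implyP[Ux /set0P/negP/negPn/eqP U0]] := nx.
  exists U => // y Uy; apply/eqP; apply/negPn/negP => py.
  by have : set0 y by rewrite -U0; split.
move/eqP: px; apply; rewrite /partial /derive.
have x0 : phi x = 0 by apply: U0; exact: nbhs_singleton.
apply: cvg_lim => //; apply: cvg_near_cst.
have : (h *: (delta_mx ord0 i : 'rV[R]_n) + x) @[h --> (0:R)] --> 0 *: delta_mx ord0 i + x.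
  by apply: cvgD; [apply: cvgZr_tmp; exact: cvg_id|exact: cvg_cst].
rewrite scale0r add0r => /(_ _ Ux) h0; rewrite /dnbhs near_withinE.
apply: (@filterS _ (nbhs (0 : R)) _ _ _ _ h0) => h /= Uh _.
by rewrite x0 subr0 U0 // scaler0.
Qed.

Lemma test_fun_ccont phi : test_fun phi -> ccont phi.
Proof.
move=> [Cphi cphi]; have cont : continuous phi := Cphi 0%N.
have supp x : phi x != 0 -> closure [set x | phi x != 0] x.
  by move=> px; apply: subset_closure.
have bnd : bcont phi.
  split => //; have : compact (phi @` closure [set x | phi x != 0]).
    by apply: continuous_compact => //; exact: continuous_subspaceT.
  move/compact_bounded => [B [_ hB]]; exists (`|B| + 1) => x.
  have [->|px] := eqVneq (phi x) 0; first by rewrite normr0 addr_ge0.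
  have BB : B < `|B| + 1 by rewrite (le_lt_trans (ler_norm B)) // ltrDl.
  by apply: (hB _ BB (phi x)); exists x => //; exact: supp.
split => //; have [B [_ hB]] := compact_bounded cphi.
exists (`|B| + 2) => [|x i xB]; first by rewrite ltr_wpDl.
apply/eqP/negPn/negP => /supp px.
have BB : B < `|B| + 1 by rewrite (le_lt_trans (ler_norm B)) // ltrDl.
have := hB _ BB x px; apply/negP; rewrite -ltNge.
apply: (@lt_le_trans _ _ `|x ord0 i|); first by lra.
by rewrite [leRHS]/Num.Def.normr /= mx_normrE; apply/bigmax_geP; right => /=; exists (ord0, i).
Qed.

Lemma test_fun_C1c phi : test_fun phi -> C1c phi.
Proof.
move=> tphi; split=> [|i]; first exact: test_fun_ccont.
split; last exact/test_fun_ccont/test_fun_partial.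
by case: tphi => Cphi _; have [_ /(_ i)[]] := Cphi 1%N.
Qed.

Definition cell (L : R) (N : nat) (k : {ffun 'I_n -> 'I_N}) : set 'rV[R]_n :=
  box (fun i => - L + L *+ 2 / N%:R * (k i)%:R) (L *+ 2 / N%:R).

(** The index is recovered from [x] as the integer part of [(x ord0 i + L) / e], with [e] the side
    of the cells; [cube_cell] uses the same formula. *)
Lemma cell_inj (L : R) N (k k' : {ffun 'I_n -> 'I_N}) x : 0 < L -> (0 < N)%N ->
  cell L k x -> cell L k' x -> k = k'.
Proof.
move=> L0 N0; have e0 : 0 < L *+ 2 / N%:R by rewrite divr_gt0 ?pmulrn_lgt0 ?ltr0n.
rewrite /cell; move: (L *+ 2 / N%:R) e0 => e e0 kx k'x.
have H (j : {ffun 'I_n -> 'I_N}) : box (fun i => - L + e * (j i)%:R) e x ->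
    forall i, Num.truncn ((x ord0 i + L) / e) = j i.
  move=> jx i; apply: truncn_def; have /andP[h1 h2] := jx i.
  rewrite ler_pdivlMr // ltr_pdivrMr // mulrC -natr1; apply/andP; split; lra.
by apply/ffunP => i; apply: val_inj; rewrite /= -(H k kx) -(H k' k'x).
Qed.

Lemma cube_cell (L : R) N x : 0 < L -> (0 < N)%N -> cube L x ->
  exists k : {ffun 'I_n -> 'I_N}, cell L k x.
Proof.
move=> L0 N0 xL; have NR : 0 < N%:R :> R by rewrite ltr0n.
have e0 : 0 < L *+ 2 / N%:R by rewrite divr_gt0 ?pmulrn_lgt0.
have eN : L *+ 2 / N%:R * N%:R = L *+ 2 by rewrite divfK // gt_eqF.
rewrite /cell; move: (L *+ 2 / N%:R) e0 eN => e e0 eN.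
have H i : (Num.truncn ((x ord0 i + L) / e) < N)%N.
  rewrite truncn_lt_nat; last by rewrite divr_ge0 ?(ltW e0) //; have /andP[h1 h2] := xL i; lra.
  by rewrite ltr_pdivrMr // mulrC eN; have /andP[h1 h2] := xL i; lra.
exists [ffun i => Ordinal (H i)] => i; rewrite ffunE /=.
have /andP[h1 h2] := xL i.
have h0 : 0 <= (x ord0 i + L) / e by rewrite divr_ge0 ?(ltW e0) //; lra.
have /andP[h3 h4] := truncn_itv h0.
move: h3 h4; rewrite ler_pdivlMr // ltr_pdivrMr // -natr1 => h3 h4.
by apply/andP; split; lra.
Qed.

Lemma measurable_cell (L : R) N (k : {ffun 'I_n -> 'I_N}) : measurable (cell L k).
Proof. exact: measurable_box. Qed.

Lemma sum_cell_le1 (L : R) N x : 0 < L -> (0 < N)%N ->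
  \sum_(k : {ffun 'I_n -> 'I_N}) \1_(cell L k) x <= 1 :> R.
Proof.
move=> L0 N0; have [[k kx]|nk] := pselect (exists k : {ffun 'I_n -> 'I_N}, cell L k x).
  rewrite (bigD1 k) //= big1 => [|j jk].
    by rewrite addr0 indicE mem_set.
  rewrite indicE memNset // => jx; move/eqP: jk; apply; exact: cell_inj jx kx.
by rewrite big1 // => k _; rewrite indicE memNset // => kx; apply: nk; exists k.
Qed.

(** Inside the cube, the Poincare inequality is summed over the cells. Outside it, [euclid x >= L],
    so the second moment controls the tail. The last two terms are small for large [L], then large
    [N]; the first involves finitely many linear functionals of [g]. *)
Lemma rellich_estimate g (L : R) (N : nat) : C1c g -> 0 < L -> (0 < N)%N ->
  \int[mu]_x g x ^+ 2 <=
    \sum_(k : {ffun 'I_n -> 'I_N})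
      ((L *+ 2 / N%:R) ^+ n)^-1 * (\int[mu]_(x in cell L k) g x) ^+ 2 +
    (L *+ 2 / N%:R) ^+ 2 * \sum_(i < n) \int[mu]_x partial i g x ^+ 2 +
    L ^- 2 * \int[mu]_x (euclid x ^+ 2 * g x ^+ 2).
Proof.
move=> Cg L0 N0; have [cg dg] := Cg.
have cdg i : ccont (partial i g) by case: (dg i).
set e := L *+ 2 / N%:R; have e0 : 0 < e by rewrite divr_gt0 ?pmulrn_lgt0 ?ltr0n.
have mI (k : {ffun 'I_n -> 'I_N}) : bmeas (\1_(cell L k) : 'rV[R]_n -> R).
  split; first by apply: measurable_indic; exact: measurable_cell.
  by exists 1 => x; rewrite indicE; case: (_ \in _); rewrite ?normr1 ?normr0.
have cellE (h : 'rV[R]_n -> R) (k : {ffun 'I_n -> 'I_N}) :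
    \int[mu]_x (\1_(cell L k) x * h x) = \int[mu]_(x in cell L k) h x.
  rewrite [RHS]Rintegral_mkcond; apply: eq_Rintegral => x _; rewrite patchE indicE.
  by case: ifP => _; rewrite ?mul1r ?mul0r.
have iI h (k : {ffun 'I_n -> 'I_N}) : ccont h ->
    mu.-integrable setT (EFin \o (fun x => \1_(cell L k) x * h x)).
  move=> ch; have [M M0 hM] := ccont_cube ch.
  have := bmeas_integrable (measurable_cube M) (cube_lty M0) (bmeasM (mI k) (ccont_bmeas ch)).
  move/(integrable_mkcond _ (measurable_cube M)); apply: eq_integrable => // x _.
  rewrite patchE; case: ifPn => // xM /=; rewrite (hM M) ?mulr0 // => xM'.
  by move: xM; rewrite mem_set.
(* Functions cut off by a cell are not continuous, so integrability of their sum is carried through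
   the induction together with additivity. *)
have sumI h : ccont h -> mu.-integrable setT (EFin \o (fun x =>
    \sum_(k : {ffun 'I_n -> 'I_N}) \1_(cell L k) x * h x)) /\
    \int[mu]_x (\sum_(k : {ffun 'I_n -> 'I_N}) \1_(cell L k) x * h x) =
    \sum_(k : {ffun 'I_n -> 'I_N}) \int[mu]_(x in cell L k) h x.
  move=> ch; elim: (index_enum _) => [|k r [IH1 IH2]].
    rewrite big_nil (_ : (fun _ => _) = fun=> 0); last by apply/funext => x; rewrite big_nil.
    by split; [exact: ccont_integrable ccont0|rewrite Rintegral_cst // mul0r].
  rewrite big_cons -IH2 -cellE.
  rewrite (_ : (fun _ => _) = fun x => \1_(cell L k) x * h x +
      \sum_(j <- r) \1_(cell L j) x * h x); last by apply/funext => x; rewrite big_cons.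
  split; last by rewrite RintegralD //; exact: iI.
  by have := integrableD measurableT (iI h k ch) IH1.
have cg2 := ccontX 1 cg; have ce := ccont_euclid cg2.
have [i1 s1] := sumI _ cg2.
have h1 : \int[mu]_x g x ^+ 2 <= \sum_(k : {ffun 'I_n -> 'I_N}) \int[mu]_(x in cell L k) g x ^+ 2 +
    L ^- 2 * \int[mu]_x (euclid x ^+ 2 * g x ^+ 2).
  rewrite -s1 -cintZ // -RintegralD //; last exact/ccont_integrable/ccontZ.
  apply: le_Rintegral => //; first exact: ccont_integrable.
    by have := integrableD measurableT i1 (ccont_integrable (ccontZ (L ^- 2) ce)).
  move=> x _; rewrite -mulr_suml.
  have s0 : 0 <= \sum_(k : {ffun 'I_n -> 'I_N}) \1_(cell L k) x :> R by apply: sumr_ge0 => k _; rewrite indicE.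
  have [/(cube_cell L0 N0)[k kx]|/not_cube[i xi]] := pselect (cube L x).
    apply: ler_wpDr; first by apply: mulr_ge0; [rewrite invr_ge0 sqr_ge0|apply: mulr_ge0; exact: sqr_ge0].
    rewrite -[leLHS]mul1r ler_wpM2r ?sqr_ge0 // (bigD1 k) //= indicE mem_set // lerDl.
    by apply: sumr_ge0 => j _; rewrite indicE.
  apply: ler_wpDl; first by rewrite mulr_ge0 ?sqr_ge0.
  rewrite mulrA -[leLHS]mul1r ler_wpM2r ?sqr_ge0 // ler_pdivlMl ?exprn_gt0 // mulr1.
  rewrite euclid_sqr (bigD1 i) //= ler_wpDr //; first by apply: sumr_ge0 => j _; exact: sqr_ge0.
  by rewrite -[leRHS]real_normK ?num_real // lerXn2r // nnegrE // ltW.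
apply: le_trans h1 _; rewrite lerD2r.
apply: (@le_trans _ _ (\sum_(k : {ffun 'I_n -> 'I_N}) ((e ^+ n)^-1 * (\int[mu]_(x in cell L k) g x) ^+ 2 +
    e ^+ 2 * \sum_(i < n) \int[mu]_(x in cell L k) partial i g x ^+ 2))).
  by apply: ler_sum => k _; apply: poincare_box => //; exact: C1c_C1b.
rewrite big_split /= lerD2l -mulr_sumr ler_wpM2l ?sqr_ge0 // exchange_big /=.
apply: ler_sum => i _; have [i2 <-] := sumI _ (ccontX 1 (cdg i)).
apply: le_Rintegral => //; first exact/ccont_integrable/ccontX.
move=> x _; rewrite -mulr_suml -[leRHS]mul1r ler_wpM2r ?sqr_ge0 //.
exact: sum_cell_le1.
Qed.
End compactly_supported.

(** * Compactness and the Schrodinger operator *)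

Section rellich.
Variables (R : realType) (n : nat).
Local Notation mu := (lebesgue_row R n).
Local Notation E := 'rV[R]_n.
Implicit Types (f g : E -> R) (phi psi : E -> R[i]).

Definition sqint f : R := \int[mu]_x f x ^+ 2.
Definition dirichlet f : R := \sum_(i < n) sqint (partial i f).
Definition moment f : R := \int[mu]_x (euclid x ^+ 2 * f x ^+ 2).

(** The second quantity bounds the real part of the quadratic form of $-\Delta+V+d$ from below when
    $\mathrm{Re}\,V\ge c|x|^2-d$. *)
Definition energy_ball (c M : R) : set (L2 mu) :=
  [set u : L2 mu | exists phi, [/\ ctest_fun phi, {ae mu, forall x, u x = phi x},
    sqint (Cre phi) + sqint (Cim phi) <= M &
    dirichlet (Cre phi) + dirichlet (Cim phi) +
      c * (moment (Cre phi) + moment (Cim phi)) <= M]].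

Lemma sqint_ge0 f : 0 <= sqint f.
Proof. by apply: Rintegral_ge0 => x _; exact: sqr_ge0. Qed.

Lemma dirichlet_ge0 f : 0 <= dirichlet f.
Proof. by apply: sumr_ge0 => i _; exact: sqint_ge0. Qed.

Lemma moment_ge0 f : 0 <= moment f.
Proof. by apply: Rintegral_ge0 => x _; rewrite mulr_ge0 // sqr_ge0. Qed.

Lemma C1cB f g : C1c f -> C1c g -> C1c (fun x => f x - g x).
Proof.
move=> [cf df] [cg dg]; split=> [|i]; first exact: ccontB.
have [dfi cfi] := df i; have [dgi cgi] := dg i.
split; first by move=> x; exact: derivableB.
rewrite (_ : partial i _ = fun x => partial i f x - partial i g x); first exact: ccontB.
by apply/funext => x; rewrite /partial; exact: deriveB.
Qed.

Lemma sqint_sub f g : ccont f -> ccont g ->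
  sqint (fun x => f x - g x) <= 2 * (sqint f + sqint g).
Proof.
move=> cf cg; have cf2 := ccontX 1 cf; have cg2 := ccontX 1 cg.
rewrite /sqint -cintD // -cintZ; last exact: ccontD.
apply: cint_le; [exact/ccontX/ccontB|exact/ccontZ/ccontD|move=> x].
by have := sqr_ge0 (f x + g x); nra.
Qed.

Lemma dirichlet_sub f g : C1c f -> C1c g ->
  dirichlet (fun x => f x - g x) <= 2 * (dirichlet f + dirichlet g).
Proof.
move=> [cf df] [cg dg]; rewrite /dirichlet -big_split mulr_sumr /=.
apply: ler_sum => i _; have [dfi cfi] := df i; have [dgi cgi] := dg i.
rewrite (_ : partial i _ = fun x => partial i f x - partial i g x); first exact: sqint_sub.
by apply/funext => x; rewrite /partial; exact: deriveB.
Qed.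

Lemma moment_sub f g : ccont f -> ccont g ->
  moment (fun x => f x - g x) <= 2 * (moment f + moment g).
Proof.
move=> cf cg; have cf2 := ccont_euclid (ccontX 1 cf); have cg2 := ccont_euclid (ccontX 1 cg).
rewrite /moment -cintD // -cintZ; last exact: ccontD.
apply: cint_le; [exact/ccont_euclid/ccontX/ccontB|exact/ccontZ/ccontD|move=> x].
have := mulr_ge0 (sqr_ge0 (euclid x)) (sqr_ge0 (f x + g x)).
by move: (euclid x ^+ 2) => w; nra.
Qed.

Lemma rnorm_sqr_test (u : L2 mu) phi : ctest_fun phi -> {ae mu, forall x, u x = phi x} ->
  rnorm u ^+ 2 = sqint (Cre phi) + sqint (Cim phi).
Proof.
move=> [tr ti] uphi; have cr := test_fun_ccont tr; have ci := test_fun_ccont ti.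
have [[mr _] [mi _]] := (ccont_bmeas cr, ccont_bmeas ci).
have cr2 := ccontX 1 cr; have ci2 := ccontX 1 ci.
rewrite /sqint -cintD //.
apply: EFin_inj; rewrite (rnorm_sqr_ae (f := phi)) //.
rewrite fineK; first by apply: eq_integral => x _; rewrite /ip -!expr2.
by apply: (integrable_fin_num measurableT) => //; exact/ccont_integrable/ccontD.
Qed.

Lemma ctest_funB phi psi : ctest_fun phi -> ctest_fun psi ->
  C1c (fun x => Cre phi x - Cre psi x) /\ C1c (fun x => Cim phi x - Cim psi x).
Proof. by move=> [pr pi] [qr qi]; split; apply: C1cB; exact: test_fun_C1c. Qed.

Lemma rnorm_sqr_sub_test (u v : L2 mu) phi psi : ctest_fun phi -> ctest_fun psi ->
  {ae mu, forall x, u x = phi x} -> {ae mu, forall x, v x = psi x} ->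
  rnorm (u - v) ^+ 2 = sqint (fun x => Cre phi x - Cre psi x) + sqint (fun x => Cim phi x - Cim psi x).
Proof.
move=> tphi tpsi uphi vpsi; have [[cr _] [ci _]] := ctest_funB tphi tpsi.
have [[mr _] [mi _]] := (ccont_bmeas cr, ccont_bmeas ci).
have cr2 := ccontX 1 cr; have ci2 := ccontX 1 ci.
rewrite /sqint -cintD //.
apply: EFin_inj; rewrite (rnorm_sqr_ae (f := fun x => phi x - psi x)).
- rewrite fineK.
    by apply: eq_integral => x _; rewrite /ip -!expr2 /Cre /Cim; case: (phi x) (psi x) => [? ?] [? ?].
  by apply: (integrable_fin_num measurableT) => //; exact/ccont_integrable/ccontD.
- split.
    by rewrite (_ : (fun _ => _) = fun x => Cre phi x - Cre psi x) //; apply/funext => x;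
      rewrite /Cre; case: (phi x) (psi x) => [? ?] [? ?].
  by rewrite (_ : (fun _ => _) = fun x => Cim phi x - Cim psi x) //; apply/funext => x;
    rewrite /Cim; case: (phi x) (psi x) => [? ?] [? ?].
have -> : u - v = u + (-1) *: v by rewrite scaleN1r.
apply: filterS2 (filterI uphi vpsi) (filterI (L2_funD u (-1 *: v)) (L2_funZ (-1) v)).
by move=> x /= [ux vx] [-> ->]; rewrite ux vx mulN1r.
Qed.

(** Rounding of [[-B, B]] to bins of length [eta]. The first hypothesis makes all bin numbers at
    most [m], where [inord] loses nothing. *)
Lemma same_bin (B eta x y : R) (m : nat) : (Num.truncn (2 * B / eta) <= m)%N ->
  0 < eta -> `|x| <= B -> `|y| <= B ->
  inord (Num.truncn ((x + B) / eta)) =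
    inord (Num.truncn ((y + B) / eta)) :> 'I_m.+1 ->
  `|x - y| <= eta.
Proof.
move=> Bm eta0 xB yB.
have H z : `|z| <= B -> 0 <= (z + B) / eta /\
    (Num.truncn ((z + B) / eta) < m.+1)%N.
  rewrite ler_norml => /andP[h1 h2].
  have z0 : 0 <= (z + B) / eta by rewrite divr_ge0 ?(ltW eta0) //; lra.
  split => //; rewrite ltnS (leq_trans _ Bm) // le_truncn // ler_pM2r ?invr_gt0 //; lra.
have [x0 hx] := H x xB; have [y0 hy] := H y yB.
move=> /(congr1 val) /=; rewrite !inordK // => xy.
have /andP[x1 x2] := truncn_itv x0; have /andP[y1 y2] := truncn_itv y0.
rewrite -xy in y1 y2; move: x1 x2 y1 y2.
rewrite !ler_pdivlMr // !ltr_pdivrMr // -natr1.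
move: (Num.truncn _)%:R => k x1 x2 y1 y2.
by rewrite ler_norml; apply/andP; split; lra.
Qed.

(** Cauchy-Schwarz bounds the square of the integral by [e ^+ n * M], with [e] the side of the cell,
    and [|x| <= x ^+ 2 + 1] avoids a square root. *)
Lemma cell_int_bound f (L : R) N (k : {ffun 'I_n -> 'I_N}) (M : R) : ccont f -> 0 < L -> (0 < N)%N ->
  sqint f <= M -> `|\int[mu]_(x in cell L k) f x| <= (L *+ 2 / N%:R) ^+ n * M + 1.
Proof.
move=> cf L0 N0 fM; have e0 : 0 < L *+ 2 / N%:R by rewrite divr_gt0 ?pmulrn_lgt0 ?ltr0n.
set e := L *+ 2 / N%:R in e0 *; have en0 : 0 < e ^+ n by rewrite exprn_gt0.
have cellfin : (mu (cell L k) < +oo)%E by exact: lebesgue_row_boxlty.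
have cellmu : mu (cell L k) = (e ^+ n)%:E by exact: lebesgue_row_boxco.
have := bint_cauchy_schwarz (measurable_cell L k) cellfin en0 cellmu (ccont_bmeas cf).
set x := \int[mu]_(x in cell L k) f x => h.
have h2 : \int[mu]_(x in cell L k) f x ^+ 2 <= M.
  apply: le_trans fM; have i2 := ccont_integrable (ccontX 1 cf).
  have ic := integrableS measurableT (measurable_cell L k) (@subsetT _ _) i2.
  rewrite /sqint /Rintegral fine_le //.
  - exact: (integrable_fin_num (measurable_cell L k)).
  - exact: (integrable_fin_num measurableT).
  apply: ge0_subset_integral => //; first exact: measurable_cell.
  - exact: measurable_int i2.
  - by move=> y _; rewrite lee_fin sqr_ge0.
have h3 : x ^+ 2 <= e ^+ n * M by apply: le_trans h _; rewrite ler_wpM2l ?(ltW en0).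
rewrite -(real_normK (num_real x)) in h3; have := normr_ge0 x; nra.
Qed.

Lemma energy_bounds (c M M1 r m : R) : 0 < c -> M <= M1 -> 0 <= r -> 0 <= m ->
  r + c * m <= M -> r <= M1 /\ m <= M1 / c.
Proof.
move=> c0 MM1 r0 m0 rm; have cm := mulr_ge0 (ltW c0) m0.
by split; [lra|rewrite ler_pdivlMr // mulrC; lra].
Qed.

Lemma sum_twice_le (p q r s M : R) : p + q <= M -> r + s <= M ->
  2 * (p + r) + 2 * (q + s) <= 4 * M.
Proof. lra. Qed.

Lemma sum_thirds_le (s1 s2 q1 q2 m1 m2 x : R) : s1 <= x / 6 -> s2 <= x / 6 ->
  q1 + q2 <= x / 3 -> m1 + m2 <= x / 3 -> (s1 + q1 + m1) + (s2 + q2 + m2) <= x.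
Proof. lra. Qed.

(** The colour of a point is the list of its rounded cell integrals, real and imaginary. For two
    points of one colour, [rellich_estimate] applied to the difference of their test functions has a
    small first term. *)
Lemma energy_ball_compact (c M : R) : 0 < c -> compact (closure (energy_ball c M)).
Proof.
move=> c0; apply: precompact_colouring => [|d d0]; first exact: L2_geo_complete.
have M0 : 0 < `|M| + 1 by rewrite ltr_wpDl.
(* [L], [N] and [eta] make the tail, gradient and cell terms of
   [rellich_estimate] at most [d ^ 2 / 3] each. *)
set M1 := `|M| + 1 in M0; have MM1 : M <= M1 by rewrite (le_trans (ler_norm M)) // lerDl.
pose L := 12 * M1 / (c * d ^+ 2) + 1.
have d2 : 0 < d ^+ 2 by rewrite exprn_gt0.
have cd : 0 < c * d ^+ 2 by rewrite mulr_gt0.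
have L0 : 0 < L by rewrite ltr_wpDl // divr_ge0 ?mulr_ge0 ?ltW.
(* The factor 4 comes from applying $(f-g)^2\le2f^2+2g^2$ to two points with the same bound. The
   summand 1 in [L] gives [L <= L ^+ 2]. *)
have hL : L ^- 2 * (4 * (M1 / c)) <= d ^+ 2 / 3.
  rewrite ler_pdivrMl ?exprn_gt0 //.
  have h1 : 12 * M1 <= c * d ^+ 2 * L.
    have -> : c * d ^+ 2 * L = 12 * M1 + c * d ^+ 2 by rewrite /L; field; rewrite !gt_eqF.
    by rewrite lerDl ltW.
  have h2 : L <= L ^+ 2.
    by rewrite expr2 ler_peMl ?(ltW L0) // /L lerDr divr_ge0 ?mulr_ge0 ?ltW.
  have h3 : 12 * M1 <= c * d ^+ 2 * L ^+ 2 by apply: le_trans h1 _; rewrite ler_wpM2l ?(ltW cd).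
  rewrite -[leLHS]mulrC mulrA -mulrA ?ler_pdivrMr //.
  rewrite mulrAC ler_pdivrMr //; move: h3; set a := L ^+ 2; set b := d ^+ 2; nra.
have [N N0 hN] : exists2 N : nat, (0 < N)%N & 48 * L ^+ 2 * M1 / d ^+ 2 <= N%:R.
  by exists (Num.truncn (48 * L ^+ 2 * M1 / d ^+ 2)).+1; rewrite // ltW // truncnS_gt.
have NR : 1 <= N%:R :> R by rewrite ler1n.
pose e := L *+ 2 / N%:R.
have e0 : 0 < e by rewrite divr_gt0 ?pmulrn_lgt0 ?ltr0n.
have he : e ^+ 2 * (4 * M1) <= d ^+ 2 / 3.
  have hN2 : 48 * L ^+ 2 * M1 / d ^+ 2 <= N%:R ^+ 2.
    by apply: le_trans hN _; rewrite expr2 ler_peMl // (le_trans _ NR).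
  move: hN2; rewrite ler_pdivrMr // => hN2.
  rewrite /e expr_div_n mulrAC ler_pdivrMr ?exprn_gt0 ?(lt_le_trans _ NR) //.
  rewrite -mulr_natl exprMn; move: hN2; move: (N%:R ^+ 2) (L ^+ 2) (d ^+ 2) => ? ? ?; nra.
pose K := {ffun 'I_n -> 'I_N}.
(* Summed over the cells with weight $e^{-n}$ this stays below $d^2/6$, once for the real and once
   for the imaginary part. *)
pose eta2 := d ^+ 2 * e ^+ n / (6 * (#|K|%:R + 1)).
have en0 : 0 < e ^+ n by rewrite exprn_gt0.
have K1 : 0 < #|K|%:R + 1 :> R by rewrite ltr_wpDl.
have eta20 : 0 < eta2 by rewrite divr_gt0 ?mulr_gt0.
pose eta := Num.sqrt eta2; have eta0 : 0 < eta by rewrite sqrtr_gt0.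
pose B := e ^+ n * M1 + 1.
pose P (u : L2 mu) phi := [/\ ctest_fun phi, {ae mu, forall x, u x = phi x},
    sqint (Cre phi) + sqint (Cim phi) <= M1,
    dirichlet (Cre phi) + dirichlet (Cim phi) <= M1 &
    moment (Cre phi) + moment (Cim phi) <= M1 / c].
(* A representing test function is fixed for each point, because the colour is computed from it; the
   value 0 off the energy ball is arbitrary. *)
have /choice[F FP] : forall u : L2 mu, exists phi, energy_ball c M u -> P u phi.
  move=> u; have [[phi [t1 t2 t3 t4]]|nu] := pselect (energy_ball c M u); last by exists (fun=> 0).
  have [r m] := (addr_ge0 (dirichlet_ge0 (Cre phi)) (dirichlet_ge0 (Cim phi)),
    addr_ge0 (moment_ge0 (Cre phi)) (moment_ge0 (Cim phi))).
  have [t5 t6] := energy_bounds c0 MM1 r m t4.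
  by exists phi => _; split => //; exact: le_trans MM1.
have [m Bm] : exists m : nat, (Num.truncn (2 * B / eta) <= m)%N by exists (Num.truncn (2 * B / eta)).
pose bin (x : R) : 'I_m.+1 := inord (Num.truncn ((x + B) / eta)).
exists {ffun K * bool -> 'I_m.+1}.
exists (fun u => [ffun p : K * bool => bin (\int[mu]_(x in cell L p.1)
  (if p.2 then Cre (F u) x else Cim (F u) x))]).
move=> u v Su Sv uv.
have [tu ue u1 u2 u3] := FP u Su; have [tv ve v1 v2 v3] := FP v Sv.
have [ur ui] := (test_fun_C1c (proj1 tu), test_fun_C1c (proj2 tu)).
have [vr vi] := (test_fun_C1c (proj1 tv), test_fun_C1c (proj2 tv)).
have [[cur _] [cui _] [cvr _] [cvi _]] := And4 ur ui vr vi.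
have [Cr Ci] := ctest_funB tu tv.
have close (b : bool) (k : K) : (\int[mu]_(x in cell L k) (if b then Cre (F u) x - Cre (F v) x
    else Cim (F u) x - Cim (F v) x)) ^+ 2 <= eta2.
  have := congr1 (fun h : {ffun _ -> _} => h (k, b)) uv; rewrite !ffunE /=.
  have s1 := sqint_ge0 (Cre (F u)); have s2 := sqint_ge0 (Cim (F u)).
  have s3 := sqint_ge0 (Cre (F v)); have s4 := sqint_ge0 (Cim (F v)).
  have cellfin : (mu (cell L k) < +oo)%E by exact: lebesgue_row_boxlty.
  have mcell := measurable_cell L k.
  have fin (f g : E -> R) : ccont f -> ccont g -> sqint f <= M1 -> sqint g <= M1 ->
      bin (\int[mu]_(x in cell L k) f x) = bin (\int[mu]_(x in cell L k) g x) ->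
      (\int[mu]_(x in cell L k) (f x - g x)) ^+ 2 <= eta2.
    move=> cf cg fM gM; rewrite (bintB mcell cellfin (ccont_bmeas cf) (ccont_bmeas cg)).
    move/(same_bin Bm eta0 (cell_int_bound k cf L0 N0 fM) (cell_int_bound k cg L0 N0 gM)) => h.
    have -> : eta2 = eta ^+ 2 by rewrite sqr_sqrtr // ltW.
    by rewrite -[leLHS]real_normK ?num_real // lerXn2r // nnegrE ltW.
  have [f1 f2] : sqint (Cre (F u)) <= M1 /\ sqint (Cim (F u)) <= M1.
    by split; apply: le_trans u1; rewrite ?lerDl ?lerDr.
  have [f3 f4] : sqint (Cre (F v)) <= M1 /\ sqint (Cim (F v)) <= M1.
    by split; apply: le_trans v1; rewrite ?lerDl ?lerDr.
  by case: b => /=; apply: fin.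
suff H : rnorm (u - v) ^+ 2 <= d ^+ 2.
  by rewrite -ler_sqr ?nnegrE ?rnorm_ge0 // ltW.
rewrite (rnorm_sqr_sub_test tu tv ue ve).
have sum_le (b : bool) : \sum_(k : K) (e ^+ n)^-1 * (\int[mu]_(x in cell L k)
    (if b then Cre (F u) x - Cre (F v) x else Cim (F u) x - Cim (F v) x)) ^+ 2 <= d ^+ 2 / 6.
  apply: (@le_trans _ _ (\sum_(k : K) (e ^+ n)^-1 * eta2)).
    by apply: ler_sum => k _; rewrite ler_wpM2l ?invr_ge0 ?(ltW en0).
  rewrite sumr_const (_ : _ *+ _ = d ^+ 2 / 6 * (#|K|%:R / (#|K|%:R + 1))); last first.
    rewrite -[LHS]mulr_natr /eta2; move: (#|K|%:R) K1 (e ^+ n) en0 => y y0 z z0.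
    by field; rewrite !gt_eqF.
  by rewrite ler_piMr ?divr_ge0 ?sqr_ge0 // ler_pdivrMr // mul1r lerDl.
have R1 := rellich_estimate Cr L0 N0; have R2 := rellich_estimate Ci L0 N0.
have D1 := dirichlet_sub ur vr; have D2 := dirichlet_sub ui vi.
have E1 := moment_sub cur cvr; have E2 := moment_sub cui cvi.
have P1 : e ^+ 2 * (dirichlet (fun x => Cre (F u) x - Cre (F v) x) +
    dirichlet (fun x => Cim (F u) x - Cim (F v) x)) <= e ^+ 2 * (4 * M1).
  by rewrite ler_wpM2l ?sqr_ge0 //; apply: le_trans (lerD D1 D2) (sum_twice_le u2 v2).
have P2 : L ^- 2 * (moment (fun x => Cre (F u) x - Cre (F v) x) +
    moment (fun x => Cim (F u) x - Cim (F v) x)) <= L ^- 2 * (4 * (M1 / c)).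
  by rewrite ler_wpM2l ?invr_ge0 ?sqr_ge0 //; apply: le_trans (lerD E1 E2) (sum_twice_le u3 v3).
have {}P1 := le_trans P1 he; have {}P2 := le_trans P2 hL.
rewrite mulrDr in P1; rewrite mulrDr in P2.
exact: le_trans (lerD R1 R2) (sum_thirds_le (sum_le true) (sum_le false) P1 P2).
Qed.
End rellich.

(** * The energy estimate and its passage to the closure *)

Section schrodinger_energy.
Variables (R : realType) (n : nat).
Local Notation mu := (lebesgue_row R n).
Local Notation E := 'rV[R]_n.
Variables (V : E -> R[i]) (c d : R).
Hypothesis V_bound : {ae mu, forall x, c * euclid x ^+ 2 - d <= complex.Re (V x)}.

Lemma ae_le_Rintegral (f g : E -> R) : mu.-integrable setT (EFin \o f) ->
  mu.-integrable setT (EFin \o g) -> {ae mu, forall x, f x <= g x} ->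
  \int[mu]_x f x <= \int[mu]_x g x.
Proof.
move=> fi gi fg; rewrite -subr_ge0 -RintegralB //.
have mgf : measurable_fun setT (fun x => g x - f x).
  apply: measurable_funB; first by apply/measurable_EFinP; exact: measurable_int gi.
  by apply/measurable_EFinP; exact: measurable_int fi.
rewrite /Rintegral (ae_eq_integral (EFin \o (fun x => `|g x - f x|))) //.
- by apply: Rintegral_ge0.
- exact/measurable_EFinP.
- exact/measurable_EFinP/measurableT_comp.
by apply: filterS fg => x fgx _; rewrite /= ger0_norm // subr_ge0.
Qed.

Lemma sqint_laplacian f : test_fun f -> \int[mu]_x (f x * laplacian f x) = - dirichlet f.
Proof.
move=> tf; have Cf := test_fun_C1c tf; have [cf _] := Cf; have [bf _] := cf.
have Cfi i := test_fun_C1c (test_fun_partial i tf).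
have c2 i : ccont (partial i (partial i f)) by have [_ /(_ i)[]] := Cfi i.
rewrite (@eq_Rintegral _ _ _ _ _ (fun x => \sum_(i < n) f x * partial i (partial i f) x)).
  rewrite cint_sum => [|i]; last by apply: ccontM => //; have [] := c2 i.
  rewrite /dirichlet -sumrN; apply: eq_bigr => i _.
  exact: integration_by_parts_row Cf (Cfi i).
by move=> x _; rewrite /laplacian mulr_sumr.
Qed.

(** Pointwise, [ip u w] is $-f\Delta f-g\Delta g+\mathrm{Re}V\,(f^2+g^2)$: the imaginary part of [V]
    cancels. Replacing $\mathrm{Re}V$ by its lower bound gives a continuous compactly supported
    minorant [h], whose integral is computed by parts. *)
Lemma schrodinger_min_pairing (u w : L2 mu) : schrodinger_min V (u, w) ->
  exists phi, [/\ ctest_fun phi, {ae mu, forall x, u x = phi x} &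
    dirichlet (Cre phi) + dirichlet (Cim phi) + c * (moment (Cre phi) + moment (Cim phi))
      - d * rnorm u ^+ 2 <= \int[mu]_x ip u w x].
Proof.
move=> [phi [tphi uphi wphi]]; exists phi; split => //.
have [tr ti] := tphi.
have [cr ci] := (test_fun_ccont tr, test_fun_ccont ti).
pose f := Cre phi; pose g := Cim phi.
have lapl (h : E -> R) : test_fun h -> ccont (fun x => h x * laplacian h x).
  move=> th; have [bl _] : ccont (laplacian h).
    by apply: ccont_sum => i; have [_ /(_ i)[]] := test_fun_C1c (test_fun_partial i th).
  by apply: ccontM => //; exact: test_fun_ccont.
have [cf2 cg2] := (ccontX 1 cr, ccontX 1 ci).
have [ef eg] := (ccont_euclid cf2, ccont_euclid cg2).
pose h x := (- 1) * (f x * laplacian f x + g x * laplacian g x) +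
  (c * (euclid x ^+ 2 * f x ^+ 2 + euclid x ^+ 2 * g x ^+ 2) + (- d) * (f x ^+ 2 + g x ^+ 2)).
have l1 : ccont (fun x => f x * laplacian f x + g x * laplacian g x).
  by apply: ccontD; exact: lapl.
have l2 : ccont (fun x => euclid x ^+ 2 * f x ^+ 2 + euclid x ^+ 2 * g x ^+ 2) by exact: ccontD.
have l3 : ccont (fun x => f x ^+ 2 + g x ^+ 2) by exact: ccontD.
have l4 := ccontD (ccontZ c l2) (ccontZ (- d) l3).
have ch : ccont h by exact: ccontD (ccontZ (- 1) l1) l4.
have hE : \int[mu]_x h x = dirichlet f + dirichlet g + c * (moment f + moment g) - d * rnorm u ^+ 2.
  have e1 : \int[mu]_x (f x * laplacian f x + g x * laplacian g x) =
      - dirichlet f + - dirichlet g.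
    by rewrite (cintD (lapl f tr) (lapl g ti)); congr (_ + _); exact: sqint_laplacian.
  have e2 : \int[mu]_x (euclid x ^+ 2 * f x ^+ 2 + euclid x ^+ 2 * g x ^+ 2) =
    moment f + moment g := cintD ef eg.
  have e3 : \int[mu]_x (f x ^+ 2 + g x ^+ 2) = rnorm u ^+ 2.
    by rewrite (rnorm_sqr_test tphi uphi); exact: cintD cf2 cg2.
  rewrite /h (cintD (ccontZ (- 1) l1) l4) (cintD (ccontZ c l2) (ccontZ (- d) l3)).
  rewrite (cintZ _ l1) (cintZ _ l2) (cintZ _ l3) e1 e2 e3.
  move: (dirichlet f) (dirichlet g) (moment f) (moment g) (rnorm u ^+ 2) => ? ? ? ? ?.
  by ring.
rewrite -/f -/g -hE; apply: ae_le_Rintegral.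
- exact: ccont_integrable.
- exact: integrable_ip.
apply: filterS3 uphi wphi V_bound => x /= ux wx Vx.
rewrite /ip ux wx /claplacian -/f -/g.
have fE : complex.Re (phi x) = f x by [].
have gE : complex.Im (phi x) = g x by [].
rewrite /h; case: (phi x) (V x) fE gE Vx => [p q] [Vr Vi] /= <- <- Vx.
move: (laplacian f x) (laplacian g x) (euclid x ^+ 2) Vx => lf lg e2 Vx.
have := mulr_ge0 (addr_ge0 (sqr_ge0 p) (sqr_ge0 q)) (_ : 0 <= Vr - (c * e2 - d)).
rewrite subr_ge0 => /(_ Vx); clear; nra.
Qed.

(** For fixed [h], the gap in the dissipation inequality is continuous on pairs; a strict violation
    at a point of the closed graph thus persists nearby. *)
Lemma cvg_pair_rnorm (v w : L2 mu) (h C : R) :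
  (rnorm (p.1 + h%:C *: p.2) ^+ 2 - (rnorm p.1 ^+ 2 - 2 * C * h + h ^+ 2 * rnorm p.2 ^+ 2))
    @[p --> (v, w)] -->
  rnorm (v + h%:C *: w) ^+ 2 - (rnorm v ^+ 2 - 2 * C * h + h ^+ 2 * rnorm w ^+ 2).
Proof.
have c1 : p.1 @[p --> (v, w)] --> v by exact: cvg_fst.
have c2 : p.2 @[p --> (v, w)] --> w by exact: cvg_snd.
have N (f : L2 mu * L2 mu -> L2 mu) l : f p @[p --> (v, w)] --> l ->
    rnorm (f p) ^+ 2 @[p --> (v, w)] --> rnorm l ^+ 2.
  move=> fl; have fl' : rnorm (f p) @[p --> (v, w)] --> rnorm l.
    by have := cvg_comp _ _ fl (@rnorm_continuous R (L2 mu) l).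
  by rewrite expr2; under eq_fun do rewrite expr2; exact: cvgM.
apply: cvgB; first by apply: N; apply: cvgD => //; exact: cvgZl_tmp.
apply: cvgD; first by apply: cvgB; [exact: N|exact: cvg_cst].
by apply: cvgM; [exact: cvg_cst|exact: N].
Qed.

(** Violation of the inequality, norm below [m] and distance from the closed set are open
    conditions, so a counterexample in the closure yields one, [(u, z)], in the minimal graph. The
    violation there means that the pairing is below [C], and [schrodinger_min_pairing] puts [u] in
    the energy ball. In the radius, [m ^+ 2] accounts for the norm and [|C| + d m ^+ 2] for the
    energy. *)
Lemma schrodinger_dissipative (C m : R) (v w : L2 mu) : 0 < d ->
  schrodinger V (v, w) -> rnorm v < m ->
  ~ closure (energy_ball c (m ^+ 2 + `|C| + d * m ^+ 2)) v -> forall h, 0 < h ->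
  rnorm (v - h%:C *: w) ^+ 2 <= rnorm v ^+ 2 - 2 * C * h + h ^+ 2 * rnorm w ^+ 2.
Proof.
move=> d0 Hvw vm nv h h0; rewrite leNgt; apply/negP => gt0.
set S := energy_ball _ _ in nv.
have m0 : 0 < m by apply: le_lt_trans vm; exact: rnorm_ge0.
(* [cvg_pair_rnorm] is stated for [v + h w]; it is used with [- h] and [- C], whose signs cancel in
   the product. *)
have near_pos : \forall p \near (v, w), 0 < rnorm (p.1 + (- h)%:C *: p.2) ^+ 2 -
    (rnorm p.1 ^+ 2 - 2 * (- C) * (- h) + (- h) ^+ 2 * rnorm p.2 ^+ 2).
  apply: (cvgr_gt _ (cvg_pair_rnorm (v := v) (w := w) (h := - h) (C := - C))).
  by rewrite subr_gt0 rmorphN scaleNr sqrrN -mulrA mulrNN mulrA.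
have near_m : \forall p \near (v, w), rnorm p.1 < m.
  have cm : rnorm p.1 @[p --> (v, w)] --> rnorm v.
    have c1 : p.1 @[p --> (v, w)] --> v by exact: cvg_fst.
    by have := cvg_comp _ _ c1 (@rnorm_continuous R (L2 mu) v).
  exact: (cvgr_lt _ cm).
have near_S : \forall p \near (v, w), ~ closure S p.1.
  apply: (@cvg_fst _ _ (nbhs v) (nbhs w) _ (~` closure S)).
  apply: open_nbhs_nbhs; split => //; exact: closed_openC (@closed_closure _ S).
have [[u z] [uz [[+ um] nu]]] := Hvw _ (filterI (filterI near_pos near_m) near_S).
rewrite /= in um nu *; rewrite rnorm_sqr_addZ sqrrN => pos.
have [phi [tphi uphi ipE]] := schrodinger_min_pairing uz.
move: pos ipE; move: (Rintegral _ _ _) => I pos ipE.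
have hI : 2 * h * I < 2 * h * C.
  by move: pos; move: (rnorm u ^+ 2) (rnorm z ^+ 2) => r s; clear; lra.
move: hI; rewrite ltr_pM2l ?mulr_gt0 // => IC.
have um2 : rnorm u ^+ 2 <= m ^+ 2 by rewrite lerXn2r // ?nnegrE ?rnorm_ge0 // ltW.
apply: nu; apply: subset_closure; exists phi; split => //.
  rewrite -(rnorm_sqr_test tphi uphi); apply: le_trans um2 _.
  by rewrite -addrA lerDl addr_ge0 // mulr_ge0 ?sqr_ge0 ?(ltW d0).
have dm := ler_wpM2l (ltW d0) um2; have CC := ler_norm C; have m2 := sqr_ge0 m.
move: ipE IC dm CC m2; move: (_ + _ + c * _) => Q.
move: (rnorm u ^+ 2) (m ^+ 2) (`|C|) => r s k; lra.
Qed.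
End schrodinger_energy.

Unset Implicit Arguments.

Theorem lemma2p3 (R : realType) (n : nat) (n_ge1 : (1 <= n)%N)
  (V : 'rV[R]_n -> R[i]) (DV : 'I_n -> 'rV[R]_n -> R[i])
  (V_W1infty_loc : W1infty_loc V DV)
  (V_re_ge0 : {ae lebesgue_row R n, forall x, 0 <= complex.Re (V x)})
  (a b : R) (a_gt0 : 0 < a) (b_gt0 : 0 < b)
  (DV_bound : {ae lebesgue_row R n, forall x,
     \sum_(i < n) Normc.normc (DV i x) ^+ 2 <= a + b * Normc.normc (V x) ^+ 2})
  (V_infty : forall M : R, exists r : R,
     {ae lebesgue_row R n, forall x, r <= euclid x -> M <= Normc.normc (V x)})
  (c d : R) (c_gt0 : 0 < c) (d_gt0 : 0 < d)
  (V_re_bound : {ae lebesgue_row R n, forall x,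
     c * euclid x ^+ 2 - d <= complex.Re (V x)})
  (T : R -> {linear L2 (lebesgue_row R n) -> L2 (lebesgue_row R n)})
  (T_semigroup : C0_semigroup T)
  (T_generator : generator T = opp_operator (schrodinger V)) :
  forall t : R, 0 < t -> compact_operator (T t).
Proof.
move=> t t_gt0; apply: semigroup_compact => //; first exact: L2_geo_complete.
move=> C m; exists (closure (energy_ball c (m ^+ 2 + `|C| + d * m ^+ 2))).
  exact: energy_ball_compact.
(* A pair [(v, w)] of the generator is a pair [(v, - w)] of [schrodinger V], so [v - h (- w)] is the
   vector [v + h w] of the semigroup criterion. *)
move=> v w; rewrite T_generator => Hvw vm nv h h_gt0.
have := schrodinger_dissipative V_re_bound d_gt0 Hvw vm nv h_gt0.
by rewrite scalerN opprK rnormN.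
Qed.
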